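(* Let $n\ge1$. Suppose that in the ring of symmetric functions a relation between Schur functions of total degree $n$ holds, $$\sum_{j=1}^{N}a_j\,\mathbb S_{\lambda^{(j,1)}}\mathbb S_{\lambda^{(j,2)}}\cdots\mathbb S_{\lambda^{(j,l_j)}}=0,$$ where $a_j\in\mathbb{C}$, the $\lambda^{(j,i)}$ are nonempty partitions and $\sum_{i=1}^{l_j}|\lambda^{(j,i)}|=n$ for every $j$. Then in $A_q(\mathrm{Mat}_n)$ $$\sum_{j=1}^{N}a_j\sum_{(I_1,\dots,I_{l_j})}\mathrm{Imm}_{\chi_q^{\lambda^{(j,1)}}}(X_{I_1})\,\mathrm{Imm}_{\chi_q^{\lambda^{(j,2)}}}(X_{I_2})\cdots\mathrm{Imm}_{\chi_q^{\lambda^{(j,l_j)}}}(X_{I_{l_j}})=0,$$ where the inner sum runs over all sequences $(I_1,\dots,I_{l_j})$ of pairwise disjoint increasingly ordered subsets of $[n]$ with $|I_i|=|\lambda^{(j,i)}|$ for all $i$.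
   Context: Let $q\in\mathbb{C}^\times$ be not a root of unity; $[n]=\{1,\dots,n\}$. Hecke algebra: $\mathcal H_m$ is generated by $T_1,\dots,T_{m-1}$ with $(T_i-q)(T_i+q^{-1})=0$, $T_iT_{i+1}T_i=T_{i+1}T_iT_{i+1}$, $T_iT_j=T_jT_i$ for $|i-j|>1$; $T_\sigma$ ($\sigma\in\mathfrak S_m$) is the standard basis given by reduced words. Jucys–Murphy elements: $y_1=1$, $y_k=1+(q-q^{-1})\sum_{i<k}T_{(i,k)}$. For $\lambda\vdash m$, $V^\lambda$ is the irreducible $\mathcal H_m$-module with a basis $\{v_{\mathcal T}\}$ indexed by standard Young tableaux $\mathcal T$ of shape $\lambda$ such that $y_kv_{\mathcal T}=q^{2c_k(\mathcal T)}v_{\mathcal T}$, where $c_k(\mathcal T)=j-i$ if $k$ occupies box $(i,j)$. The character element is $\chi_q^\lambda=\sum_{\sigma\in\mathfrak S_m}\mathrm{tr}_{V^\lambda}(T_{\sigma^{-1}})\,T_\sigma\in\mathcal H_m$. Action on tensors: $\mathcal H_m$ acts on $(\mathbb{C}^n)^{\otimes m}$ by $T_k\mapsto\check R_k$, the operator $\check R=q\sum_i e_{ii}\otimes e_{ii}+\sum_{i\ne j}e_{ij}\otimes e_{ji}+(q-q^{-1})\sum_{i>j}e_{ii}\otimes e_{jj}$ acting in factors $k,k+1$. Quantum coordinate algebra: $A_q(\mathrm{Mat}_n)$ is the unital algebra generated by $x_{ij}$, $1\le i,j\le n$, with relations $\check R X_1X_2=X_1X_2\check R$, $X=(x_{ij})$,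 where $X_k$ denotes $X$ in the $k$-th tensor factor. Immanants: with $|j_1,\dots,j_m\rangle=e_{j_1}\otimes\cdots\otimes e_{j_m}$ and $\langle i_1,\dots,i_m|$ the dual basis, for $I=(i_1,\dots,i_m)$ put $\mathrm{Imm}_{\chi}(X_I)=\langle i_1,\dots,i_m|\chi X_1\cdots X_m|i_1,\dots,i_m\rangle\in A_q(\mathrm{Mat}_n)$ for $\chi\in\mathcal H_m$. $\mathbb S_\lambda$ denotes the Schur function indexed by $\lambda$. *)

(* Defs.v *)
From HB Require Import structures.
From mathcomp Require Import all_boot all_order all_fingroup all_algebra.
From mathcomp Require Import complex reals finmap monalg mpoly.
(* boolp and classical_sets are not imported: their notations clash with
   those of mpoly. *)
From mathcomp Require boolp classical_sets.

Set Implicit Arguments.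
Unset Strict Implicit.
Unset Printing Implicit Defensive.

Import GRing.Theory.
Local Open Scope ring_scope.
Local Open Scope quotient_scope.

(** * Free algebras *)

Section FreeAlgebra.
Variables (K : fieldType) (I : choiceType).

Lemma malgCMC (a : K) (z : {malg K[{fmonom I}]}) : z * malgC a = a *: z.
Proof.
rewrite -mul_malgC [z]monalgE mulr_suml mulr_sumr; apply: eq_bigr => w _.
by rewrite !malgM_def !fgmulUU mulm1 mul1m mulrC.
Qed.

Definition free_alg : Type := {malg K[{fmonom I}]}.

HB.instance Definition _ := GRing.Lalgebra.on free_alg.

Definition free_gen (i : I) : free_alg := mkmalgU (fmu i) 1.

Lemma free_scalerAr (a : K) (x y : free_alg) : a *: (x * y) = x * (a *: y).
Proof.
by rewrite -[a *: y]malgCMC mulrA malgCMC.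
Qed.

HB.instance Definition _ :=
  GRing.LSemiAlgebra_isSemiAlgebra.Build K free_alg free_scalerAr.

Definition free_eval (d : nat) (f : I -> 'M[K]_d) (x : free_alg) : 'M[K]_d :=
  \sum_(w <- monalg.msupp x) monalg.mcoeff w x *: \prod_(i <- (w : seq I)) f i.

Section FreeEval.
Variables (d : nat) (f : I -> 'M[K]_d).

Let evalU (c : K) (w : fmonom I) :
  free_eval f (mkmalgU w c : {malg K[{fmonom I}]}) =
    c *: \prod_(i <- (w : seq I)) f i.
Proof.
rewrite /free_eval monalg.msuppU; case: eqP => [->|_].
  by rewrite big_seq_fset0 scale0r.
by rewrite big_seq_fset1 monalg.mcoeffUU.
Qed.

Let evalEw (D : {fset fmonom I}%fset) (x : free_alg) :
    (monalg.msupp x `<=` D)%fset -> free_eval f x =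
  \sum_(w <- D) monalg.mcoeff w x *: \prod_(i <- (w : seq I)) f i.
Proof.
move=> le; rewrite /free_eval (big_fset_incl _ le) // => w _ /mcoeff_outdom ->.
by rewrite scale0r.
Qed.

Lemma free_eval_is_linear : linear (free_eval f).
Proof.
move=> a x y; pose D := (monalg.msupp x `|` monalg.msupp y)%fset.
rewrite !(@evalEw D) ?fsubsetUl ?fsubsetUr //.
  rewrite scaler_sumr -big_split; apply: eq_bigr => w _ /=.
  by rewrite linearP scalerDl scalerA.
apply: fsubset_trans (monalg.msuppD_le _ _) _.
by apply: fsetSU; apply: monalg.msuppZ_le.
Qed.

HB.instance Definition _ :=
  GRing.isLinear.Build K free_alg 'M[K]_d *:%R (free_eval f)
    free_eval_is_linear.

Lemma free_eval_is_monoid_morphism : monoid_morphism (free_eval f).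
Proof.
split=> [|x y]; first by rewrite evalU scale1r fm1 big_nil.
rewrite [in LHS](monalg.monalgE x) [in LHS](monalg.monalgE y).
rewrite mulr_suml [X in _ = X * _]/free_eval mulr_suml linear_sum.
apply: eq_bigr => v _; rewrite mulr_sumr /free_eval mulr_sumr.
rewrite [LHS](@linear_sum _ _ _ _ (free_eval f)); apply: eq_bigr => w _ /=.
rewrite malgM_def fgmulUU evalU fmM big_cat /=.
by rewrite -[RHS]/(_ *m _) -scalemxAl -scalemxAr scalerA.
Qed.

HB.instance Definition _ :=
  GRing.isMonoidMorphism.Build free_alg 'M[K]_d (free_eval f)
    free_eval_is_monoid_morphism.

Lemma free_eval_gen (i : I) : free_eval f (free_gen i) = f i.
Proof. by rewrite evalU scale1r fmU big_seq1. Qed.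

End FreeEval.
End FreeAlgebra.

(** * Algebras given by generators and relations *)

Section Presentation.
Variables (K : fieldType) (I : choiceType) (rel : free_alg K I -> Prop).

Inductive two_sided_ideal : free_alg K I -> Prop :=
| Ideal_gen r : rel r -> two_sided_ideal r
| Ideal_0 : two_sided_ideal 0
| Ideal_D x y :
    two_sided_ideal x -> two_sided_ideal y -> two_sided_ideal (x + y)
| Ideal_Ml x y : two_sided_ideal y -> two_sided_ideal (x * y)
| Ideal_Mr x y : two_sided_ideal x -> two_sided_ideal (x * y).

Definition ideal_eq (x y : free_alg K I) : bool :=
  boolp.asbool (two_sided_ideal (x - y)).

Lemma ideal_eqP x y : reflect (two_sided_ideal (x - y)) (ideal_eq x y).
Proof. exact: boolp.asboolP. Qed.

Lemma ideal_N x : two_sided_ideal x -> two_sided_ideal (- x).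
Proof. by rewrite -mulN1r; apply: Ideal_Ml. Qed.

Lemma ideal_Z a x : two_sided_ideal x -> two_sided_ideal (a *: x).
Proof. by rewrite -mulr_algl; apply: Ideal_Ml. Qed.

Lemma ideal_eq_refl : reflexive ideal_eq.
Proof. by move=> x; apply/ideal_eqP; rewrite subrr; apply: Ideal_0. Qed.

Lemma ideal_eq_sym : ssrbool.symmetric ideal_eq.
Proof.
by move=> x y; apply/ideal_eqP/ideal_eqP => /ideal_N; rewrite opprB.
Qed.

Lemma ideal_eq_trans : transitive ideal_eq.
Proof.
move=> y x z /ideal_eqP xy /ideal_eqP yz; apply/ideal_eqP.
by rewrite -[x](subrK y) -addrA; apply: Ideal_D.
Qed.

Canonical ideal_eq_equiv :=
  EquivRel ideal_eq ideal_eq_refl ideal_eq_sym ideal_eq_trans.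

Definition pres_alg : Type := {eq_quot ideal_eq}.

HB.instance Definition _ : EqQuotient _ ideal_eq pres_alg :=
  EqQuotient.on pres_alg.
HB.instance Definition _ := Choice.on pres_alg.

Definition pres_pi (x : free_alg K I) : pres_alg := \pi_pres_alg x.

Lemma pres_piP x y : reflect (two_sided_ideal (x - y)) (pres_pi x == pres_pi y).
Proof. by rewrite /pres_pi eqmodE; apply: ideal_eqP. Qed.

Definition pres_repr (u : pres_alg) : free_alg K I := generic_quotient.repr u.

Lemma pres_reprK u : pres_pi (pres_repr u) = u.
Proof. exact: reprK. Qed.

Let piE x y : two_sided_ideal (x - y) -> pres_pi x = pres_pi y.
Proof. by move/pres_piP/eqP. Qed.

Let repr_pi x : two_sided_ideal (pres_repr (pres_pi x) - x).
Proof. by apply/pres_piP; rewrite pres_reprK. Qed.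

Definition pres_opp (u : pres_alg) := pres_pi (- pres_repr u).
Definition pres_add (u v : pres_alg) := pres_pi (pres_repr u + pres_repr v).
Definition pres_mul (u v : pres_alg) := pres_pi (pres_repr u * pres_repr v).
Definition pres_scale (a : K) (u : pres_alg) := pres_pi (a *: pres_repr u).

Let oppE x : pres_opp (pres_pi x) = pres_pi (- x).
Proof. by apply: piE; rewrite -opprD; apply/ideal_N/repr_pi. Qed.

Let addE x y : pres_add (pres_pi x) (pres_pi y) = pres_pi (x + y).
Proof.
by apply: piE; rewrite opprD addrACA; apply: Ideal_D; apply: repr_pi.
Qed.

Let mulE x y : pres_mul (pres_pi x) (pres_pi y) = pres_pi (x * y).
Proof.
apply: piE; set x' := pres_repr _; set y' := pres_repr _.
have -> : x' * y' - x * y = x' * (y' - y) + (x' - x) * y.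
  by rewrite mulrBr mulrBl addrA subrK.
by apply: Ideal_D; [apply/Ideal_Ml/repr_pi | apply/Ideal_Mr/repr_pi].
Qed.

Let scaleE a x : pres_scale a (pres_pi x) = pres_pi (a *: x).
Proof. by apply: piE; rewrite -scalerBr; apply/ideal_Z/repr_pi. Qed.

Let presW (P : pres_alg -> Prop) : (forall x, P (pres_pi x)) -> forall u, P u.
Proof. by move=> Ppi u; rewrite -[u]pres_reprK. Qed.

Let addA : associative pres_add.
Proof.
by elim/presW=> x; elim/presW=> y; elim/presW=> z; rewrite !addE addrA.
Qed.

Let addC : commutative pres_add.
Proof. by elim/presW=> x; elim/presW=> y; rewrite !addE addrC. Qed.

Let add0 : left_id (pres_pi 0) pres_add.
Proof. by elim/presW=> x; rewrite addE add0r. Qed.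

Let addN : left_inverse (pres_pi 0) pres_opp pres_add.
Proof. by elim/presW=> x; rewrite oppE addE addNr. Qed.

HB.instance Definition _ := GRing.isZmodule.Build pres_alg addA addC add0 addN.

Let mulA : associative pres_mul.
Proof.
by elim/presW=> x; elim/presW=> y; elim/presW=> z; rewrite !mulE mulrA.
Qed.

Let mul1 : left_id (pres_pi 1) pres_mul.
Proof. by elim/presW=> x; rewrite mulE mul1r. Qed.

Let mulr1_ : right_id (pres_pi 1) pres_mul.
Proof. by elim/presW=> x; rewrite mulE mulr1. Qed.

Let mulDl : left_distributive pres_mul pres_add.
Proof.
by elim/presW=> x; elim/presW=> y; elim/presW=> z;
  rewrite !(addE, mulE) mulrDl.
Qed.

Let mulDr : right_distributive pres_mul pres_add.
Proof.
by elim/presW=> x; elim/presW=> y; elim/presW=> z;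
  rewrite !(addE, mulE) mulrDr.
Qed.

HB.instance Definition _ :=
  GRing.Zmodule_isPzRing.Build pres_alg mulA mul1 mulr1_ mulDl mulDr.

Let scaleA a b u : pres_scale a (pres_scale b u) = pres_scale (a * b) u.
Proof. by elim/presW: u => x; rewrite !scaleE scalerA. Qed.

Let scale1 : left_id 1 pres_scale.
Proof. by elim/presW=> x; rewrite scaleE scale1r. Qed.

Let scaleDr : right_distributive pres_scale pres_add.
Proof.
by move=> a; elim/presW=> x; elim/presW=> y; rewrite !(addE, scaleE) scalerDr.
Qed.

Let scaleDl u a b :
  pres_scale (a + b) u = pres_add (pres_scale a u) (pres_scale b u).
Proof. by elim/presW: u => x; rewrite !(scaleE, addE) scalerDl. Qed.

HB.instance Definition _ := GRing.Zmodule_isLmodule.Build K pres_alg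
  scaleA scale1 scaleDr scaleDl.

Lemma pres_pi_is_linear : linear pres_pi.
Proof. by move=> a x y; rewrite -addE -scaleE. Qed.

HB.instance Definition _ :=
  GRing.isLinear.Build K (free_alg K I) pres_alg *:%R pres_pi
    pres_pi_is_linear.

Lemma pres_pi_is_monoid_morphism : monoid_morphism pres_pi.
Proof. by split=> [|x y]; [|exact: esym (mulE x y)]. Qed.

HB.instance Definition _ :=
  GRing.isMonoidMorphism.Build (free_alg K I) pres_alg pres_pi
    pres_pi_is_monoid_morphism.

Lemma pres_scalerAl (a : K) (u v : pres_alg) : a *: (u * v) = a *: u * v.
Proof.
elim/presW: u => x; elim/presW: v => y.
by rewrite -rmorphM -!linearZ -rmorphM scalerAl.
Qed.

Lemma pres_scalerAr (a : K) (u v : pres_alg) : a *: (u * v) = u * (a *: v).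
Proof.
elim/presW: u => x; elim/presW: v => y.
by rewrite -rmorphM -!linearZ -rmorphM scalerAr.
Qed.

Definition pres_gen (i : I) : pres_alg := pres_pi (free_gen K i).

(* When f satisfies the relations, this is the algebra morphism that sends the
   generators to f: see pres_eval_gen and the two lemmas that follow it. *)
Definition pres_eval (d : nat) (f : I -> 'M[K]_d) (u : pres_alg) : 'M[K]_d :=
  free_eval f (pres_repr u).

Section PresEval.
Variables (d : nat) (f : I -> 'M[K]_d).
Hypothesis f_rel : forall r, rel r -> free_eval f r = 0.

Lemma pres_eval_pi x : pres_eval f (pres_pi x) = free_eval f x.
Proof.
apply/eqP; rewrite -subr_eq0 -linearB; apply/eqP.
elim: (repr_pi x) => [r /f_rel //||y z _ y0 _ z0|y z _ z0|y z _ y0].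
- exact: linear0.
- by rewrite linearD /= y0 z0 addr0.
- by rewrite rmorphM /= z0 mulr0.
- by rewrite rmorphM /= y0 mul0r.
Qed.

Lemma pres_eval_gen i : pres_eval f (pres_gen i) = f i.
Proof. by rewrite pres_eval_pi free_eval_gen. Qed.

Lemma pres_eval_is_linear : linear (pres_eval f).
Proof.
move=> a; elim/presW=> x; elim/presW=> y.
by rewrite -linearP !pres_eval_pi linearP.
Qed.

Lemma pres_eval_is_monoid_morphism : monoid_morphism (pres_eval f).
Proof.
split; first by rewrite -(rmorph1 pres_pi) pres_eval_pi rmorph1.
by elim/presW=> x; elim/presW=> y; rewrite -rmorphM !pres_eval_pi rmorphM.
Qed.

Lemma pres_nontrivial : (0 < d)%N -> 1 != 0 :> pres_alg.
Proof.
move=> d_gt0; apply/eqP => /(congr1 (pres_eval f)) /matrixP.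
move=> /(_ (Ordinal d_gt0) (Ordinal d_gt0)).
rewrite pres_eval_is_monoid_morphism.1 -(linear0 pres_pi) pres_eval_pi linear0.
by rewrite !mxE eqxx; apply/eqP/oner_neq0.
Qed.

End PresEval.
End Presentation.

(* Prevents unification from unfolding the quotient. *)
Opaque free_gen pres_pi pres_repr pres_opp pres_add pres_mul pres_scale.

(** * Tensor powers *)

(* Operators on (K^n)^{(x) m}, with entries in A, are matrices indexed by
   multi-indices m.-tuple 'I_n through enum_rank / enum_val. *)
Notation tens_dim n m := #|{: m.-tuple 'I_n}|.

Section Tensor.
Variables (A : nzRingType) (n m : nat).

Definition in_factor (k : 'I_m) (M : 'M[A]_n) : 'M[A]_(tens_dim n m) :=
  \matrix_(a, b)
    let I := enum_val a in let J := enum_val b in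
    if [forall l, (l != k) ==> (tnth I l == tnth J l)]
    then M (tnth I k) (tnth J k) else 0.

Definition bra_ket (I J : m.-tuple 'I_n) (M : 'M[A]_(tens_dim n m)) : A :=
  M (enum_rank I) (enum_rank J).

End Tensor.

Definition Rcheck (K : fieldType) (q : K) (n m : nat) (k l : 'I_m) :
    'M[K]_(tens_dim n m) :=
  let e k (i j : 'I_n) := in_factor k (delta_mx i j : 'M[K]_n) in
  q *: (\sum_(i < n) e k i i *m e l i i)
  + \sum_(i < n) \sum_(j < n | i != j) e k i j *m e l j i
  + (q - q^-1) *: (\sum_(i < n) \sum_(j < n | (j < i)%N) e k i i *m e l j j).

(** * The quantum coordinate algebra *)

Lemma rmorph_mx_comm_eq0 (A B : pzRingType) (eps : {rmorphism A -> B}) (N : nat)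
    (R X Y : 'M[A]_N) a b :
  map_mx eps X = 1%:M -> map_mx eps Y = 1%:M ->
  eps ((R *m X *m Y - X *m Y *m R) a b) = 0.
Proof.
move=> epsX epsY; transitivity (map_mx eps (R *m X *m Y - X *m Y *m R) a b).
  by rewrite [RHS]mxE.
by rewrite map_mxB !map_mxM epsX epsY !mulmx1 mul1mx subrr mxE.
Qed.

Section QuantumMatrices.
Variables (K : fieldType) (q : K) (n : nat).

Let F := free_alg K ('I_n * 'I_n)%type.
Let gen_mx : 'M[F]_n := \matrix_(i, j) free_gen K (i, j).
Let X1 := in_factor (@ord0 1) gen_mx.
Let X2 := in_factor (@ord_max 1) gen_mx.
Let R12 : 'M[F]_(tens_dim n 2) :=
  map_mx (in_alg F) (Rcheck q n (@ord0 1) (@ord_max 1)).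

Inductive qmat_rel : F -> Prop :=
| Qmat_RXX a b : qmat_rel ((R12 *m X1 *m X2 - X1 *m X2 *m R12) a b).

Definition qmat : Type := pres_alg qmat_rel.

HB.instance Definition _ := GRing.Lmodule.on qmat.
HB.instance Definition _ := GRing.PzRing.on qmat.

Lemma qmat_rel_counit r : qmat_rel r ->
  free_eval (fun p : 'I_n * 'I_n => (p.1 == p.2)%:R : 'M[K]_1) r = 0.
Proof.
set f := fun p => _; case=> a b; set eps := free_eval f.
have epsX k : map_mx eps (in_factor k gen_mx) = 1%:M :> 'M_(tens_dim n 2).
  apply/matrixP=> i j; rewrite !mxE /=.
  case: ifP => [/forallP eq_ij | /negbT /forallPn[l]].
    rewrite !mxE /eps free_eval_gen /f /= -(inj_eq enum_val_inj).
    congr (nat_of_bool _)%:R; apply/eqP/eqP => [ij_k | -> //].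
    apply: eq_from_tnth => l.
    by case: (eqVneq l k) => [-> // | /(implyP (eq_ij l))/eqP].
  rewrite negb_imply => /andP[_ ne_ij]; rewrite /eps linear0.
  by case: eqP => // ij; rewrite ij eqxx in ne_ij.
by apply: (@rmorph_mx_comm_eq0 _ _ (free_eval f)); apply: epsX.
Qed.

HB.instance Definition _ := GRing.PzSemiRing_isNonZero.Build qmat
  (pres_nontrivial qmat_rel_counit isT).
HB.instance Definition _ :=
  GRing.Lmodule_isLalgebra.Build K qmat (@pres_scalerAl _ _ qmat_rel).
HB.instance Definition _ :=
  GRing.LSemiAlgebra_isSemiAlgebra.Build K qmat (@pres_scalerAr _ _ qmat_rel).

Definition qmat_X : 'M[qmat]_n := \matrix_(i, j) pres_gen qmat_rel (i, j).

End QuantumMatrices.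

(** * The Hecke algebra *)

Section RmorphRelations.
Variables (A B : pzRingType) (eps : {rmorphism A -> B}) (x y z : A).

Lemma rmorph_subM_eq0 : eps x = eps y -> eps ((x - y) * z) = 0.
Proof. by move=> xy; rewrite rmorphM rmorphB xy subrr mul0r. Qed.

Lemma rmorph_comm_eq0 : eps x = eps y -> eps (x * y - y * x) = 0.
Proof. by move=> xy; rewrite rmorphB !rmorphM xy subrr. Qed.

Lemma rmorph_braid_eq0 : eps x = eps y -> eps (x * y * x - y * x * y) = 0.
Proof. by move=> xy; rewrite rmorphB !rmorphM xy subrr. Qed.

End RmorphRelations.

Section Adjacent.
Variable m : nat.
Implicit Type k : 'I_m.-1.

Fact ltn_left k : (k < m)%N.
Proof. by apply: leq_trans (ltn_ord k) (leq_pred m). Qed.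

Fact ltn_right k : (k.+1 < m)%N.
Proof. by rewrite -ltn_predRL. Qed.

Definition ord_left k : 'I_m := Ordinal (ltn_left k).
Definition ord_right k : 'I_m := Ordinal (ltn_right k).

Definition adj_tperm k : 'S_m := tperm (ord_left k) (ord_right k).

Definition word_perm (w : seq 'I_m.-1) : 'S_m :=
  (\prod_(k <- w) adj_tperm k)%g.

Definition is_reduced_word (s : 'S_m) (w : seq 'I_m.-1) : Prop :=
  word_perm w = s /\ forall w', word_perm w' = s -> (size w <= size w')%N.

(* The product of 'S_m composes from left to right. The opposite convention
   exchanges T_s and T_(s^-1), which affects neither T_s for a transposition s
   nor char_elt below. *)
Definition reduced_word (s : 'S_m) : seq 'I_m.-1 :=
  classical_sets.xget [::] (is_reduced_word s).

End Adjacent.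

Section Hecke.
Variables (K : fieldType) (q : K) (m : nat).

Let F := free_alg K 'I_m.-1.
Let T (i : 'I_m.-1) : F := free_gen K i.

Inductive hecke_rel : F -> Prop :=
| Hecke_quad i : hecke_rel ((T i - q%:A) * (T i + q^-1%:A))
| Hecke_braid (i j : 'I_m.-1) : j = i.+1 :> nat ->
    hecke_rel (T i * T j * T i - T j * T i * T j)
| Hecke_comm (i j : 'I_m.-1) : (i.+1 < j)%N || (j.+1 < i)%N ->
    hecke_rel (T i * T j - T j * T i).

Definition hecke : Type := pres_alg hecke_rel.

HB.instance Definition _ := GRing.Lmodule.on hecke.
HB.instance Definition _ := GRing.PzRing.on hecke.

Lemma hecke_rel_triv r : hecke_rel r ->
  free_eval (fun _ => q%:M : 'M[K]_1) r = 0.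
Proof.
set f := fun=> _.
have fT i : free_eval f (T i) = q%:M by rewrite free_eval_gen.
case=> [i|i j _|i j _].
- apply: (rmorph_subM_eq0 (eps := free_eval f)); apply: etrans (fT i) _.
  apply/esym/(etrans (linearZ_LR (free_eval f) q 1)).
  apply: etrans (congr1 ( *:%R q) (free_eval_is_monoid_morphism f).1) _.
  exact: scalemx1.
- by apply: (rmorph_braid_eq0 (eps := free_eval f)); rewrite /= !fT.
- by apply: (rmorph_comm_eq0 (eps := free_eval f)); rewrite /= !fT.
Qed.

HB.instance Definition _ := GRing.PzSemiRing_isNonZero.Build hecke
  (pres_nontrivial hecke_rel_triv isT).
HB.instance Definition _ :=
  GRing.Lmodule_isLalgebra.Build K hecke (@pres_scalerAl _ _ hecke_rel).
HB.instance Definition _ :=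
  GRing.LSemiAlgebra_isSemiAlgebra.Build K hecke (@pres_scalerAr _ _ hecke_rel).

Definition hecke_gen (i : 'I_m.-1) : hecke := pres_gen hecke_rel i.

Definition hecke_basis (s : 'S_m) : hecke :=
  \prod_(k <- reduced_word s) hecke_gen k.

Definition jucys_murphy (k : 'I_m) : hecke :=
  1 + (q - q^-1) *: \sum_(i < m | (i < k)%N) hecke_basis (tperm i k).

Definition tens_act (n : nat) : hecke -> 'M[K]_(tens_dim n m) :=
  pres_eval (fun k => Rcheck q n (ord_left k) (ord_right k)).

End Hecke.

(** * Partitions and tableaux *)

Definition is_part (s : seq nat) : bool := sorted geq s && (0%N \notin s).

Record intpart := IntPart { parts :> seq nat; _ : is_part parts }.

Definition psize (lam : intpart) : nat := sumn lam.

Section Tableaux.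
Variable lam : intpart.

(* The pair (i, j) is the box in row i and column j, counted from 0; the bound
   j < |lam| always holds. *)
Definition box : predArgType :=
  {b : 'I_(size lam) * 'I_(psize lam) | (b.2 < nth 0%N lam b.1)%N}.

Definition box_row (b : box) : nat := (val b).1.
Definition box_col (b : box) : nat := (val b).2.
Definition content (b : box) : int := (box_col b)%:Z - (box_row b)%:Z.

(* Entries are counted from 0. There are as many boxes as entries, so that
   injectivity means that each entry occurs exactly once. *)
Definition is_syt (t : {ffun box -> 'I_(psize lam)}) : bool :=
  [&& injectiveb t,
      [forall b, forall c, (box_row b == box_row c) && (box_col b < box_col c)%N
         ==> (t b < t c)%N] &
      [forall b, forall c, (box_col b == box_col c) && (box_row b < box_row c)%N
         ==> (t b < t c)%N]].

Definition syt : predArgType := {t : {ffun box -> 'I_(psize lam)} | is_syt t}.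

Definition is_ssyt (k : nat) (t : {ffun box -> 'I_k}) : bool :=
  [forall b, forall c, (box_row b == box_row c) && (box_col b < box_col c)%N
     ==> (t b <= t c)%N] &&
  [forall b, forall c, (box_col b == box_col c) && (box_row b < box_row c)%N
     ==> (t b < t c)%N].

End Tableaux.

(* The Schur function in k variables, i.e. the component at k of the Schur
   function seen in the graded inverse limit of the rings of symmetric
   polynomials. *)
Definition schur (K : fieldType) (k : nat) (lam : intpart) : mpoly.mpoly k K :=
  \sum_(t : {ffun box lam -> 'I_k} | is_ssyt t) \prod_b 'X_(t b).

(** * Irreducible modules, characters and immanants *)

Record specht_module (K : fieldType) (q : K) (lam : intpart) := SpechtModule {
  sm_dim : nat;
  sm_act : {lrmorphism hecke q (psize lam) -> 'M[K]_sm_dim};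
  sm_neq0 : (0 < sm_dim)%N;
  sm_irr : forall U : {vspace 'cV[K]_sm_dim},
    (forall h v, v \in U -> sm_act h *m v \in U) -> U = 0%VS \/ U = fullv;
  sm_vec : syt lam -> 'cV[K]_sm_dim;
  sm_basis : basis_of fullv (codom sm_vec);
  sm_jucys_murphy : forall (t : syt lam) (b : box lam),
    sm_act (jucys_murphy q (val t b)) *m sm_vec t
      = q ^ (2 * content b) *: sm_vec t
}.

Definition char_elt (K : fieldType) (q : K) (lam : intpart)
    (V : specht_module q lam) : hecke q (psize lam) :=
  \sum_(s : 'S_(psize lam))
    \tr (sm_act V (hecke_basis q s^-1%g)) *: hecke_basis q s.

Definition immanant (K : fieldType) (q : K) (n m : nat) (chi : hecke q m)
    (I : m.-tuple 'I_n) : qmat q n :=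
  bra_ket I I (map_mx (in_alg (qmat q n)) (tens_act n chi)
               *m \prod_(k < m) in_factor k (qmat_X q n)).

(* The sequences (I_0, ..., I_(l-1)) of pairwise disjoint subsets of 'I_n with
   #|I_i| = d i, each written as an increasing tuple. *)
Definition disjoint_increasing (n l : nat) (d : 'I_l -> nat)
    (I : {dffun forall i : 'I_l, (d i).-tuple 'I_n}) : bool :=
  [forall i, sorted ltn [seq val x | x <- I i]] &&
  [forall i, forall j, (i != j) ==> [disjoint I i & I j]].

(* Main.v *)
(** Everything happens in the Hecke algebra. Put ch(z) = sum_f <f|z|f> / P_f x^f,
    where f runs over the nondecreasing words and P_f is the Poincare polynomial,
    at q^2, of the stabilizer of f.

    The shuffle product sum_u T_(u^-1) (x (x) y) T_u of central elements x of H_a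
    and y of H_b, over the minimal representatives u of the cosets of S_a x S_b, is
    central in H_(a+b). It is multiplicative for ch, and since R-check commutes
    with X_1 ... X_m its immanant at an increasing word is the sum, over the
    splittings of the word into two subwords, of the products of the immanants of
    x and y. So the combination of Schur functions is ch(Z), and that
    of products of immanants is the immanant of Z at (1, ..., n), for one central
    element Z of H_n; it remains to see that Z vanishes as soon as ch(Z) does.

    - ch(chi_q^lam) is the Schur function: <f|chi_q^lam|f> is the trace on V^lam of
      the q-symmetrizer of the stabilizer of f, whose image has a basis indexed by
      semistandard tableaux of weight f, as the Jucys-Murphy eigenbasis shows.
    - If ch(Z) = 0, then the trace function y |-> tau(Z y), with tau the
      symmetrizing form, vanishes on all parabolic q-symmetrizers. For generic q
      these span the cocenter of H_n, so that Z = 0. *)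

Require Import Defs.
From HB Require Import structures.
From mathcomp Require Import all_boot all_order all_fingroup all_algebra.
From mathcomp Require Import complex reals finmap monalg mpoly.
From mathcomp Require Import zify ring.

Set Implicit Arguments.
Unset Strict Implicit.
Unset Printing Implicit Defensive.

(** * Inversions and reduced words *)

(** Centrality drives the last step: tau(Z y) is a trace function of y exactly when Z is central. A
    trace function is determined by its values on Coxeter elements of parabolic subgroups, because
    H_(k+1) = H_k + H_k g_k H_k lets cyclicity remove repeated generators. Enlarging a parabolic by
    one generator changes the trace of its symmetrizer by q (1 + q^2 + ... + q^(2d)) times a trace
    with one more generator in the Coxeter part; q not being a root of unity, this can be solved for
    the latter.

    The division by P_f in ch compensates that shuffles of words with repeated letters are counted
    with q-multiplicities: the weighted number of ways to reach w1 w2 from the sorted word f is P_f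
    / (P_w1 P_w2). Increasing words have no repeated letters, so immanants need no such factor.

    Linear independence of the T_s is not visible in the presentation. It is read off from the
    action on the word (1, ..., n), as are tau and its symmetry. *)

Ltac case_nat_if := match goal with
  |- context [if (?x == ?y) then _ else _] =>
    match x with context [if _ then _ else _] => fail 1 | _ => case: (x =P y) => ? end
  end.

Lemma adjacent_incr m (h : 'I_m -> nat) : (forall k, h (ord_left k) < h (ord_right k))%N ->
  forall i j : 'I_m, (i < j)%N -> (h i < h j)%N.
Proof.
move=> hk i j; move: {2}(j - i)%N (leqnn (j - i)) => d; elim: d i j => [|d IH] i j; first by lia.
move=> le lt; have lt_k : (i < m.-1)%N by have := ltn_ord j; lia.
have ei : i = ord_left (Ordinal lt_k) by apply: val_inj.
have [e|ne] := eqVneq (j : nat) i.+1.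
  by rewrite (_ : j = ord_right (Ordinal lt_k)) ?{1}ei //; apply: val_inj; rewrite /= e.
apply: leq_ltn_trans (IH (ord_right (Ordinal lt_k)) j _ _); rewrite ?{1}ei ?(ltnW (hk _)) //=; lia.
Qed.

Section Inversions.
Variable m : nat.
Implicit Types (s u : 'S_m) (k : 'I_m.-1) (i j : 'I_m) (Q : rel 'I_m).

Lemma adj_tpermE k i : adj_tperm k i = (if i == k :> nat then k.+1
  else if i == k.+1 :> nat then nat_of_ord k else nat_of_ord i) :> nat.
Proof.
rewrite permE /= -!(inj_eq val_inj) /=.
by case: ifP => // _; case: ifP.
Qed.

Lemma adj_tpermD k i : (i < k)%N || (k.+1 < i)%N -> adj_tperm k i = i.
Proof.
move=> ne; apply: val_inj; rewrite /= adj_tpermE.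
by do 2![case: eqP => [?|_]; first by lia].
Qed.

Lemma adj_tpermK k : (adj_tperm k * adj_tperm k)%g = 1%g.
Proof. exact: tperm2. Qed.

Lemma adj_tpermKl k s : (adj_tperm k * (adj_tperm k * s))%g = s.
Proof. by rewrite mulgA adj_tpermK mul1g. Qed.

Lemma adj_tpermKr k s : (s * adj_tperm k * adj_tperm k)%g = s.
Proof. by rewrite -mulgA adj_tpermK mulg1. Qed.

(** Products compose from left to right, so this is the condition for left multiplication by
    [adj_tperm k] to lengthen [s]; for right multiplication the condition is an ascent of [s^-1]. *)
Definition ascent s k := (s (ord_left k) < s (ord_right k))%N.

Lemma adj_left k : adj_tperm k (ord_left k) = ord_right k.
Proof. exact: tpermL. Qed.

Lemma adj_right k : adj_tperm k (ord_right k) = ord_left k.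
Proof. exact: tpermR. Qed.

Lemma ascent_adj k s : ascent (adj_tperm k * s)%g k = ~~ ascent s k.
Proof.
rewrite /ascent !permM adj_left adj_right -leqNgt ltn_neqAle.
rewrite (inj_eq val_inj) (inj_eq perm_inj) -(inj_eq val_inj) /=.
by rewrite neq_ltn ltnSn orbT.
Qed.

Definition inversion s (p : 'I_m * 'I_m) := (p.1 < p.2)%N && (s p.2 < s p.1)%N.

(** Exchanging the positions k and k + 1 carries inversions to inversions and creates one new pair.
    The operation is arbitrary because this serves both for counting inversions and for the product
    [correction]. *)
Lemma big_inversion_adj (R : Type) (idx : R) (op : Monoid.com_law idx)
    (h : 'I_m -> 'I_m -> R) s k : ascent s k ->
  \big[op/idx]_(p | inversion (adj_tperm k * s) p)
     h ((adj_tperm k * s)%g p.1) ((adj_tperm k * s)%g p.2) =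
  op (h (s (ord_right k)) (s (ord_left k)))
     (\big[op/idx]_(p | inversion s p) h (s p.1) (s p.2)).
Proof.
move=> asc; pose a := adj_tperm k; pose ap (p : 'I_m * 'I_m) := (a p.1, a p.2).
have aK : involutive a by move=> i; rewrite -permM tperm2 perm1.
have apK : involutive ap by case=> i j; rewrite /ap /= !aK.
rewrite (reindex_inj (inv_inj apK)) (bigD1 (ord_right k, ord_left k)) /=; last first.
  by rewrite /inversion /= !permM !aK /a adj_left adj_right /= ltnSn.
rewrite !permM !aK; congr (op _ _); apply: eq_big => -[i j]; last by rewrite !permM !aK.
rewrite /inversion /= !permM !aK.
case: (boolP (_ < s i)%N) => [lt|]; rewrite ?andbF // !andbT.
have := adj_tpermE k i; have := adj_tpermE k j; rewrite -/a => -> ->.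
have : (i, j) != (ord_left k, ord_right k).
  by apply: contraTneq lt => -[-> ->]; rewrite -leqNgt ltnW.
rewrite !xpair_eqE -!(inj_eq val_inj) /=; move: (nat_of_ord i) (nat_of_ord j) => x y.
by repeat (case: eqP => ?); lia.
Qed.

(** With [Q] always true this is the Coxeter length; with [Q] testing equality of letters of a word
    it is the exponent of q produced by the action on tensors. *)
Definition invQ Q s := \sum_(p | inversion s p) Q (s p.1) (s p.2).

Lemma invQ_adj Q s k : ascent s k ->
  invQ Q (adj_tperm k * s)%g = (Q (s (ord_right k)) (s (ord_left k)) + invQ Q s)%N.
Proof. exact: (@big_inversion_adj _ _ addn (fun i j => nat_of_bool (Q i j))). Qed.

Definition ninv := invQ (fun _ _ => true).

Lemma ninv_adj s k : ascent s k -> ninv (adj_tperm k * s)%g = (ninv s).+1.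
Proof. exact: invQ_adj. Qed.

Lemma ninv_adjN s k : ~~ ascent s k -> ninv s = (ninv (adj_tperm k * s)%g).+1.
Proof. by rewrite -ascent_adj => /ninv_adj; rewrite adj_tpermKl. Qed.

Lemma ninv_adj_le s k : (ninv s <= (ninv (adj_tperm k * s)%g).+1)%N.
Proof.
have [asc|/ninv_adjN->//] := boolP (ascent s k).
by rewrite ninv_adj // ltnW // ltnS leqnSn.
Qed.

Lemma ninv1 : ninv 1%g = 0%N.
Proof.
by apply: big1 => -[i j]; rewrite /inversion !perm1 /=; lia.
Qed.

Lemma all_ascent s : (forall k, ascent s k) -> s = 1%g.
Proof.
move=> asc; have incr := adjacent_incr (h := fun i => s i) asc.
have geS i : (i <= s i)%N.
  move: {2}(nat_of_ord i) (leqnn i) => d; elim: d i => [|d IH] i; first by lia.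
  case: i => -[//|i] lt_i /= le_d.
  have lt_i' : (i < m)%N by lia.
  by apply: leq_ltn_trans (IH (Ordinal lt_i') _) (incr _ _ _) => /=; lia.
have leS i : (s i <= i)%N.
  move: {2}(m - i)%N (leqnn (m - i)) => d; elim: d i => [|d IH] i.
    by have := ltn_ord i; lia.
  move=> le_d; have [lt_i|ge_i] := ltnP i.+1 m; last by have := ltn_ord (s i); lia.
  have := IH (Ordinal lt_i); have := incr i (Ordinal lt_i); rewrite /=; lia.
by apply/permP=> i; rewrite perm1; apply: val_inj; apply/eqP; rewrite eqn_leq leS geS.
Qed.

Lemma ex_descent s : s != 1%g -> exists k, ~~ ascent s k.
Proof.
move=> s1; apply/existsP; rewrite -negb_forall; apply: contra s1 => /forallP asc.
exact/eqP/all_ascent.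
Qed.

(** Induction along the left weak order; it matches [gen_basis_up] and so replaces induction on
    reduced words. *)
Lemma perm_ind_up (P : 'S_m -> Prop) : P 1%g ->
  (forall k s, ascent s k -> P s -> P (adj_tperm k * s)%g) -> forall s, P s.
Proof.
move=> P1 PS s; move: {2}(ninv s) (leqnn (ninv s)) => d.
elim: d s => [|d IH] s le_d; have [->//|/ex_descent[k desc]] := eqVneq s 1%g.
  by move: le_d; rewrite (ninv_adjN desc).
rewrite -[s](adj_tpermKl k); apply: PS; first by rewrite ascent_adj.
by apply: IH; rewrite -ltnS -(ninv_adjN desc).
Qed.

Lemma word_perm_cons k w : word_perm (k :: w) = (adj_tperm k * word_perm w)%g.
Proof. exact: big_cons. Qed.

Lemma word_perm_nil : word_perm [::] = 1%g :> 'S_m.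
Proof. exact: big_nil. Qed.

Lemma word_perm_rcons k w : word_perm (rcons w k) = (word_perm w * adj_tperm k)%g.
Proof. by rewrite /word_perm -cats1 big_cat big_seq1. Qed.

Lemma word_perm_rev (w : seq 'I_m.-1) : word_perm (rev w) = ((word_perm w)^-1)%g.
Proof.
elim: w => [|k w IH]; first by rewrite word_perm_nil invg1.
by rewrite rev_cons word_perm_rcons IH word_perm_cons invMg tpermV.
Qed.

Lemma ninv_word_perm (w : seq 'I_m.-1) : (ninv (word_perm w) <= size w)%N.
Proof.
elim: w => [|k w IH]; first by rewrite word_perm_nil ninv1.
rewrite word_perm_cons /=; have [asc|desc] := boolP (ascent (word_perm w) k).
  by rewrite ninv_adj.
by rewrite ltnW // ltnS (leq_trans _ IH) // [in leqRHS](ninv_adjN desc).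
Qed.

Definition is_reduced (w : seq 'I_m.-1) := size w == ninv (word_perm w).

Lemma reduced_cons k w :
  is_reduced (k :: w) = is_reduced w && ascent (word_perm w) k.
Proof.
rewrite /is_reduced word_perm_cons /=; have le := ninv_word_perm w.
have [asc|desc] := boolP (ascent _ _); first by rewrite ninv_adj // eqSS andbT.
by rewrite andbF; rewrite (ninv_adjN desc) in le; apply/eqP; lia.
Qed.

Lemma ex_reduced s : exists2 w, word_perm w = s & is_reduced w.
Proof.
elim/perm_ind_up: s => [|k s asc [w ws redw]].
  by exists [::]; rewrite /is_reduced ?word_perm_nil // ninv1.
by exists (k :: w); rewrite ?word_perm_cons ?ws // reduced_cons redw ws.
Qed.

(** [ninv] is the least length of a word for [s], so the boolean [is_reduced] agrees with the
    minimality by which [reduced_word] is chosen. *)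
Lemma reduced_wordP s : word_perm (reduced_word s) = s /\ is_reduced (reduced_word s).
Proof.
have [w0 w0s red0] := ex_reduced s.
have : is_reduced_word s (reduced_word s).
  apply: (@classical_sets.xgetI _ [::] (is_reduced_word s) w0); split=> // w' ws'.
  by rewrite (eqP red0) w0s -ws' ninv_word_perm.
case=> ws min; split=> //; rewrite /is_reduced eqn_leq ninv_word_perm andbT ws.
by rewrite (leq_trans (min _ w0s)) // (eqP red0) w0s.
Qed.

Lemma ninv_permV s : ninv s^-1%g = ninv s.
Proof.
have le u : (ninv u^-1%g <= ninv u)%N.
  have [wu redw] := reduced_wordP u.
  rewrite -{1}wu -word_perm_rev (leq_trans (ninv_word_perm _)) // size_rev.
  by rewrite (eqP redw) wu.
by apply/eqP; rewrite eqn_leq le -{1}[s]invgK le.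
Qed.

Lemma is_reduced_rev (w : seq 'I_m.-1) : is_reduced (rev w) = is_reduced w.
Proof. by rewrite /is_reduced size_rev word_perm_rev ninv_permV. Qed.

Lemma adj_tperm_comm k (l : 'I_m.-1) : (k.+1 < l)%N ->
  (adj_tperm k * adj_tperm l = adj_tperm l * adj_tperm k)%g.
Proof.
move=> lt; apply/permP=> i; apply: val_inj; rewrite /= !permM !adj_tpermE.
by repeat (case_nat_if; rewrite //=); lia.
Qed.

Lemma adj_tperm_braid k (l : 'I_m.-1) : l = k.+1 :> nat ->
  (adj_tperm k * adj_tperm l * adj_tperm k =
   adj_tperm l * adj_tperm k * adj_tperm l)%g.
Proof.
move=> e; apply/permP=> i; apply: val_inj; rewrite /= !permM !adj_tpermE.
by repeat (case_nat_if; rewrite //=); lia.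
Qed.

(** First of the two rank-two cases of Matsumoto's theorem: s has reduced words starting with either
    order of the two descents and sharing the tail [w]. In [adjacent_descents] the common start is
    the longest element of the S_3 generated by the two descents. *)
Lemma far_descents s k (l : 'I_m.-1) : (k.+1 < l)%N ->
  ~~ ascent s k -> ~~ ascent s l -> exists w,
    [/\ is_reduced (l :: w), word_perm (l :: w) = (adj_tperm k * s)%g,
        is_reduced (k :: w) & word_perm (k :: w) = (adj_tperm l * s)%g].
Proof.
move=> far dk dl; have c := adj_tperm_comm far.
have [w wE rw] := ex_reduced (adj_tperm l * (adj_tperm k * s))%g.
have wE' : word_perm w = (adj_tperm k * (adj_tperm l * s))%g.
  by rewrite wE !mulgA c.
exists w; split.
- rewrite reduced_cons rw wE ascent_adj /ascent !permM.
  by rewrite !adj_tpermD ?dl //= ?far ?orbT // (ltn_trans far) ?orbT.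
- by rewrite word_perm_cons wE adj_tpermKl.
- rewrite reduced_cons rw wE' ascent_adj /ascent !permM.
  by rewrite !adj_tpermD ?dk //= ?far // ltnW.
by rewrite word_perm_cons wE' adj_tpermKl.
Qed.

Lemma adjacent_descents s k (l : 'I_m.-1) : l = k.+1 :> nat ->
  ~~ ascent s k -> ~~ ascent s l -> exists w,
    [/\ is_reduced (l :: k :: w), word_perm (l :: k :: w) = (adj_tperm k * s)%g,
        is_reduced (k :: l :: w) & word_perm (k :: l :: w) = (adj_tperm l * s)%g].
Proof.
move=> elk; have b := adj_tperm_braid elk.
have e_lk : ord_left l = ord_right k by apply: val_inj.
rewrite /ascent e_lk -!leqNgt => dk dl.
have al_p : adj_tperm l (ord_left k) = ord_left k.
  by apply: adj_tpermD; rewrite /= elk ltnSn.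
have ak_t : adj_tperm k (ord_right l) = ord_right l.
  by apply: adj_tpermD; rewrite /= elk ltnSn orbT.
have al_r : adj_tperm l (ord_right k) = ord_right l by rewrite -e_lk adj_left.
have al_t : adj_tperm l (ord_right l) = ord_right k by rewrite adj_right e_lk.
have [w wE rw] := ex_reduced (adj_tperm k * (adj_tperm l * (adj_tperm k * s)))%g.
have wE' : word_perm w = (adj_tperm l * (adj_tperm k * (adj_tperm l * s)))%g.
  by rewrite wE !mulgA b.
exists w; split.
- rewrite !reduced_cons rw word_perm_cons wE adj_tpermKl !ascent_adj /ascent !permM e_lk.
  by rewrite al_p al_r !adj_left !ak_t adj_right -!leqNgt dl (leq_trans dl dk).
- by rewrite !word_perm_cons wE !adj_tpermKl.
- rewrite !reduced_cons rw word_perm_cons wE' adj_tpermKl !ascent_adj /ascent !permM e_lk.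
  by rewrite al_p al_r adj_right ak_t al_t al_p -!leqNgt dk (leq_trans dl dk).
by rewrite !word_perm_cons wE' !adj_tpermKl.
Qed.

End Inversions.

Import GRing.Theory.
Local Open Scope ring_scope.
Local Open Scope complex_scope.

(** * The standard basis of the Hecke algebra *)

Section PresentationTheory.
Variables (K : fieldType) (I : choiceType) (rel : free_alg K I -> Prop).

Lemma pres_rel r : rel r -> pres_pi rel r = 0.
Proof.
by move=> rr; apply/eqP/pres_piP; rewrite subr0; apply: Ideal_gen.
Qed.

Lemma free_monomE (w : {fmonom I}) :
  mkmalgU w 1 = \prod_(i <- (w : seq I)) free_gen K i :> free_alg K I.
Proof.
case: w => w /=; elim: w => [|i w IH].
  rewrite big_nil; congr mkmalgU; apply: val_inj; by rewrite /= fm1.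
rewrite big_cons -IH [RHS]malgM_def fgmulUU mulr1; congr mkmalgU.
by apply: val_inj; rewrite /= fmM fmU.
Qed.

Lemma pres_ind (P : pres_alg rel -> Prop) :
  P 1 -> (forall i x, P x -> P (pres_gen rel i * x)) ->
  (forall x y, P x -> P y -> P (x + y)) -> (forall a x, P x -> P (a *: x)) ->
  forall x, P x.
Proof.
move=> P1 PM PD PZ x; rewrite -[x]pres_reprK; move: (pres_repr x) => {}x.
rewrite (monalgE x) [pres_pi _ _](linear_sum (pres_pi rel)).
apply: (big_ind P) => [|//|w _]; first by have := PZ 0 1 P1; rewrite scale0r.
have -> : << monalg.mcoeff w x *g w >> =
    monalg.mcoeff w x *: (mkmalgU w 1 : free_alg K I).
  by apply/malgP=> v; rewrite monalg.mcoeffZ !monalg.mcoeffU mulrnAr mulr1.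
rewrite (linearZ_LR (pres_pi rel)); apply: PZ; rewrite free_monomE rmorph_prod.
elim: (w : seq I) => [|i v IH]; first by rewrite big_nil.
by rewrite big_cons; apply: PM.
Qed.

End PresentationTheory.

(* A generating family satisfying the Hecke relations in an abstract algebra;
   hecke q m itself is a quotient that unification would keep unfolding. *)
Record hecke_family (K : fieldType) (q : K) (m : nat) (B : algType K)
    (g : 'I_m.-1 -> B) : Prop := HeckeFamily {
  hf_quad : forall k, g k * g k = 1 + (q - q^-1) *: g k;
  hf_braid : forall k l : 'I_m.-1, l = k.+1 :> nat -> g k * g l * g k = g l * g k * g l;
  hf_comm : forall k l : 'I_m.-1, (k.+1 < l)%N || (l.+1 < k)%N -> g k * g l = g l * g k;
  hf_ind : forall P : B -> Prop, P 1 -> (forall k x, P x -> P (g k * x)) ->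
    (forall x y, P x -> P y -> P (x + y)) -> (forall a x, P x -> P (a *: x)) ->
    forall x, P x
}.

Definition word_elt (m : nat) (B : pzRingType) (g : 'I_m.-1 -> B) w : B :=
  \prod_(k <- w) g k.

Definition basis_elt (m : nat) (B : pzRingType) (g : 'I_m.-1 -> B) s : B :=
  word_elt g (reduced_word s).

Section HeckeFamilyTheory.
Variables (K : fieldType) (q : K) (m : nat) (B : algType K) (g : 'I_m.-1 -> B).
Hypothesis fam : hecke_family q g.
Local Notation T := (basis_elt g).
Local Notation word_elt := (word_elt g).
Implicit Types (k l : 'I_m.-1) (s u : 'S_m) (w : seq 'I_m.-1).

Lemma word_elt_cons k w : word_elt (k :: w) = g k * word_elt w.
Proof. exact: big_cons. Qed.

(** By induction on length. If the first letters differ, both are descents of the permutation; the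
    rank-two lemmas then supply reduced words with these first letters and a common tail, which one
    commutation or braid relation identifies. *)
Lemma matsumoto w1 w2 : is_reduced w1 -> is_reduced w2 ->
  word_perm w1 = word_perm w2 -> word_elt w1 = word_elt w2.
Proof.
move: {2}(size w1) (leqnn (size w1)) => n; elim: n w1 w2 => [|n IH] w1 w2.
  case: w1 => // _ _; rewrite word_perm_nil.
  by case: w2 => // l w2 + e; rewrite /is_reduced -e ninv1.
case: w1 => [|k w1].
  by move=> _ _; rewrite word_perm_nil; case: w2 => // l w2 + e; rewrite /is_reduced -e ninv1.
case: w2 => [|l w2].
  by move=> _ + _ e; rewrite /is_reduced e word_perm_nil ninv1.
wlog le_kl : k l w1 w2 / (k <= l)%N => [W|].
  have [le_kl|/ltnW le_lk] := leqP k l; first exact: W.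
  move=> sz r1 r2 e; apply: esym; apply: (W l k w2 w1) => //.
  by move: r1 r2 sz; rewrite /is_reduced e => /eqP-> /eqP->.
move=> /= sz r1 r2 e; rewrite !word_elt_cons.
pose s := word_perm (k :: w1).
have s1 : word_perm w1 = (adj_tperm k * s)%g by rewrite /s word_perm_cons adj_tpermKl.
have s2 : word_perm w2 = (adj_tperm l * s)%g.
  by rewrite /s e word_perm_cons adj_tpermKl.
have /andP[r1' asc1] : is_reduced w1 && ascent (word_perm w1) k by rewrite -reduced_cons.
have /andP[r2' asc2] : is_reduced w2 && ascent (word_perm w2) l by rewrite -reduced_cons.
have sz2 : (size w2 <= n)%N.
  suff -> : size w2 = size w1 by [].
  by move: r1 r2; rewrite /is_reduced -e /= => /eqP <- /eqP [].
have dk : ~~ ascent s k by rewrite -ascent_adj -s1.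
have dl : ~~ ascent s l by rewrite -ascent_adj -s2.
have [ekl|ne_kl] := eqVneq k l.
  by rewrite ekl; congr (_ * _); apply: IH => //; rewrite s1 s2 ekl.
have lt_kl : (k < l)%N by rewrite ltn_neqAle le_kl andbT.
have [far|le_lk] := ltnP k.+1 l.
  have [w [rl el rk ek]] := far_descents far dk dl.
  have -> : word_elt w1 = word_elt (l :: w) by apply: IH; rewrite ?s1 ?el.
  have -> : word_elt w2 = word_elt (k :: w) by apply: IH; rewrite ?s2 ?ek.
  by rewrite !word_elt_cons !mulrA (hf_comm fam) ?far.
have elk : l = k.+1 :> nat by apply/eqP; rewrite eqn_leq le_lk lt_kl.
have [w [rl el rk ek]] := adjacent_descents elk dk dl.
have -> : word_elt w1 = word_elt (l :: k :: w) by apply: IH; rewrite ?s1 ?el.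
have -> : word_elt w2 = word_elt (k :: l :: w) by apply: IH; rewrite ?s2 ?ek.
by rewrite !word_elt_cons !mulrA (hf_braid fam).
Qed.

Lemma basis_word w : is_reduced w -> word_elt w = T (word_perm w).
Proof.
by move=> redw; have [e r] := reduced_wordP (word_perm w); apply: matsumoto.
Qed.

Lemma basis1 : T 1%g = 1.
Proof.
rewrite -(word_perm_nil m) -basis_word; first exact: big_nil.
by rewrite /is_reduced word_perm_nil ninv1.
Qed.

Lemma gen_basis_up k s : ascent s k -> g k * T s = T (adj_tperm k * s)%g.
Proof.
have [w <- redw] := ex_reduced s; move=> asc.
rewrite -word_perm_cons -!basis_word ?word_elt_cons //.
by rewrite reduced_cons redw.
Qed.

Lemma basis_gen_up k s : ascent s^-1%g k -> T s * g k = T (s * adj_tperm k)%g.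
Proof.
have [w <- redw] := ex_reduced s; move=> asc.
rewrite -word_perm_rcons -!basis_word //.
  by rewrite /word_elt -cats1 big_cat big_seq1.
by rewrite -is_reduced_rev rev_rcons reduced_cons is_reduced_rev redw word_perm_rev.
Qed.

Lemma gen_basis_down k s : ~~ ascent s k ->
  g k * T s = T (adj_tperm k * s)%g + (q - q^-1) *: T s.
Proof.
rewrite -ascent_adj => asc; rewrite -{1 3}[s](adj_tpermKl k) -gen_basis_up //.
by rewrite mulrA (hf_quad fam) mulrDl mul1r scalerAl.
Qed.

(** Both sides equal g x + x g + (q - q^-1) g x g. This is how sums that pair up under conjugation
    by a generator are shown to commute with it. *)
Lemma gen_pair_comm k x : g k * (x + g k * x * g k) = (x + g k * x * g k) * g k.
Proof.
have e1 : g k * (g k * x * g k) = x * g k + (q - q^-1) *: (g k * x * g k).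
  by rewrite !mulrA (hf_quad fam) !mulrDl mul1r -!scalerAl.
have e2 : g k * x * g k * g k = g k * x + (q - q^-1) *: (g k * x * g k).
  by rewrite -mulrA (hf_quad fam) mulrDr mulr1 -scalerAr.
by rewrite mulrDr mulrDl e1 e2 addrCA.
Qed.

Lemma gen_basis k : g k = T (adj_tperm k).
Proof.
by rewrite -[adj_tperm k]mulg1 -gen_basis_up ?basis1 ?mulr1 // /ascent !perm1.
Qed.

(** Only spanning is available at this point; independence follows from [bcoord_basis]. *)
Lemma basis_span (P : B -> Prop) :
  (forall s, P (T s)) -> (forall x y, P x -> P y -> P (x + y)) ->
  (forall a x, P x -> P (a *: x)) -> forall x, P x.
Proof.
move=> PT PD PZ x; suff [c ->] : exists c : 'S_m -> K, x = \sum_s c s *: T s.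
  apply: (big_ind P) => // [|s _]; last exact: PZ.
  by have := PZ 0 _ (PT 1%g); rewrite scale0r.
elim/(hf_ind fam): x => [|k x [c ->]|x y [c ->] [d ->]|a x [c ->]].
- exists (fun s => (s == 1%g)%:R); rewrite (bigD1 1%g) //= eqxx scale1r basis1.
  by rewrite big1 ?addr0 // => s /negPf->; rewrite scale0r.
- rewrite mulr_sumr.
  apply: (big_ind (fun x => exists c : 'S_m -> K, x = \sum_s c s *: T s)).
  + by exists (fun=> 0); rewrite big1 // => s _; rewrite scale0r.
  + move=> _ _ [e ->] [d ->]; exists (fun s => e s + d s).
    by rewrite -big_split; apply: eq_bigr => s _; rewrite scalerDl.
  + move=> s _; rewrite -scalerAr.
    have PTs u : exists c : 'S_m -> K, T u = \sum_s c s *: T s.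
      exists (fun s => (s == u)%:R); rewrite (bigD1 u) //= eqxx scale1r.
      by rewrite big1 ?addr0 // => v /negPf->; rewrite scale0r.
    have [asc|desc] := boolP (ascent s k).
      rewrite gen_basis_up //; have [d ->] := PTs (adj_tperm k * s)%g.
      exists (fun u => c s * d u); rewrite scaler_sumr.
      by apply: eq_bigr => u _; rewrite scalerA.
    rewrite gen_basis_down //; have [d ->] := PTs (adj_tperm k * s)%g.
    have [e ->] := PTs s; exists (fun u => c s * (d u + (q - q^-1) * e u)).
    rewrite scalerDr scalerA !scaler_sumr -big_split; apply: eq_bigr => u _ /=.
    by rewrite !scalerA -scalerDl; congr (_ *: _); ring.
- exists (fun s => c s + d s).
  by rewrite -big_split; apply: eq_bigr => s _; rewrite scalerDl.
- by exists (fun s => a * c s); rewrite scaler_sumr; apply: eq_bigr => s _; rewrite scalerA.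
Qed.

End HeckeFamilyTheory.

Section HeckeAlgebra.
Variables (K : fieldType) (q : K) (m : nat).
Hypothesis q_neq0 : q != 0.
Local Notation H := (hecke q m).
Local Notation g := (@hecke_gen K q m).

(* Hiding the quotient map behind an existential keeps unification from
   unfolding it. *)
Let hecke_pi : exists2 pi : free_alg K 'I_m.-1 -> H,
  [/\ forall x y, pi (x * y) = pi x * pi y, forall x y, pi (x - y) = pi x - pi y,
      forall x y, pi (x + y) = pi x + pi y & forall c, pi c%:A = c%:A] &
  (forall k, pi (free_gen K k) = g k) /\ (forall r, hecke_rel q r -> pi r = 0).
Proof.
exists (pres_pi (@hecke_rel K q m)).
  split.
  - exact: (rmorphM (pres_pi (@hecke_rel K q m))).
  - exact: (rmorphB (pres_pi (@hecke_rel K q m))).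
  - exact: (rmorphD (pres_pi (@hecke_rel K q m))).
  move=> c; apply: etrans (linearZ_LR (pres_pi (@hecke_rel K q m)) c 1) _.
  exact: (congr1 ( *:%R c) (rmorph1 (pres_pi (@hecke_rel K q m)))).
by split; [reflexivity | exact: pres_rel].
Qed.

Lemma hecke_gens : hecke_family q g.
Proof.
have [pi [piM piB piD piA] [pig pi0]] := hecke_pi.
split=> [k|k l e|k l e|]; last exact: pres_ind.
- have : (g k - q%:A) * (g k + q^-1%:A) = 0.
    by rewrite -pig -!piA -piB -piD -piM; apply/pi0/Hecke_quad.
  move: (g k) => x; rewrite mulrBl !mulrDr mulr_algr !mulr_algl scalerA mulfV // scale1r.
  move/eqP; rewrite subr_eq0 => /eqP e; apply: (addIr (q^-1 *: x)).
  by rewrite e scalerBl -addrA subrK addrC.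
- by apply: subr0_eq; rewrite -!pig -!piM -piB; apply/pi0/Hecke_braid.
by apply: subr0_eq; rewrite -!pig -!piM -piB; apply/pi0/Hecke_comm.
Qed.

End HeckeAlgebra.

(** * The action on tensors *)

Section TupleAction.
Variables (T : Type) (m : nat).
Implicit Types (I : m.-tuple T) (s u : 'S_m).

(** Because products compose from left to right, [tactM] makes this a left action, in step with left
    multiplication in the Hecke algebra. *)
Definition tact I s : m.-tuple T := [tuple tnth I (s i) | i < m].

Lemma tnth_tact I s i : tnth (tact I s) i = tnth I (s i).
Proof. by rewrite tnth_mktuple. Qed.

Lemma tact1 I : tact I 1%g = I.
Proof. by apply: eq_from_tnth => i; rewrite tnth_tact perm1. Qed.

Lemma tactM I s u : tact I (s * u)%g = tact (tact I u) s.
Proof. by apply: eq_from_tnth => i; rewrite !tnth_tact permM. Qed.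

End TupleAction.

Section Kets.
Variables (K : fieldType) (n m : nat).
Local Notation D := (tens_dim n m).
Implicit Types (I J : m.-tuple 'I_n) (k l : 'I_m).

Fact ket_key : unit. Proof. by []. Qed.
Definition ket := locked_with ket_key (fun I => delta_mx (enum_rank I) 0 : 'cV[K]_D).

Lemma ketD I : ket I = delta_mx (enum_rank I) 0.
Proof. by rewrite /ket locked_withE. Qed.

Lemma bra_ketE I J (M : 'M[K]_D) : bra_ket I J M = (M *m ket J) (enum_rank I) 0.
Proof.
rewrite ketD mxE (bigD1 (enum_rank J)) //= mxE !eqxx mulr1 big1 ?addr0 //.
by move=> j /negPf ne; rewrite mxE ne mulr0.
Qed.

Lemma ketE I J : ket J (enum_rank I) 0 = (I == J)%:R.
Proof. by rewrite ketD mxE (inj_eq enum_rank_inj) andbT. Qed.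

Lemma mx_ket_ext (M N : 'M[K]_D) :
  (forall J, M *m ket J = N *m ket J) -> M = N.
Proof.
move=> MN; apply/matrixP=> a b; rewrite -[a]enum_valK -[b]enum_valK.
by rewrite -![_ (enum_rank _) (enum_rank _)]/(bra_ket _ _ _) !bra_ketE MN.
Qed.

Lemma cV_ket (v : 'cV[K]_D) : v = \sum_J v (enum_rank J) 0 *: ket J.
Proof.
apply/matrixP=> a b; rewrite ord1 summxE -[a]enum_valK.
rewrite (bigD1 (enum_val a)) //= mxE ketE eqxx mulr1 big1 ?addr0 //.
by move=> J /negPf ne; rewrite mxE ketE eq_sym ne mulr0.
Qed.

Definition tset J k (i : 'I_n) : m.-tuple 'I_n :=
  [tuple if p == k then i else tnth J p | p < m].

Lemma in_factor_ket k (M : 'M[K]_n) J :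
  in_factor k M *m ket J = \sum_i M i (tnth J k) *: ket (tset J k i).
Proof.
apply/matrixP=> a b; rewrite ord1 -[a]enum_valK; set I := enum_val a.
rewrite -bra_ketE /bra_ket mxE !enum_rankK summxE.
cbv zeta; case: ifP => [/forallP eqIJ|].
  rewrite (bigD1 (tnth I k)) //= mxE ketE.
  have -> : I = tset J k (tnth I k).
    apply: eq_from_tnth => p; rewrite tnth_mktuple.
    by have := eqIJ p; case: eqP => [->|_ /= /eqP].
  rewrite tnth_mktuple eqxx eqxx mulr1 big1 ?addr0 // => i ne.
  rewrite mxE ketE; case: eqP => [/(congr1 (fun t => tnth t k))|_]; last by rewrite mulr0.
  by rewrite !tnth_mktuple eqxx => e; rewrite e eqxx in ne.
move=> nIJ; rewrite big1 // => i _; rewrite mxE ketE.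
case: eqP => [e|_]; last by rewrite mulr0.
case/negP: nIJ; apply/forallP=> p; apply/implyP=> /negPf ne.
by rewrite e tnth_mktuple ne.
Qed.

Lemma in_factor_delta_ket k (i j : 'I_n) J :
  in_factor k (delta_mx i j) *m ket J =
    (tnth J k == j)%:R *: ket (tset J k i).
Proof.
rewrite in_factor_ket (bigD1 i) //= mxE eqxx /= big1 ?addr0 // => p /negPf ne.
by rewrite mxE ne scale0r.
Qed.

Lemma tset_id J k : tset J k (tnth J k) = J.
Proof. by apply: eq_from_tnth => p; rewrite tnth_mktuple; case: eqP => // ->. Qed.

Variable q : K.

Lemma Rcheck_ket k l J : k != l ->
  Rcheck q n k l *m ket J =
  (q * (tnth J k == tnth J l)%:R + (q - q^-1) * (tnth J l < tnth J k)%N%:R) *: ket J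
  + (tnth J k != tnth J l)%:R *: ket (tact J (tperm k l)).
Proof.
move=> kl; set x := tnth J k; set y := tnth J l.
rewrite /Rcheck !mulmxDl -!scalemxAl !mulmx_suml.
have -> : \sum_i in_factor k (delta_mx i i) *m in_factor l (delta_mx i i) *m ket J
   = (x == y)%:R *: ket J.
  rewrite (bigD1 y) //= -mulmxA in_factor_delta_ket eqxx scale1r tset_id.
  rewrite in_factor_delta_ket -/x big1 ?addr0 => [|i /negPf ne].
    by case: eqP => [e|]; rewrite ?scale0r // -e tset_id.
  by rewrite -mulmxA in_factor_delta_ket -/y eq_sym ne scale0r mulmx0.
have -> : \sum_i (\sum_(j < n | i != j)
     in_factor k (delta_mx i j) *m in_factor l (delta_mx j i)) *m ket J
   = (x != y)%:R *: ket (tact J (tperm k l)).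
  rewrite (bigD1 y) //= [X in _ + X]big1 ?addr0 => [|i /negPf ne]; last first.
    rewrite mulmx_suml big1 // => j _.
    by rewrite -mulmxA in_factor_delta_ket -/y eq_sym ne scale0r mulmx0.
  rewrite mulmx_suml; have tk j : tnth (tset J l j) k = x.
    by rewrite tnth_mktuple (negPf kl).
  transitivity (\sum_(j < n | y != j) (x == j)%:R *: ket (tset (tset J l j) k y)).
    apply: eq_bigr => j _; rewrite -mulmxA in_factor_delta_ket eqxx scale1r.
    by rewrite in_factor_delta_ket tk.
  case: (eqVneq x y) => [exy|ne]; rewrite ?scale0r ?scale1r.
    by rewrite big1 // => j; rewrite exy => /negPf->; rewrite scale0r.
  rewrite (bigD1 x) ?(eq_sym y) //= eqxx scale1r big1 ?addr0 => [|j /andP[_ /negPf]]; last first.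
    by rewrite eq_sym => ->; rewrite scale0r.
  congr ket; apply: eq_from_tnth => p; rewrite !tnth_mktuple.
  by case: tpermP => [->|->|/eqP/negPf-> /eqP/negPf->]; rewrite ?eqxx // eq_sym (negPf kl).
have -> : \sum_(i < n) (\sum_(j < n | (j < i)%N)
     in_factor k (delta_mx i i) *m in_factor l (delta_mx j j)) *m ket J
   = (y < x)%N%:R *: ket J.
  transitivity (\sum_(i < n) \sum_(j < n | (j < i)%N) ((y == j) && (x == i))%:R *: ket J).
    apply: eq_bigr => i _; rewrite mulmx_suml; apply: eq_bigr => j _.
    rewrite -mulmxA in_factor_delta_ket -/y; case: eqP => [<-|_]; last first.
      by rewrite scale0r mulmx0 scale0r.
    rewrite scale1r tset_id in_factor_delta_ket -/x.
    by case: eqP => [<-|_]; rewrite ?tset_id //= !scale0r.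
  rewrite (bigD1 x) //= [X in _ + X]big1 ?addr0 => [|i /negPf ne]; last first.
    by rewrite big1 // => j _; rewrite eq_sym in ne; rewrite ne andbF scale0r.
  rewrite eqxx; case: (ltnP y x) => [lt|ge].
    rewrite (bigD1 y) //= eqxx big1 ?addr0 // => j /andP[_ /negPf].
    by rewrite eq_sym => ->; rewrite scale0r.
  rewrite scale0r big1 // => j ltj; case: eqP => [e|]; rewrite ?scale0r //.
  by move: ltj; rewrite -e ltnNge ge.
by rewrite !scalerA scalerDl addrAC.
Qed.

End Kets.

Section Action.
Variables (K : fieldType) (q : K) (n m : nat).
Hypothesis q_neq0 : q != 0.
Local Notation ket := (@ket K n m).
Local Notation A k := (Rcheck q n (ord_left k) (ord_right k)).
Implicit Types (I J f : m.-tuple 'I_n) (k l : 'I_m.-1) (s u : 'S_m).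

Definition rdiag (x y : 'I_n) : K :=
  if (x < y)%N then 0 else if (y < x)%N then q - q^-1 else q.
Definition rswap (x y : 'I_n) : K := (x != y)%:R.

Lemma left_neq_right k : ord_left k != ord_right k.
Proof. by rewrite -(inj_eq val_inj) /= neq_ltn ltnSn. Qed.

Lemma Rcheck_adj_ket k J : A k *m ket J =
  rdiag (tnth J (ord_left k)) (tnth J (ord_right k)) *: ket J +
  rswap (tnth J (ord_left k)) (tnth J (ord_right k)) *: ket (tact J (adj_tperm k)).
Proof.
rewrite Rcheck_ket ?left_neq_right //; congr (_ *: _ + _).
rewrite /rdiag -(inj_eq val_inj) /=.
by case: ltngtP; rewrite ?mulr0 ?mulr1 ?add0r ?addr0.
Qed.

Lemma Rcheck_quad k : (A k - q%:M) *m (A k + q^-1%:M) = 0.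
Proof.
apply: mx_ket_ext => J; rewrite mul0mx -mulmxA [X in _ *m X]mulmxDl Rcheck_adj_ket mul_scalar_mx.
set x := tnth J _; set y := tnth J _; set J' := tact J _.
have xJ' : tnth J' (ord_left k) = y by rewrite tnth_tact adj_left.
have yJ' : tnth J' (ord_right k) = x by rewrite tnth_tact adj_right.
have JJ' : tact J' (adj_tperm k) = J by rewrite -tactM adj_tpermK tact1.
rewrite mulmxBl mul_scalar_mx !mulmxDr -!scalemxAr !Rcheck_adj_ket -/x -/y -/J' xJ' yJ' JJ'.
rewrite /rdiag /rswap -!(inj_eq val_inj) /=.
move: (ket J) (ket J') => v v'.
case: ltngtP => e; rewrite ?scale0r ?add0r ?addr0 ?scale1r;
  by apply/matrixP=> a b; rewrite !mxE; move: (v a b) (v' a b) => ? ?; field.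
Qed.

Lemma Rcheck_comm k l : (k.+1 < l)%N -> A k *m A l = A l *m A k.
Proof.
move=> lt; apply: mx_ket_ext => J; rewrite -!mulmxA !Rcheck_adj_ket.
rewrite !mulmxDr -!scalemxAr !Rcheck_adj_ket !tnth_tact /adj_tperm !tpermD;
  rewrite -?(inj_eq val_inj) /=; try lia.
rewrite -!tactM -!/(adj_tperm _) adj_tperm_comm //.
move: (ket _) (ket _) (ket _) (ket _) => v1 v2 v3 v4.
by apply/matrixP=> a b; rewrite !mxE; ring.
Qed.

(** Both sides stay in the span of the six rearrangements of three letters. Their relative order
    fixes all coefficients, which leaves finitely many identities in q with the kets as
    indeterminate vectors. *)
Lemma Rcheck_braid k l : l = k.+1 :> nat ->
  A k *m A l *m A k = A l *m A k *m A l.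
Proof.
move=> elk; apply: mx_ket_ext => J; rewrite -!mulmxA.
have e_lk : ord_left l = ord_right k by apply: val_inj.
have al_p : adj_tperm l (ord_left k) = ord_left k.
  by apply: adj_tpermD => /=; lia.
have ak_t : adj_tperm k (ord_right l) = ord_right l.
  by apply: adj_tpermD => /=; lia.
have al_r : adj_tperm l (ord_right k) = ord_right l by rewrite -e_lk adj_left.
have al_t : adj_tperm l (ord_right l) = ord_right k by rewrite adj_right e_lk.
have b := adj_tperm_braid elk.
set x := tnth J (ord_left k); set y := tnth J (ord_right k); set z := tnth J (ord_right l).
pose a J' := (tnth J' (ord_left k), tnth J' (ord_right k), tnth J' (ord_right l)).
have Ak J' x' y' z' : a J' = (x', y', z') -> A k *m ket J' =
    rdiag x' y' *: ket J' + rswap x' y' *: ket (tact J' (adj_tperm k)).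
  by case=> <- <- _; apply: Rcheck_adj_ket.
have Al J' x' y' z' : a J' = (x', y', z') -> A l *m ket J' =
    rdiag y' z' *: ket J' + rswap y' z' *: ket (tact J' (adj_tperm l)).
  by case=> _ <- <-; rewrite Rcheck_adj_ket e_lk.
have ak J' x' y' z' : a J' = (x', y', z') -> a (tact J' (adj_tperm k)) = (y', x', z').
  by rewrite /a !tnth_tact adj_left adj_right ak_t => -[-> -> ->].
have al J' x' y' z' : a J' = (x', y', z') -> a (tact J' (adj_tperm l)) = (x', z', y').
  by rewrite /a !tnth_tact al_p al_r al_t => -[-> -> ->].
pose Jk := tact J (adj_tperm k); pose Jl := tact J (adj_tperm l).
pose Jkl := tact Jk (adj_tperm l); pose Jlk := tact Jl (adj_tperm k).
have aJ : a J = (x, y, z) by [].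
have aJk := ak _ _ _ _ aJ; have aJl := al _ _ _ _ aJ.
have aJkl := al _ _ _ _ aJk; have aJlk := ak _ _ _ _ aJl.
have top : tact Jkl (adj_tperm k) = tact Jlk (adj_tperm l).
  by rewrite /Jkl /Jlk /Jk /Jl -!tactM b.
have kk : tact Jk (adj_tperm k) = J by rewrite -tactM adj_tpermK tact1.
have ll : tact Jl (adj_tperm l) = J by rewrite -tactM adj_tpermK tact1.
rewrite (Ak _ _ _ _ aJ) (Al _ _ _ _ aJ) !mulmxDr -!scalemxAr.
rewrite (Al _ _ _ _ aJ) (Al _ _ _ _ aJk) (Ak _ _ _ _ aJ) (Ak _ _ _ _ aJl).
rewrite !mulmxDr -!scalemxAr.
rewrite (Ak _ _ _ _ aJ) (Al _ _ _ _ aJ) (Al _ _ _ _ aJk) (Ak _ _ _ _ aJl) (Ak _ _ _ _ aJk)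
  (Ak _ _ _ _ aJkl) (Al _ _ _ _ aJl) (Al _ _ _ _ aJlk).
rewrite -/Jk -/Jl -/Jkl -/Jlk top kk ll.
move: (ket J) (ket Jk) (ket Jl) (ket Jkl) (ket Jlk) (ket _) => v1 v2 v3 v4 v5 v6.
clearbody x y z; rewrite /rdiag /rswap -!(inj_eq val_inj) /=.
apply/matrixP=> i j; rewrite !mxE.
move: (v1 i j) (v2 i j) (v3 i j) (v4 i j) (v5 i j) (v6 i j) => w1 w2 w3 w4 w5 w6.
move: (nat_of_ord x) (nat_of_ord y) (nat_of_ord z) => x0 y0 z0.
by case: (ltngtP x0 y0) => xy; case: (ltngtP y0 z0) => yz; case: (ltngtP x0 z0) => xz;
  (try lia); rewrite ?mul0r ?add0r ?addr0 ?mul1r; field.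
Qed.

End Action.

Section ActionMorphism.
Variables (K : fieldType) (q : K) (n m : nat).
Hypothesis q_neq0 : q != 0.
Local Notation g := (@hecke_gen K q m).
Local Notation A k := (Rcheck q n (ord_left k) (ord_right k)).
Implicit Types (I J f : m.-tuple 'I_n) (k l : 'I_m.-1) (s u : 'S_m).

Let Rcheck_relations (F : algType K) (ev : {lrmorphism F -> 'M[K]_(tens_dim n m)})
    (t : 'I_m.-1 -> F) : (forall k, ev (t k) = A k) ->
  [/\ forall k, ev ((t k - q%:A) * (t k + q^-1%:A)) = 0,
      forall k l : 'I_m.-1, l = k.+1 :> nat ->
        ev (t k * t l * t k - t l * t k * t l) = 0 &
      forall k l : 'I_m.-1, (k.+1 < l)%N || (l.+1 < k)%N ->
        ev (t k * t l - t l * t k) = 0].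
Proof.
move=> evt; have evc c : ev c%:A = c%:M by rewrite linearZ rmorph1 -scalemx1.
split=> [k|k l kl|k l kl].
- by rewrite rmorphM rmorphB rmorphD /= !evc evt; apply: Rcheck_quad.
- rewrite rmorphB !rmorphM /= !evt; apply/eqP; rewrite subr_eq0; apply/eqP.
  exact: Rcheck_braid.
rewrite rmorphB !rmorphM /= !evt; apply/eqP; rewrite subr_eq0; apply/eqP.
by case/orP: kl => lt; [exact: Rcheck_comm | apply: esym; exact: Rcheck_comm].
Qed.

Lemma tens_act_rel r : hecke_rel q r -> free_eval (fun k : 'I_m.-1 => A k) r = 0.
Proof.
have [h1 h2 h3] := @Rcheck_relations (free_alg K 'I_m.-1)
  (free_eval (fun k : 'I_m.-1 => A k)) (@free_gen K _) (free_eval_gen _).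
case=> [i|i j ij|i j ij]; [exact: h1 | exact: (h2 i j ij) | exact: (h3 i j ij)].
Qed.

(** Counterpart of [hecke_family] for the action: later arguments see these four properties and not
    the quotient. *)
Record tensor_rep (B : algType K) (gen : 'I_m.-1 -> B)
    (act : B -> 'M[K]_(tens_dim n m)) : Prop := TensorRep {
  tr_M : forall x y, act (x * y) = act x *m act y;
  tr_1 : act 1 = 1%:M;
  tr_P : forall a x y, act (a *: x + y) = a *: act x + act y;
  tr_gen : forall k, act (gen k) = A k
}.

Lemma tens_act_rep : tensor_rep g (@tens_act K q m n).
Proof.
split.
- exact: (pres_eval_is_monoid_morphism tens_act_rel).2.
- exact: (pres_eval_is_monoid_morphism tens_act_rel).1.
- exact: (pres_eval_is_linear tens_act_rel).
by move=> k; apply: pres_eval_gen; apply: tens_act_rel.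
Qed.

(** Symmetry of the generators makes transposition realize the anti-automorphism T_s -> T_(s^-1),
    which turns statements on kets into statements on bras. *)
Lemma Rcheck_tr k : (A k)^T = A k.
Proof.
apply/matrixP=> a b; rewrite mxE -[a]enum_valK -[b]enum_valK.
set I := enum_val a; set J := enum_val b.
rewrite -![_ (enum_rank _) (enum_rank _)]/(bra_ket _ _ _) !bra_ketE !Rcheck_adj_ket.
rewrite !mxE !ketE; congr (_ + _).
  by rewrite (eq_sym J); case: eqP => [->//|_]; rewrite !mulr0.
have sw : (J == tact I (adj_tperm k)) = (I == tact J (adj_tperm k)).
  by apply/eqP/eqP => ->; rewrite -tactM adj_tpermK tact1.
rewrite sw; case: eqP => [->|_]; last by rewrite !mulr0.
by rewrite !tnth_tact adj_left adj_right /rswap eq_sym.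
Qed.

End ActionMorphism.

Section Nondecreasing.
Variables (n m : nat).
Implicit Types f : m.-tuple 'I_n.

Definition nondecr f := [forall i : 'I_m, forall j : 'I_m, (i <= j)%N ==> (tnth f i <= tnth f j)%N].

Lemma nondecrP f : reflect (forall i j : 'I_m, (i <= j)%N -> (tnth f i <= tnth f j)%N)
  (nondecr f).
Proof.
apply: (iffP forallP) => [h i j ij|h i]; first exact: (implyP (forallP (h i) j)).
by apply/forallP=> j; apply/implyP; apply: h.
Qed.

Definition ninvf f := invQ (fun i j => tnth f i == tnth f j).

Lemma ninvf1 f : ninvf f 1%g = 0%N.
Proof. by apply: big1 => -[i j]; rewrite /inversion !perm1 /=; case: ltngtP. Qed.

Lemma ninvf_up f u k : ascent u k -> ninvf f (adj_tperm k * u)%g =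
  ((tnth f (u (ord_right k)) == tnth f (u (ord_left k))) + ninvf f u)%N.
Proof. exact: invQ_adj. Qed.

End Nondecreasing.

Section TensorRepTheory.
Variables (K : fieldType) (q : K) (n m : nat) (B : algType K) (g : 'I_m.-1 -> B).
Variable act : B -> 'M[K]_(tens_dim n m).
Hypotheses (q_neq0 : q != 0) (fam : hecke_family q g) (rep : tensor_rep q g act).
Local Notation T := (basis_elt g).
Local Notation ket := (@ket K n m).
Implicit Types (I J f : m.-tuple 'I_n) (k l : 'I_m.-1) (s u : 'S_m).

Lemma actD x y : act (x + y) = act x + act y.
Proof. by rewrite -[x]scale1r (tr_P rep) !scale1r. Qed.

Lemma act0 : act 0 = 0.
Proof. by apply: (addIr (act 0)); rewrite -actD !add0r. Qed.

Lemma actZ a x : act (a *: x) = a *: act x.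
Proof. by rewrite -[a *: x]addr0 (tr_P rep) act0 addr0. Qed.

Lemma act_sum (X : Type) (r : seq X) (P : pred X) (F : X -> B) :
  act (\sum_(i <- r | P i) F i) = \sum_(i <- r | P i) act (F i).
Proof. exact: (big_morph _ actD act0). Qed.

Lemma act_tr s : (act (T s))^T = act (T s^-1%g).
Proof.
have [w <- redw] := ex_reduced s.
rewrite -word_perm_rev -!(basis_word fam) // ?is_reduced_rev // => {redw}.
elim: w => [|k w IH]; first by rewrite /word_elt big_nil (tr_1 rep) trmx1.
rewrite word_elt_cons (tr_M rep) trmx_mul IH (tr_gen rep) Rcheck_tr.
by rewrite rev_cons /word_elt -cats1 big_cat big_seq1 (tr_M rep) (tr_gen rep).
Qed.

(** Along a chain of ascents starting from a sorted word, each generator meets two letters in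
    nondecreasing order. The term q - q^-1 therefore never occurs: distinct letters are exchanged
    and equal ones give a factor q. *)
Lemma act_basis_ket f s : nondecr f ->
  act (T s) *m ket f = q ^+ ninvf f s *: ket (tact f s).
Proof.
move=> /nondecrP nd; elim/perm_ind_up: s => [|k s asc IH].
  rewrite (basis1 fam) // (tr_1 rep) mul1mx tact1.
  by rewrite ninvf1 scale1r.
rewrite -(gen_basis_up fam) // (tr_M rep) -mulmxA IH -scalemxAr (tr_gen rep).
rewrite Rcheck_adj_ket !tnth_tact ninvf_up //.
have := nd _ _ (ltnW asc); rewrite leq_eqVlt -tactM /rdiag /rswap -!(inj_eq val_inj) /=.
rewrite (eq_sym (tnth f (s (ord_right k)) : nat)).
case: ltngtP => //= e _; last first.
  rewrite scale0r addr0 scalerA -exprSr; congr (_ *: ket _).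
  apply: eq_from_tnth => i; rewrite !tnth_tact permM.
  by case: tpermP => // ->; apply: val_inj.
by rewrite scale0r add0r scale1r.
Qed.

End TensorRepTheory.

(** * Parabolic symmetrizers and the symmetrizing form *)

Section PairSum.
Variables (m : nat) (V : nmodType).
Implicit Types (k : 'I_m.-1) (s u : 'S_m) (P : pred 'S_m).

Lemma sum_ascent k P (F : 'S_m -> V) :
  (forall u, P (adj_tperm k * u)%g = P u) ->
  \sum_(u | P u) F u =
    \sum_(u | P u && ascent u k) (F u + F (adj_tperm k * u)%g).
Proof.
move=> Pk; rewrite (bigID (fun u => ascent u k)) big_split /=; congr (_ + _).
rewrite (reindex_inj (mulgI (adj_tperm k))) /=; apply: eq_bigl => u.
by rewrite Pk ascent_adj negbK.
Qed.

Lemma sum_permV P (F : 'S_m -> V) :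
  \sum_(u | P u) F u = \sum_(u | P u^-1%g) F u^-1%g.
Proof. by rewrite (reindex_inj invg_inj). Qed.

End PairSum.

Section Stabilizer.
Variables (m : nat) (F : 'I_m -> nat).
Implicit Types (k : 'I_m.-1) (s u : 'S_m) (i j : 'I_m).

Definition stab : pred 'S_m := fun u => [forall i, F (u i) == F i].

Lemma stabP u : reflect (forall i, F (u i) = F i) (stab u).
Proof. by apply: (iffP forallP) => h i; apply/eqP. Qed.

Lemma stab1 : stab 1%g.
Proof. by apply/stabP=> i; rewrite perm1. Qed.

Lemma stabV u : stab u^-1%g = stab u.
Proof.
suff h v : stab v -> stab v^-1%g by apply/idP/idP => /h //; rewrite invgK.
by move/stabP=> h; apply/stabP=> i; rewrite -{2}(permKV v i) h.
Qed.

Lemma stab_adj k u : F (ord_left k) = F (ord_right k) ->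
  stab (adj_tperm k * u)%g = stab u.
Proof.
move=> Fk; have Fa i : F (adj_tperm k i) = F i by case: tpermP => [->|->|].
suff h v : stab v -> stab (adj_tperm k * v)%g.
  by apply/idP/idP => /h //; rewrite adj_tpermKl.
by move/stabP=> h; apply/stabP=> i; rewrite permM h Fa.
Qed.

Hypothesis F_nd : forall i j, (i <= j)%N -> (F i <= F j)%N.

Lemma stab_descent k u : stab u -> ~~ ascent u k -> F (ord_left k) = F (ord_right k).
Proof.
move=> /stabP st; rewrite /ascent -leqNgt => /F_nd; rewrite !st => le.
by apply/eqP; rewrite eqn_leq le F_nd.
Qed.

(** For nondecreasing [F] the stabilizer is a standard parabolic subgroup: a descent of one of its
    elements lies inside a level set of [F], so descending in the weak order does not leave the
    subgroup. *)
Lemma stab_ind (P : 'S_m -> Prop) : P 1%g ->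
  (forall k s, F (ord_left k) = F (ord_right k) -> ascent s k -> stab s ->
     P s -> P (adj_tperm k * s)%g) ->
  forall s, stab s -> P s.
Proof.
move=> P1 PS s; move: {2}(ninv s) (leqnn (ninv s)) => d.
elim: d s => [|d IH] s le_d st; have [->//|/ex_descent[k desc]] := eqVneq s 1%g.
  by move: le_d; rewrite (ninv_adjN desc).
have Fk := stab_descent st desc.
rewrite -[s](adj_tpermKl k); apply: PS => //; rewrite ?ascent_adj ?stab_adj //.
by apply: IH; rewrite ?stab_adj // -ltnS -(ninv_adjN desc).
Qed.

End Stabilizer.

Section Symmetrizer.
Variables (K : fieldType) (q : K) (m : nat) (B : algType K) (g : 'I_m.-1 -> B).
Hypotheses (q_neq0 : q != 0) (fam : hecke_family q g).
Local Notation T := (basis_elt g).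
Variable F : 'I_m -> nat.
Implicit Types (k l : 'I_m.-1) (s u : 'S_m).

Definition symm : B := \sum_(u | stab F u) q ^+ ninv u *: T u.

(** The scalar by which [symm] acts on vectors on which all generators of the stabilizer act by
    q. *)
Definition poincare : K := \sum_(u | stab F u) q ^+ (2 * ninv u).

Let eigen_pair (V : lmodType K) (a b : V) (c : K) :
  c *: b + (q * c) *: (a + (q - q^-1) *: b) = q *: (c *: a + (q * c) *: b).
Proof.
rewrite !scalerDr !scalerA addrCA -scalerDl.
by congr (_ + _ *: _); field.
Qed.

(** Each pair T_u + q T_(s_k u) with k an ascent of u is already an eigenvector of g_k. *)
Lemma gen_symm k : F (ord_left k) = F (ord_right k) -> g k * symm = q *: symm.
Proof.
move=> Fk; have stk u := stab_adj u Fk.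
rewrite /symm (sum_ascent _ stk) mulr_sumr scaler_sumr; apply: eq_bigr => u /andP[_ asc].
rewrite ninv_adj // mulrDr -!scalerAr (gen_basis_up fam asc).
rewrite (gen_basis_down fam); last by rewrite ascent_adj asc.
by rewrite adj_tpermKl exprS eigen_pair.
Qed.

Lemma symm_gen k : F (ord_left k) = F (ord_right k) -> symm * g k = q *: symm.
Proof.
move=> Fk; have stk u : stab F (adj_tperm k * u)^-1%g = stab F u^-1%g.
  by rewrite !stabV stab_adj.
rewrite /symm sum_permV (sum_ascent _ stk) mulr_suml scaler_sumr.
apply: eq_bigr => u /andP[_ asc].
rewrite !ninv_permV ninv_adj // mulrDl -!scalerAl invMg tpermV.
rewrite (basis_gen_up fam); last by rewrite invgK.
rewrite -(basis_gen_up fam); last by rewrite invgK.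
rewrite -mulrA (hf_quad fam) mulrDr mulr1 -scalerAr.
by rewrite exprS eigen_pair.
Qed.

End Symmetrizer.

Lemma bra_ketM (A : nzRingType) n m (I J : m.-tuple 'I_n) (P Q : 'M[A]_(tens_dim n m)) :
  bra_ket I J (P *m Q) = \sum_L bra_ket I L P * bra_ket L J Q.
Proof.
rewrite /bra_ket mxE (reindex enum_rank) //=.
by exists enum_val => i _; rewrite ?enum_rankK ?enum_valK.
Qed.

Section Bra.
Variables (K : fieldType) (n m : nat).
Implicit Types (I J : m.-tuple 'I_n) (M : 'M[K]_(tens_dim n m)).
Local Notation ket := (@ket K n m).

Lemma bra_ket_tr I J M : bra_ket I J M^T = bra_ket J I M.
Proof. by rewrite /bra_ket mxE. Qed.

Lemma bra_ket_sum I J (X : Type) (r : seq X) (P : pred X) F :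
  bra_ket I J (\sum_(i <- r | P i) F i : 'M[K]_(tens_dim n m)) =
    \sum_(i <- r | P i) bra_ket I J (F i).
Proof. exact: summxE. Qed.

Lemma bra_ketZ I J a M : bra_ket I J (a *: M) = a * bra_ket I J M.
Proof. by rewrite /bra_ket mxE. Qed.

Lemma bra_ketD I J M M' : bra_ket I J (M + M') = bra_ket I J M + bra_ket I J M'.
Proof. by rewrite /bra_ket mxE. Qed.

End Bra.

Section TraceForm.
Variables (K : fieldType) (q : K) (m : nat) (B : algType K) (g : 'I_m.-1 -> B).
Variable act0 : B -> 'M[K]_(tens_dim m m).
Hypotheses (q_neq0 : q != 0) (fam : hecke_family q g) (rep0 : tensor_rep q g act0).
Local Notation T := (basis_elt g).
Implicit Types (k l : 'I_m.-1) (s u : 'S_m) (x y : B).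

Local Notation idt := (ord_tuple m).
Local Notation ket0 := (@ket K m m).

Lemma nondecr_ord_tuple : nondecr idt.
Proof. by apply/nondecrP=> i j; rewrite !tnth_ord_tuple. Qed.

Lemma tact_ord_tuple_inj : injective (tact idt).
Proof.
move=> s u /(congr1 (fun t => tnth t)) e; apply/permP=> i.
by have := congr1 (fun f => f i) e; rewrite !tnth_tact !tnth_ord_tuple.
Qed.

Lemma act_basis_id s : act0 (T s) *m ket0 idt = ket0 (tact idt s).
Proof.
rewrite (act_basis_ket fam rep0) ?nondecr_ord_tuple //.
suff -> : ninvf idt s = 0%N by rewrite scale1r.
apply: big1 => -[i j] /andP[_ /=]; rewrite !tnth_ord_tuple.
by case: (eqVneq (s i) (s j)) => [->|]; rewrite ?ltnn.
Qed.

(** The coefficient of [T s] in [x]. The rearrangements of the word (0, ..., m - 1) are pairwise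
    distinct kets, and T_s sends this word to one of them without any power of q. *)
Definition bcoord x s : K := bra_ket (tact idt s) idt (act0 x).

Definition tform x := bcoord x 1%g.

Lemma bcoord_basis u s : bcoord (T u) s = (s == u)%:R.
Proof.
by rewrite /bcoord bra_ketE act_basis_id ketE (inj_eq tact_ord_tuple_inj).
Qed.

Lemma bcoordP a x y s : bcoord (a *: x + y) s = a * bcoord x s + bcoord y s.
Proof. by rewrite /bcoord (tr_P rep0) bra_ketD bra_ketZ. Qed.

Lemma bcoord_sum (X : Type) (r : seq X) (P : pred X) F s :
  bcoord (\sum_(i <- r | P i) F i) s = \sum_(i <- r | P i) bcoord (F i) s.
Proof. by rewrite /bcoord (act_sum rep0) bra_ket_sum. Qed.

Lemma bcoordZ a x s : bcoord (a *: x) s = a * bcoord x s.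
Proof. by rewrite /bcoord (actZ rep0) bra_ketZ. Qed.

Lemma bcoordE x : x = \sum_s bcoord x s *: T s.
Proof.
elim/(basis_span fam): x => [u|x y ex ey|a x ex].
- rewrite (bigD1 u) //= bcoord_basis eqxx scale1r big1 ?addr0 // => s /negPf ne.
  by rewrite bcoord_basis ne scale0r.
- rewrite [in LHS]ex [in LHS]ey -big_split; apply: eq_bigr => s _ /=.
  by rewrite -scalerDl -[in RHS](scale1r x) bcoordP mul1r.
by rewrite [in LHS]ex scaler_sumr; apply: eq_bigr => s _; rewrite scalerA bcoordZ.
Qed.

(** Moving T_s to the bra by transposition turns this into the pairing of the two kets reached by
    s^-1 and u, which are equal or orthogonal. *)
Lemma tform_basisM s u : tform (T s * T u) = (s == u^-1%g)%:R.
Proof.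
rewrite /tform /bcoord tact1 (tr_M rep0) bra_ketM.
rewrite (bigD1 (tact idt u)) //= [X in _ + X]big1 ?addr0 => [|L /negPf ne]; last first.
  by rewrite [X in _ * X]bra_ketE act_basis_id ketE ne mulr0.
rewrite [X in _ * X]bra_ketE act_basis_id ketE eqxx mulr1.
rewrite -bra_ket_tr (act_tr fam rep0) bra_ketE act_basis_id ketE.
by rewrite (inj_eq tact_ord_tuple_inj) eq_sym eq_invg_sym // eq_sym; congr (_ == _)%:R.
Qed.

Lemma tformM x y : tform (x * y) = \sum_s bcoord x s * bcoord y s^-1%g.
Proof.
rewrite [in LHS](bcoordE x) mulr_suml /tform bcoord_sum; apply: eq_bigr => s _.
rewrite [in LHS](bcoordE y) mulr_sumr bcoord_sum (bigD1 s^-1%g) //=.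
rewrite big1 ?addr0 => [|u ne].
  by rewrite -scalerAl -scalerAr !bcoordZ -[bcoord _ 1%g]/(tform _) tform_basisM invgK eqxx mulr1.
rewrite -scalerAl -scalerAr !bcoordZ -[bcoord _ 1%g]/(tform _) tform_basisM.
have -> : (s == u^-1)%g = false by apply: contraNF ne => /eqP->; rewrite invgK.
by rewrite !mulr0.
Qed.

Lemma tformC x y : tform (x * y) = tform (y * x).
Proof.
rewrite !tformM (reindex_inj invg_inj); apply: eq_bigr => s _.
by rewrite invgK mulrC.
Qed.

Lemma tform_nondeg x : (forall y, tform (x * y) = 0) -> x = 0.
Proof.
move=> x0; rewrite (bcoordE x) big1 // => s _.
have := x0 (T s^-1%g); rewrite tformM (bigD1 s) //= bcoord_basis eqxx mulr1.
rewrite big1 ?addr0 => [->|u /negPf ne]; first by rewrite scale0r.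
by rewrite bcoord_basis (inj_eq invg_inj) ne mulr0.
Qed.

Section Matrix_coefficient.
Variables (n : nat) (act : B -> 'M[K]_(tens_dim n m)).
Hypothesis rep : tensor_rep q g act.
Variable f : m.-tuple 'I_n.
Hypothesis f_nd : nondecr f.
Local Notation F := (fun i : 'I_m => nat_of_ord (tnth f i)).

Lemma stab_tact u : stab F u = (tact f u == f).
Proof.
apply/stabP/eqP => [h|e i]; last by rewrite -{2}e tnth_tact.
by apply: eq_from_tnth => i; rewrite tnth_tact; apply: val_inj; apply: h.
Qed.

Lemma ninvf_stab u : stab F u -> ninvf f u = ninv u.
Proof.
move=> /stabP st; apply: eq_bigr => -[i j] /andP[/= ij uji].
rewrite -(inj_eq val_inj) /=.
have := nondecrP _ f_nd _ _ (ltnW ij); have := nondecrP _ f_nd _ _ (ltnW uji).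
by rewrite !st; case: ltngtP.
Qed.

(** The bridge between diagonal matrix coefficients and the form tau. For x = T_u both sides are
    q^(length of u) when u stabilizes f, and 0 otherwise. *)
Lemma bra_ket_symm x : bra_ket f f (act x) = tform (x * symm q g F).
Proof.
elim/(basis_span fam): x => [u|x y ex ey|a x ex].
- rewrite bra_ketE (act_basis_ket fam rep) // mxE ketE eq_sym -stab_tact.
  rewrite /symm mulr_sumr /tform bcoord_sum (bigID (pred1 u^-1%g)) /= addrC big1 => [|s /andP[_ /negPf ne]].
    rewrite add0r; case: (boolP (stab F u)) => st.
      rewrite (big_pred1 u^-1%g) => [|s /=]; last first.
        by case: eqP => [->|]; rewrite ?andbF // stabV st.
      rewrite -scalerAr bcoordZ -[bcoord _ 1%g]/(tform _) tform_basisM invgK eqxx ninv_permV.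
      by rewrite (ninvf_stab st).
    rewrite mulr0 big1 // => s /andP[sts /eqP e].
    by rewrite -stabV -e sts in st.
  by rewrite -scalerAr bcoordZ -[bcoord _ 1%g]/(tform _) tform_basisM -eq_invg_sym eq_sym ne mulr0.
- by rewrite -[x]scale1r (tr_P rep) mulrDl bra_ketD /tform -scalerAl bcoordP bra_ketZ ex ey.
by rewrite (actZ rep) bra_ketZ ex -scalerAl /tform bcoordZ.
Qed.

End Matrix_coefficient.
End TraceForm.

(** * Parabolic subgroups as stabilizers of block indices *)

Section BlockIndex.
Variable m : nat.
Implicit Types (J : {set 'I_m.-1}) (k s : 'I_m.-1) (i j : 'I_m).

(* The index of the block of i, when k and k + 1 lie in one block iff k \in J. *)
Definition block J i : nat := #|[set k : 'I_m.-1 | (k < i)%N && (k \notin J)]|.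

Lemma block_nd J i j : (i <= j)%N -> (block J i <= block J j)%N.
Proof.
move=> ij; apply/subset_leq_card/subsetP=> k; rewrite !inE => /andP[ki ->].
by rewrite (leq_trans ki).
Qed.

Lemma block_le J i : (block J i <= i)%N.
Proof.
rewrite /block -[leqRHS](size_iota 0) cardE -(size_map (@nat_of_ord _)).
apply: uniq_leq_size; first by rewrite map_inj_uniq ?enum_uniq //; apply: ord_inj.
by move=> x /mapP[k]; rewrite mem_enum inE => /andP[ki _] ->; rewrite mem_iota.
Qed.

Lemma block_step J k :
  block J (ord_right k) = ((k \notin J) + block J (ord_left k))%N.
Proof.
rewrite /block; case: (boolP (k \in J)) => [kJ|kJ] /=.
  apply: eq_card => l; rewrite !inE /= ltnS leq_eqVlt.
  by case: eqP => //= /val_inj->; rewrite kJ !andbF.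
rewrite -[X in (X + _)%N]/(nat_of_bool true).
have -> : true = (k \notin [set l : 'I_m.-1 | (l < ord_left k)%N && (l \notin J)]).
  by rewrite inE /= ltnn.
rewrite -cardsU1; apply: eq_card => l; rewrite !inE /= ltnS leq_eqVlt.
by rewrite -(inj_eq val_inj l k) /=; case: eqP => [/val_inj->|]; rewrite ?kJ.
Qed.

Lemma block_eq_step J k : (block J (ord_left k) == block J (ord_right k)) = (k \in J).
Proof. by rewrite block_step; case: (k \in J); rewrite ?eqxx /= ?ltn_eqF. Qed.

Lemma block_add J s i : s \notin J -> block J i = (block (s |: J) i + (s < i)%N)%N.
Proof.
move=> sJ; rewrite /block; case: (boolP (s < i)%N) => si /=; last first.
  rewrite addn0; apply: eq_card => l; rewrite !inE.
  by case: eqP => // ->; rewrite (negPf si).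
rewrite addnC -[X in (X + _)%N]/(nat_of_bool true).
have -> : true = (s \notin [set l : 'I_m.-1 | (l < i)%N && (l \notin s |: J)]).
  by rewrite !inE eqxx andbF.
rewrite -cardsU1; apply: eq_card => l; rewrite !inE.
by case: eqP => //= ->; rewrite si sJ.
Qed.

Lemma block_above J i j : (forall k, k \in J -> (k < i)%N) -> (i < j)%N ->
  (block J i < block J j)%N.
Proof.
move=> Ji ij; have im : (i < m.-1)%N by have := ltn_ord j; lia.
have ij' : (ord_right (Ordinal im) <= j)%N by [].
apply: leq_trans (block_nd J ij'); rewrite block_step.
have -> : Ordinal im \notin J by apply/negP => /Ji /=; rewrite ltnn.
by rewrite add1n ltnS; apply: eq_leq; congr (block J _); apply: val_inj.
Qed.

Lemma stab_block_fix J u i : (forall k, k \in J -> (k < i)%N) -> stab (block J) u ->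
  forall j, (i < j)%N -> u j = j.
Proof.
move=> Ji /stabP st j ij.
have inj (a b : 'I_m) : (i < b)%N -> block J a = block J b -> a = b.
  move=> ib e; apply: val_inj; case: (ltngtP a b) => // lt; last first.
    by have := block_above (fun k kJ => ltn_trans (Ji k kJ) ib) lt; rewrite e ltnn.
  have [ai|ia] := leqP a i.
    by have := leq_trans (block_above Ji ib) (eq_leq (esym e));
      rewrite ltnNge block_nd.
  by have := block_above (fun k kJ => ltn_trans (Ji k kJ) ia) lt; rewrite e ltnn.
exact: inj.
Qed.

Lemma stab_block0 u : stab (block set0) u = (u == 1%g).
Proof.
apply/idP/eqP => [st|->]; last exact: stab1.
apply/permP=> i; rewrite perm1; apply: val_inj; have := stabP _ _ st i.
have b0 (j : 'I_m) : forall k : 'I_m.-1, k \in set0 -> (k < j)%N by move=> k; rewrite inE.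
by case: (ltngtP (u i) i) => // /(block_above (b0 _)) lt e; rewrite e ltnn in lt.
Qed.

(** As [J] lies below s, the index s + 1 is a block of its own for [J], and adding s attaches it to
    the block of s. The smaller parabolic subgroup is thus a point stabilizer in the larger one. *)
Lemma stab_block_add J s u : (forall k, k \in J -> (k < s)%N) ->
  stab (block J) u = stab (block (s |: J)) u && (u (ord_right s) == ord_right s).
Proof.
move=> Js; have sJ : s \notin J by apply/negP => /Js; rewrite ltnn.
have Jl k : k \in J -> (k < ord_left s)%N by apply: Js.
have Jr k : k \in s |: J -> (k < ord_right s)%N.
  by rewrite !inE => /orP[/eqP->|/Js ks] //=; rewrite ltnW.
have le_s (v : 'S_m) i : (forall j : 'I_m, (s < j)%N -> v j = j) -> (s < v i)%N = (s < i)%N.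
  move=> fix_v; apply/idP/idP => [si|si]; last by rewrite fix_v.
  by have := fix_v _ si => /perm_inj e; rewrite -e.
apply/idP/andP => [st|[st /eqP fix_s]].
  have fix_u := stab_block_fix Jl st.
  split; last by apply/eqP/fix_u => /=.
  apply/stabP=> i; have := stabP _ _ st i.
  by rewrite !(block_add _ sJ) le_s // => /addIn.
have fix_u (j : 'I_m) : (s < j)%N -> u j = j.
  rewrite -[(s < j)%N]/(ord_right s <= j)%N leq_eqVlt => /orP[/eqP e|].
    by rewrite -(val_inj e : ord_right s = j).
  exact: (stab_block_fix Jr st).
apply/stabP=> i; have := stabP _ _ st i.
by rewrite !(block_add _ sJ) le_s // => ->.
Qed.

End BlockIndex.

Lemma sum_interval (V : nmodType) (m a r : nat) (h : nat -> V) : (r < m)%N -> (a <= r)%N ->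
  \sum_(j < m | (a <= j <= r)%N) h (r - j)%N = \sum_(d < (r - a).+1) h d.
Proof.
move=> rm ar; rewrite -(big_mkord (fun j => a <= j <= r)%N (fun j => h (r - j)%N)).
transitivity (\sum_(a <= j < r.+1) h (r - j)%N).
  rewrite (@big_nat_widen _ _ _ a r.+1 m) // (@big_nat_widenl _ _ _ a 0) //.
  by apply: eq_bigl => j; rewrite ltnS andbC.
rewrite big_rev_mkord subSn //; apply: eq_bigr => d _; congr h.
by have := ltn_ord d; lia.
Qed.

(** * Cosets in a parabolic subgroup of the one without its last generator *)

Section Recursion.
Variables (m : nat) (J : {set 'I_m.-1}) (s : 'I_m.-1).
Hypothesis Js : forall k, k \in J -> (k < s)%N.
Local Notation F := (block (s |: J)).
Local Notation r := (ord_right s).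
Implicit Types (k : 'I_m.-1) (u : 'S_m) (i j : 'I_m).

Let Jr k : k \in s |: J -> (k < r)%N.
Proof. by rewrite !inE => /orP[/eqP->|/Js ks] //=; rewrite ltnW. Qed.

Lemma last_block : exists2 a, (a <= s)%N & forall j, (F j == F r) = (a <= j <= r)%N.
Proof.
have Fl : exists a, [exists j : 'I_m, (j == a :> nat) && (F j == F r)].
  by exists r; apply/existsP; exists r; rewrite !eqxx.
case: (ex_minnP Fl) => a /existsP[j0 /andP[/eqP ej0 /eqP Fj0]] mina.
exists a.
  apply: mina; apply/existsP; exists (ord_left s); rewrite eqxx /=.
  by rewrite block_eq_step !inE eqxx.
move=> j; apply/idP/andP => [Fj|[aj jr]].
  split; first by apply: mina; apply/existsP; exists j; rewrite eqxx.
  by rewrite leqNgt; apply/negP => /(block_above Jr); rewrite (eqP Fj) ltnn.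
rewrite eqn_leq block_nd //= -Fj0; apply: block_nd.
by rewrite ej0.
Qed.

(** The cosets are told apart by the preimage j of the last index r; those that occur are the
    indices of the last block. *)
Lemma sum_stab_last (V : nmodType) (G : 'S_m -> V) :
  \sum_(u | stab F u) G u = \sum_(j | F j == F r) \sum_(u | stab F u && (u j == r)) G u.
Proof.
rewrite (partition_big (fun u : 'S_m => u^-1%g r) (fun j => F j == F r)) /=; last first.
  by move=> u; rewrite -stabV => /stabP->.
apply: eq_bigr => j _; apply: eq_bigl => u; congr (_ && _).
by apply/eqP/eqP => [<-|<-]; rewrite ?permKV ?permK.
Qed.

Lemma sum_stab_right (V : nmodType) (G : 'S_m -> V) :
  \sum_(u | stab F u && (u r == r)) G u = \sum_(u | stab (block J) u) G u.
Proof. by apply: eq_bigl => u; rewrite [RHS](stab_block_add _ Js). Qed.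

(** The elements of the subgroup fix everything beyond r, so r is the largest value available in the
    last block. *)
Lemma ascent_last k u : (k <= s)%N -> stab F u -> u (ord_right k) = r -> ascent u k.
Proof.
move=> ks st ur; rewrite /ascent ur.
have ne : u (ord_left k) != r.
  by rewrite -ur (inj_eq perm_inj) -(inj_eq val_inj) /= neq_ltn ltnSn.
rewrite ltn_neqAle [_ != _]ne /= leqNgt; apply/negP => gt.
have := stab_block_fix Jr st gt => /perm_inj e; move: gt; rewrite e /=.
by rewrite ltnNge ltnW.
Qed.

Lemma block_eq_below k : (k <= s)%N -> F (ord_left k) = F r -> k \in s |: J.
Proof.
move=> ks Fk; have [a _ blk] := last_block; rewrite -block_eq_step Fk eq_sym blk /= ltnS ks andbT.
by move/eqP: Fk; rewrite blk => /andP[/leq_trans->].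
Qed.

(** Passes from the coset of k + 1 to that of k. Starting at r this reaches every coset, with
    lengths growing by one each time by [ascent_last]. *)
Lemma sum_stab_left (V : nmodType) (G : 'S_m -> V) k :
    (k <= s)%N -> F (ord_left k) = F r ->
  \sum_(u | stab F u && (u (ord_left k) == r)) G u =
  \sum_(u | stab F u && (u (ord_right k) == r)) G (adj_tperm k * u)%g.
Proof.
move=> ks /(block_eq_below ks) kJ.
rewrite (reindex_inj (mulgI (adj_tperm k))) /=; apply: eq_bigl => u.
by rewrite stab_adj ?permM ?adj_left //; apply/eqP; rewrite block_eq_step.
Qed.

End Recursion.

(** * Nonvanishing of Poincaré polynomials *)

Section PoincareNonzero.
Variables (K : fieldType) (q : K) (m : nat).
Hypothesis q_nroot : forall k : nat, (0 < k)%N -> q ^+ k != 1.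
Implicit Types (J : {set 'I_m.-1}) (s : 'I_m.-1) (F : 'I_m -> nat).

Lemma geom_neq0 n : \sum_(d < n.+1) q ^+ (2 * d) != 0.
Proof.
have := q_nroot (isT : 0 < 2 * n.+1)%N; apply: contra => /eqP e.
rewrite -subr_eq0 exprM subrX1; apply/eqP.
transitivity ((q ^+ 2 - 1) * \sum_(d < n.+1) q ^+ (2 * d)); last by rewrite e mulr0.
by congr (_ * _); apply: eq_bigr => d _; rewrite exprM.
Qed.

(** The coset of s + 1 - d consists of products with an element of length d, lengths adding up, and
    contributes the factor q^(2d). *)
Lemma poincare_add J s : (forall k, k \in J -> (k < s)%N) ->
  exists n, poincare q (block (s |: J)) =
    poincare q (block J) * \sum_(d < n.+1) q ^+ (2 * d).
Proof.
move=> Js; have [a a_s blk] := last_block Js.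
rewrite /poincare sum_stab_last.
pose p j := \sum_(u : 'S_m | stab (block (s |: J)) u && (u j == ord_right s)) q ^+ (2 * ninv u).
have pE d : (d <= s.+1 - a)%N -> forall j : 'I_m, j = (s.+1 - d)%N :> nat ->
    p j = poincare q (block J) * q ^+ (2 * d).
  elim: d => [|d IH] le j ej.
    rewrite muln0 mulr1 -[j](_ : ord_right s = j) ?[p _]sum_stab_right //.
    by apply: val_inj; rewrite /= ej subn0.
  have jm : (j < m.-1)%N by have := ltn_ord s; lia.
  have ejl : ord_left (Ordinal jm) = j by apply: val_inj.
  rewrite -ejl /p sum_stab_left //; last 2 first.
  - by rewrite /=; lia.
  - by apply/eqP; rewrite blk /=; lia.
  transitivity (q ^+ 2 * p (ord_right (Ordinal jm))).
    rewrite mulr_sumr; apply: eq_bigr => u /andP[st /eqP ur].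
    by rewrite ninv_adj ?mulnS ?exprD //; apply: ascent_last st ur => //=; lia.
  rewrite (IH _ (ord_right (Ordinal jm))); [|lia|rewrite /=; lia].
  by rewrite mulrCA -exprD -mulnS.
exists (s.+1 - a)%N; rewrite mulr_sumr
  -(@sum_interval _ m a s.+1 (fun d => poincare q (block J) * q ^+ (2 * d))); [|exact: ltn_ord (ord_right s)|lia].
apply: eq_big => j; rewrite blk // => /andP[aj jr]; apply: pE; first by lia.
by move: jr => /= jr; lia.
Qed.

Lemma poincare_block_neq0 J : poincare q (block J) != 0.
Proof.
suff h n : (forall k, k \in J -> (k < n)%N) -> poincare q (block J) != 0.
  by apply: (h m.-1) => k _; apply: ltn_ord.
elim: n J => [|n IH] J Jn.
  have -> : J = set0 by apply/setP=> k; rewrite inE; apply/negP => /Jn.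
  by rewrite /poincare (big_pred1 1%g) ?ninv1 ?oner_eq0 // => u; rewrite stab_block0.
have [nm|mn] := ltnP n m.-1; last first.
  by apply: IH => k _; apply: leq_trans mn; apply: ltn_ord.
case: (boolP (Ordinal nm \in J)) => nJ; last first.
  apply: IH => k kJ; rewrite ltn_neqAle -ltnS Jn // andbT.
  by apply: contraNneq nJ => e; rewrite (_ : Ordinal nm = k) //; apply: val_inj.
have Jn' k : k \in J :\ Ordinal nm -> (k < Ordinal nm)%N.
  rewrite !inE => /andP[ne /Jn]; rewrite ltnS leq_eqVlt => /orP[/eqP e|//].
  by case/eqP: ne; apply: val_inj.
have [d] := poincare_add Jn'; rewrite setD1K // => ->.
by rewrite mulf_neq0 ?geom_neq0 // IH.
Qed.

Definition level_set F : {set 'I_m.-1} := [set k | F (ord_left k) == F (ord_right k)].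

(** [F] may skip values, so it is the stabilizers and not the functions that agree; both groups are
    generated by the same adjacent transpositions. *)
Lemma stab_level F : (forall i j : 'I_m, (i <= j)%N -> (F i <= F j)%N) ->
  stab F =1 stab (block (level_set F)).
Proof.
move=> nd u; apply/idP/idP => st.
  elim/(stab_ind nd): {u}st => [|k u Fk _ _ IH]; first exact: stab1.
  by rewrite stab_adj //; apply/eqP; rewrite block_eq_step inE Fk.
elim/(stab_ind (@block_nd m (level_set F))): {u}st => [|k u Fk _ _ IH]; first exact: stab1.
by rewrite stab_adj //; move/eqP: Fk; rewrite block_eq_step inE => /eqP.
Qed.

Lemma poincare_neq0 F : (forall i j : 'I_m, (i <= j)%N -> (F i <= F j)%N) ->
  poincare q F != 0.
Proof.
move=> /stab_level st; rewrite /poincare (eq_bigl _ _ st).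
exact: poincare_block_neq0.
Qed.

End PoincareNonzero.

(** * Trace functions *)

Section TraceVanishing.
Variables (K : fieldType) (q : K) (m : nat) (B : algType K) (g : 'I_m.-1 -> B).
Hypotheses (q_neq0 : q != 0) (fam : hecke_family q g).
Hypothesis q_nroot : forall k : nat, (0 < k)%N -> q ^+ k != 1.
Local Notation T := (basis_elt g).
Implicit Types (k l : 'I_m.-1) (s u : 'S_m) (x y z : B) (J A : {set 'I_m.-1}).

(** The subalgebra H_n generated by the [g k] with k < n. Below, [split_at k] is H_k + H_k g_k
    H_k. *)
Inductive below (n : nat) : B -> Prop :=
| Below1 : below n 1
| BelowD x y : below n x -> below n y -> below n (x + y)
| BelowZ a x : below n x -> below n (a *: x)
| BelowM k x : (k < n)%N -> below n x -> below n (g k * x).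

Lemma below_full x : below m.-1 x.
Proof.
elim/(hf_ind fam): x => [|k x|x y|a x]; first exact: Below1.
- by apply: BelowM; apply: ltn_ord.
- exact: BelowD.
exact: BelowZ.
Qed.

Lemma below_gen n k : (k < n)%N -> below n (g k).
Proof. by move=> kn; rewrite -[g k]mulr1; apply: BelowM => //; apply: Below1. Qed.

Lemma belowM n x y : below n x -> below n y -> below n (x * y).
Proof.
move=> bx yn; elim: bx => [|x1 x2 _ b1 _ b2|a x1 _ b1|k x1 kn _ b1].
- by rewrite mul1r.
- by rewrite mulrDl; apply: BelowD.
- by rewrite -scalerAl; apply: BelowZ.
by rewrite -mulrA; apply: BelowM.
Qed.

Lemma below_le n p x : (n <= p)%N -> below n x -> below p x.
Proof.
move=> np; elim=> [|x1 x2 _ b1 _ b2|a x1 _ b1|k x1 kn _ b1].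
- exact: Below1.
- exact: BelowD.
- exact: BelowZ.
by apply: BelowM => //; apply: leq_trans np.
Qed.

Lemma below_comm n x k : below n x -> (n < k)%N -> g k * x = x * g k.
Proof.
move=> + nk; elim=> [|x1 x2 _ b1 _ b2|a x1 _ b1|l x1 ln _ b1].
- by rewrite mulr1 mul1r.
- by rewrite mulrDr mulrDl b1 b2.
- by rewrite -scalerAr -scalerAl b1.
rewrite mulrA (hf_comm fam) -?mulrA ?b1 ?mulrA //.
by rewrite (leq_ltn_trans ln nk) orbT.
Qed.

Inductive split_at k : B -> Prop :=
| Split0 x : below k x -> split_at k x
| Split1 x y : below k x -> below k y -> split_at k (x * g k * y)
| SplitD x y : split_at k x -> split_at k y -> split_at k (x + y).

Lemma splitZ k a x : split_at k x -> split_at k (a *: x).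
Proof.
elim=> [x1 b1|x1 y1 bx by1|x1 y1 _ h1 _ h2]; last by rewrite scalerDr; apply: SplitD.
  by apply/Split0/BelowZ.
by rewrite !scalerAl; apply: Split1 => //; apply: BelowZ.
Qed.

Lemma splitMl k z x : below k z -> split_at k x -> split_at k (z * x).
Proof.
move=> bz; elim=> [x1 b1|x1 y1 bx by1|x1 y1 _ h1 _ h2]; last by rewrite mulrDr; apply: SplitD.
  exact/Split0/belowM.
by rewrite !mulrA; apply: Split1 => //; apply: belowM.
Qed.

Lemma splitMr k z x : below k z -> split_at k x -> split_at k (x * z).
Proof.
move=> bz; elim=> [x1 b1|x1 y1 bx by1|x1 y1 _ h1 _ h2]; last by rewrite mulrDl; apply: SplitD.
  exact/Split0/belowM.
by rewrite -mulrA; apply: Split1 => //; apply: belowM.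
Qed.

(** The decomposition behind Markov traces. The only problem is g_k y g_k with y in H_k, and it is
    solved by applying the statement to y one level lower. *)
Lemma split_below n k x : k = n :> nat -> below n.+1 x -> split_at k x.
Proof.
elim: n k x => [|n IH] k x kn.
  elim=> [|x1 x2 _ b1 _ b2|a x1 _ b1|l x1 ln _ b1].
  - exact/Split0/Below1.
  - exact: SplitD.
  - exact: splitZ.
  have -> : l = k by apply: val_inj; rewrite /= kn; move: ln; case: (l : nat).
  have scal y : below 0 y -> exists c, y = c%:A.
    elim=> [|x2 x3 _ [c ->] _ [d ->]|a x2 _ [c ->]|//].
    - by exists 1; rewrite scale1r.
    - by exists (c + d); rewrite scalerDl.
    by exists (a * c); rewrite scalerA.
  elim: b1 => [y by0|y z by0 bz|y z _ hy _ hz]; last by rewrite mulrDr; apply: SplitD.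
    by rewrite -[g k]mul1r; apply: Split1 => //; apply: Below1.
  move: by0; rewrite kn => /scal[c ->]; rewrite mulr_algl -scalerAl -scalerAr mulrA.
  apply: splitZ; rewrite (hf_quad fam) mulrDl mul1r -scalerAl.
  apply: SplitD; first exact: Split0.
  by apply: splitZ; rewrite -[g k]mul1r; apply: Split1 => //; apply: Below1.
elim=> [|x1 x2 _ b1 _ b2|a x1 _ b1|l x1 ln _ b1].
- exact/Split0/Below1.
- exact: SplitD.
- exact: splitZ.
have [l_lt|l_ge] := ltnP l n.+1; first by apply: splitMl b1; apply: below_gen; rewrite kn.
have -> : l = k by apply: val_inj; apply/eqP; rewrite /= kn eqn_leq l_ge andbT.
have n_lt : (n < m.-1)%N by apply: leq_trans (ltn_ord k); rewrite kn.
pose p : 'I_m.-1 := Ordinal n_lt.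
have kp : k = p.+1 :> nat by [].
elim: b1 => [y by0|y z by0 bz|y z _ hy _ hz]; last by rewrite mulrDr; apply: SplitD.
  by rewrite -[g k]mul1r; apply: Split1 => //; apply: Below1.
have lift y' : below n y' -> below k y' by apply: below_le; rewrite kn.
rewrite !mulrA -[_ * z]/(_ z); apply: (splitMr bz).
have /(IH p) {by0} : below n.+1 y by rewrite -kn.
move/(_ erefl); elim=> [y0 b0|y0 y1 b0 b1|y0 y1 _ h0 _ h1].
- rewrite (below_comm b0) ?kn // -mulrA (hf_quad fam) mulrDr mulr1 -scalerAr.
  apply: SplitD; first exact/Split0/lift.
  by apply: splitZ; rewrite -[_ * g k]mulr1; apply: Split1; [exact: lift | exact: Below1].
(* With y0 and y1 commuting with g_k, the braid relation turns two occurrences of g_k into a single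
   one. *)
- have -> : g k * (y0 * g p * y1) * g k = (y0 * g p) * g k * (g p * y1).
    rewrite !mulrA (below_comm b0) ?kn // -(mulrA _ y1) -(below_comm b1) ?kn //.
    by rewrite -!mulrA; congr (_ * _); rewrite !mulrA (hf_braid fam kp).
  by apply: Split1; apply: belowM; (exact: lift || (apply: below_gen; rewrite kn)).
by rewrite mulrDr mulrDl; apply: SplitD.
Qed.

Definition coxeter A : B := \prod_(k <- enum A) g k.

Lemma coxeter0 : coxeter set0 = 1.
Proof. by rewrite /coxeter enum_set0 big_nil. Qed.

Lemma sorted_enum_ord p (A : {set 'I_p}) : sorted ltn (map val (enum A)).
Proof.
rewrite sorted_map /enum_mem; apply: sorted_filter; first by move=> x y z; apply: ltn_trans.
by rewrite -enumT -sorted_map val_enum_ord iota_ltn_sorted.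
Qed.

Lemma coxeter_add k A : (forall l, l \in A -> (k < l)%N) -> coxeter (k |: A) = g k * coxeter A.
Proof.
move=> kA; rewrite /coxeter; have -> : enum (k |: A) = k :: enum A; last exact: big_cons.
apply: (inj_map val_inj); apply: (irr_sorted_eq ltn_trans ltnn (sorted_enum_ord _)).
  rewrite /= path_min_sorted ?sorted_enum_ord //.
  by apply/allP=> _ /mapP[l + ->]; rewrite mem_enum => /kA.
move=> x; apply/mapP/idP => [[l]|] /=.
  rewrite mem_enum !inE => /orP[/eqP->|lA] ->; first by rewrite eqxx.
  by rewrite (map_f val) ?orbT // mem_enum.
rewrite inE => /orP[/eqP->|/mapP[l]]; first by exists k; rewrite // mem_enum !inE eqxx.
by rewrite mem_enum => lA ->; exists l; rewrite // mem_enum !inE lA orbT.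
Qed.

Lemma coxeter_comm n x A : below n x -> (forall l, l \in A -> (n < l)%N) ->
  coxeter A * x = x * coxeter A.
Proof.
move=> bx nA; rewrite /coxeter big_seq.
have : all (fun l : 'I_m.-1 => n < l)%N (enum A).
  by apply/allP=> l; rewrite mem_enum => /nA.
rewrite -big_seq; elim: (enum A) => [|l e IH] /=; first by rewrite big_nil mul1r mulr1.
by case/andP=> nl /IH e0; rewrite big_cons -mulrA e0 !mulrA (below_comm bx nl).
Qed.

Variable tr : B -> K.
Hypothesis trP : forall a x y, tr (a *: x + y) = a * tr x + tr y.
Hypothesis trC : forall x y, tr (x * y) = tr (y * x).

Let trD x y : tr (x + y) = tr x + tr y.
Proof. by rewrite -{1}[x]scale1r trP mul1r. Qed.

Let tr0 : tr 0 = 0.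
Proof. by apply: (addIr (tr 0)); rewrite -trD !add0r. Qed.

Let trZ a x : tr (a *: x) = a * tr x.
Proof. by rewrite -[a *: x]addr0 trP tr0 addr0. Qed.

(** Strengthened to x times [coxeter A] with x in H_n and A at or above n. If x = x1 g_n y1, then y1
    commutes with the Coxeter part and returns to the front by cyclicity, so g_n joins [A] and y1 x1
    lies in H_n. *)
Lemma tr_coxeter_eq0 : (forall A, tr (coxeter A) = 0) -> forall x, tr x = 0.
Proof.
move=> tr_cox.
suff h n x A : (n <= m.-1)%N -> below n x -> (forall l, l \in A -> (n <= l)%N) ->
    tr (x * coxeter A) = 0.
  move=> x; rewrite -[x]mulr1 -coxeter0; apply: (h m.-1) => //; first exact: below_full.
  by move=> l; rewrite inE.
elim: n x A => [|n IH] x A le bx nA.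
  elim: bx => [|x1 x2 _ b1 _ b2|a x1 _ b1|//]; first by rewrite mul1r.
    by rewrite mulrDl trD b1 b2 addr0.
  by rewrite -scalerAl trZ b1 mulr0.
pose k : 'I_m.-1 := Ordinal le.
have := split_below (erefl : k = n :> nat) bx.
elim=> [x1 b1|x1 y1 b1 b2|x1 y1 _ h1 _ h2].
- by apply: IH => //; [exact: ltnW | move=> l /nA /ltnW].
- rewrite -!mulrA -(coxeter_comm b2); last by move=> l /nA.
  rewrite (mulrA (g k)) -coxeter_add; last by move=> l /nA.
  rewrite mulrA trC mulrA; apply: IH; [exact: ltnW | exact: belowM |].
  by move=> l; rewrite !inE => /orP[/eqP->|/nA /ltnW].
by rewrite mulrDl trD h1 h2 addr0.
Qed.

Lemma basis_stab_below J n u : (forall k, k \in J -> (k < n)%N) ->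
  stab (block J) u -> below n (T u).
Proof.
move=> Jn; elim/(stab_ind (@block_nd m J)): {u}_ / => [|k u + asc _ IH].
  by rewrite (basis1 fam); apply: Below1.
move/eqP; rewrite block_eq_step => /Jn kn.
by rewrite -(gen_basis_up fam asc); apply: BelowM.
Qed.

Lemma symm_below J n : (forall k, k \in J -> (k < n)%N) -> below n (symm q g (block J)).
Proof.
move=> Jn; apply: (big_ind (below n)).
- by rewrite -(scale0r 1); apply/BelowZ/Below1.
- exact: BelowD.
by move=> u /(basis_stab_below Jn) bu; apply: BelowZ.
Qed.

(** Summing over the cosets of [sum_stab_last]: the coset of k + 1 gives the first term, and that of
    k - d gives q^(d+1) g_(k-d) ... g_k times [symm] of [J]. Modulo commutators the generators of
    [J] in this product are absorbed, leaving g_k alone. *)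
Lemma tr_symm_add J A k : (forall l, l \in J -> (l < k)%N) -> (forall l, l \in A -> (k < l)%N) ->
  exists n, tr (symm q g (block (k |: J)) * coxeter A) =
    tr (symm q g (block J) * coxeter A) +
    q * (\sum_(d < n.+1) q ^+ (2 * d)) * tr (symm q g (block J) * coxeter (k |: A)).
Proof.
move=> Jk Ak; have [a ak blk] := last_block Jk.
rewrite {1}/symm sum_stab_last.
pose S j := \sum_(u : 'S_m | stab (block (k |: J)) u && (u j == ord_right k)) q ^+ ninv u *: T u.
set c := coxeter A; set x := symm q g (block J).
have bx : below k x by apply: symm_below.
have SS j : (j < k.+1)%N -> (a <= j)%N -> forall jm : (j < m.-1)%N,
    S (ord_left (Ordinal jm)) = q *: (g (Ordinal jm) * S (ord_right (Ordinal jm))).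
  move=> jk aj jm; rewrite /S sum_stab_left //; last first.
    by apply/eqP; rewrite blk /= aj ltnW.
  rewrite mulr_sumr scaler_sumr; apply: eq_bigr => u /andP[st /eqP ur].
  have asc : ascent u (Ordinal jm) by apply: (ascent_last Jk _ st ur); rewrite /= -ltnS.
  by rewrite -(gen_basis_up fam asc) ninv_adj // exprS -scalerAr scalerA.
have S0 : S (ord_right k) = x by rewrite /S sum_stab_right.
(* Every coset sum is a left multiple of the symmetrizer of [J], hence absorbs a generator of [J]
   from the right at the cost of q. *)
have Sx d : (d <= k.+1 - a)%N -> forall j : 'I_m, j = (k.+1 - d)%N :> nat ->
    exists w, S j = w * x.
  elim: d => [|d IH] le j ej.
    exists 1; rewrite mul1r -S0; congr S; apply: val_inj; by rewrite /= ej subn0.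
  have jm : (j < m.-1)%N by have := ltn_ord k; lia.
  have -> : j = ord_left (Ordinal jm) by apply: val_inj.
  rewrite SS; [|lia|lia].
  have [] := IH _ (ord_right (Ordinal jm)); [lia|rewrite /=; lia|move=> w ->].
  by exists (q *: (g (Ordinal jm) * w)); rewrite -scalerAl mulrA.
(* Each further step gains q^2: one q from the length, the other from moving the new generator
   around the trace, past the Coxeter part, into the symmetrizer. *)
have trS d : (d < k.+1 - a)%N -> forall j : 'I_m, j = (k - d)%N :> nat ->
    tr (S j * c) = q * q ^+ (2 * d) * tr (x * coxeter (k |: A)).
  elim: d => [|d IH] le j ej.
    have jm : (j < m.-1)%N by have := ltn_ord k; lia.
    have -> : j = ord_left k by apply: val_inj; rewrite /= ej subn0.
    have kk : Ordinal (ltn_ord k) = k by apply: val_inj.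
    have := SS k; rewrite -[in ord_left k]kk => -> //; rewrite kk S0.
    rewrite -scalerAl trZ muln0 mulr1 coxeter_add // trC -/c; congr (_ * _).
    by rewrite trC -mulrA -(coxeter_comm bx Ak) trC -mulrA.
  have jm : (j < m.-1)%N by have := ltn_ord k; lia.
  have -> : j = ord_left (Ordinal jm) by apply: val_inj.
  rewrite SS; [|lia|lia].
  have jJ : Ordinal jm \in J.
    have : Ordinal jm \in k |: J.
      apply: (block_eq_below Jk); first by rewrite /=; lia.
      by apply/eqP; rewrite blk /=; lia.
    by rewrite !inE -(inj_eq val_inj) /=; case: eqP => //; lia.
  set y := S _; rewrite -scalerAl trZ -[in LHS]mulrA [in LHS]trC -[in LHS]mulrA.
  have -> : c * g (Ordinal jm) = g (Ordinal jm) * c.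
    by apply: (coxeter_comm (n := k)) => //; apply: below_gen; apply: Jk.
  have -> : y * (g (Ordinal jm) * c) = q *: (y * c).
    have [] := Sx d.+1 _ (ord_right (Ordinal jm)); [lia|rewrite /=; lia|].
    rewrite -/y => w ->; rewrite mulrA -(mulrA w) (symm_gen q_neq0 fam).
      by rewrite -scalerAr -scalerAl.
    by apply/eqP; rewrite block_eq_step.
  rewrite trZ IH; [|lia|rewrite /=; lia].
  by rewrite mulnS exprD; ring.
(* Apart from k + 1, the cosets are indexed by a, ..., k, which are k - a + 1 in number. *)
exists (k - a)%N; rewrite mulr_suml (big_morph _ trD tr0).
rewrite (bigD1 (ord_right k)) //= -/(S _) S0; congr (_ + _).
rewrite -mulrA mulr_suml mulr_sumr.
rewrite -(@sum_interval _ m a k (fun d => q * (q ^+ (2 * d) * tr (x * coxeter (k |: A))))) //; last first.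
  exact: (ltn_ord (ord_left k)).
apply: eq_big => j.
  by rewrite blk -(inj_eq val_inj) /=; lia.
rewrite blk -(inj_eq val_inj) /= => /andP[/andP[aj jr] ne].
by rewrite -/(S _) (trS (k - j)%N) ?mulrA //; lia.
Qed.

(** Descending induction on n, for products of a symmetrizer of [J] below n with a Coxeter element
    of [A'] at or above n. If n is in [A'], removing it yields two vanishing traces, and
    [tr_symm_add] gives the third after division by a nonzero scalar. At n = 0 the symmetrizer is
    1. *)
Theorem tr_symm_eq0 : (forall J, tr (symm q g (block J)) = 0) -> forall x, tr x = 0.
Proof.
move=> tr_symm; apply: tr_coxeter_eq0 => A.
suff h n : (n <= m.-1)%N -> forall J A', (forall l, l \in J -> (l < n)%N) ->
    (forall l, l \in A' -> (n <= l)%N) -> tr (symm q g (block J) * coxeter A') = 0.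
  have := h 0%N isT set0 A; rewrite {1}/symm (big_pred1 1%g).
    by rewrite ninv1 scale1r (basis1 fam) mul1r; apply=> // l; rewrite inE.
  by move=> u; rewrite stab_block0.
move: {2}(m.-1 - n)%N (erefl (m.-1 - n)%N) => d.
elim: d n => [|d IH] n dn le J A' Jn An.
  have -> : A' = set0; last by rewrite coxeter0 mulr1.
  by apply/setP=> l; rewrite inE; apply/negP => /An; have := ltn_ord l; lia.
have n_lt : (n < m.-1)%N by lia.
pose k : 'I_m.-1 := Ordinal n_lt.
have h := IH n.+1 _ n_lt.
have [kA|kA] := boolP (k \in A'); last first.
  apply: h => [|l /Jn /ltnW //|l lA]; first by lia.
  rewrite ltn_neqAle An // andbT; apply: contraNneq kA => e.
  by rewrite (_ : k = l) //; apply: val_inj.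
have kA' l : l \in A' :\ k -> (k < l)%N.
  rewrite !inE => /andP[ne /An]; rewrite leq_eqVlt => /orP[/eqP e|//].
  by case/eqP: ne; apply: val_inj.
have dn' : (m.-1 - n.+1)%N = d by lia.
have e1 : tr (symm q g (block (k |: J)) * coxeter (A' :\ k)) = 0.
  by apply: h => // l; rewrite !inE => /orP[/eqP-> //|/Jn /ltnW].
have e2 : tr (symm q g (block J) * coxeter (A' :\ k)) = 0.
  by apply: h => // l /Jn /ltnW.
have [p] := @tr_symm_add J _ k Jn kA'; rewrite setD1K // e1 e2 add0r.
move/esym/eqP; rewrite mulf_eq0 => /orP[|/eqP //].
by rewrite mulf_eq0 (negPf q_neq0) (negPf (geom_neq0 q_nroot _)).
Qed.

End TraceVanishing.

(** * Tableaux and the Jucys-Murphy basis *)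

Section Boxes.
Variable lam : intpart.
Local Notation m := (psize lam).
Implicit Types (b c e : box lam) (t : syt lam) (i j : 'I_m) (k : 'I_m.-1).

Lemma box_inj b c : box_row b = box_row c -> box_col b = box_col c -> b = c.
Proof.
case: b c => [[i j] ij] [[i' j'] ij']; rewrite /box_row /box_col /= => e1 e2.
by apply: val_inj; congr pair; apply: val_inj.
Qed.

Lemma nth_part_le r r' : (r <= r')%N -> (nth 0%N lam r' <= nth 0%N lam r)%N.
Proof.
move=> le; have [lt|ge] := ltnP r' (size lam); last by rewrite [leqLHS]nth_default.
case: lam lt => s /= /andP[srt _] lt.
apply: (sorted_leq_nth (leT := geq)) => //; last by rewrite inE (leq_ltn_trans le).
- by move=> x y z yx zy; apply: leq_trans zy yx.
- by move=> x /=.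
Qed.

Lemma nth_part_psize r : (nth 0%N lam r <= m)%N.
Proof.
rewrite /psize; elim: (parts lam) r => [|x s IH] [|r] //=; first exact: leq_addr.
by apply: leq_trans (IH r) (leq_addl _ _).
Qed.

Lemma ex_box r (p : nat) : (p < nth 0%N lam r)%N -> exists b, box_row b = r /\ box_col b = p.
Proof.
move=> lt; have rs : (r < size lam)%N.
  by rewrite ltnNge; apply: contraL lt => ge; rewrite nth_default.
have cm : (p < m)%N := leq_trans lt (nth_part_psize r).
by exists (Sub (Ordinal rs, Ordinal cm) lt).
Qed.

Lemma boxP b : (box_col b < nth 0%N lam (box_row b))%N.
Proof. exact: (valP b). Qed.

Lemma ex_corner b r (p : nat) : (r <= box_row b)%N -> (p <= box_col b)%N ->
  exists e, box_row e = r /\ box_col e = p.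
Proof.
move=> rb cb; apply: ex_box; apply: leq_ltn_trans cb _.
by apply: leq_trans (boxP b) (nth_part_le rb).
Qed.

Lemma card_box : #|{: box lam}| = m.
Proof.
rewrite card_sig.
transitivity (\sum_(i < size lam) \sum_(j < m | (j < nth 0%N lam i)%N) 1)%N.
  by rewrite pair_big_dep -sum1_card; apply: eq_bigl => -[i j]; rewrite !inE.
transitivity (\sum_(i < size lam) nth 0%N lam i)%N; last first.
  rewrite -(big_mkord xpredT (nth 0%N lam)) /psize.
  by rewrite -(big_nth 0%N xpredT id) sumnE.
apply: eq_bigr => i _; rewrite -(big_ord_widen m (fun=> 1%N)) ?nth_part_psize //.
by rewrite sum1_card card_ord.
Qed.

Lemma syt_inj t : injective (val t).
Proof. by case/and3P: (valP t) => /injectiveP. Qed.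

Lemma syt_row t b c : box_row b = box_row c -> (box_col b < box_col c)%N ->
  (val t b < val t c)%N.
Proof.
case/and3P: (valP t) => _ /forallP/(_ b)/forallP/(_ c)/implyP h _ e lt.
by apply: h; rewrite e eqxx.
Qed.

Lemma syt_col t b c : box_col b = box_col c -> (box_row b < box_row c)%N ->
  (val t b < val t c)%N.
Proof.
case/and3P: (valP t) => _ _ /forallP/(_ b)/forallP/(_ c)/implyP h e lt.
by apply: h; rewrite e eqxx.
Qed.

Lemma syt_le t b c : (box_row b <= box_row c)%N -> (box_col b <= box_col c)%N ->
  (val t b <= val t c)%N.
Proof.
move=> rbc cbc; have [e [re ce]] := ex_corner rbc (leqnn (box_col c)).
apply: (@leq_trans (val t e)).
  move: cbc; rewrite -ce leq_eqVlt => /orP[/eqP e1|lt].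
    by rewrite (box_inj (esym re) e1).
  by apply/ltnW/syt_row.
move: rbc; rewrite -re leq_eqVlt => /orP[/eqP e1|lt]; first by rewrite (box_inj e1 ce).
exact/ltnW/syt_col.
Qed.

Lemma syt_lt t b c : (box_row b <= box_row c)%N -> (box_col b <= box_col c)%N ->
  b != c -> (val t b < val t c)%N.
Proof.
move=> r1 c1 ne; rewrite ltn_neqAle syt_le // andbT.
by apply: contra ne => /eqP/val_inj/syt_inj->.
Qed.

Lemma syt_onto t i : i \in codom (val t).
Proof. by apply: inj_card_onto; [exact: syt_inj | rewrite card_ord card_box]. Qed.

Definition pos t i : box lam := iinv (syt_onto t i).

Lemma posK t i : val t (pos t i) = i.
Proof. exact: f_iinv. Qed.

Lemma pos_syt t b : pos t (val t b) = b.
Proof. by apply: (@syt_inj t); rewrite posK. Qed.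

Lemma pos_inj t : injective (pos t).
Proof. exact: can_inj (posK t). Qed.

Lemma pos_eq t i b : (pos t i == b) = (val t b == i).
Proof. by apply/eqP/eqP => <-; rewrite ?posK ?pos_syt. Qed.

Variant adjacent_spec b c : Prop :=
| AdjRow of box_row c = box_row b & box_col c = (box_col b).+1
| AdjCol of box_col c = box_col b & box_row c = (box_row b).+1
| AdjDown of (box_row b < box_row c)%N & (box_col c < box_col b)%N
| AdjUp of (box_row c < box_row b)%N & (box_col b < box_col c)%N.

(** In any other configuration the diagram contains a box strictly between the two, whose entry
    would lie strictly between k and k + 1, or else the order of the entries is violated. *)
Lemma adjacent_pos t k : adjacent_spec (pos t (ord_left k)) (pos t (ord_right k)).
Proof.
set b := pos _ _; set c := pos _ _.
have tb : val t b = k :> nat by rewrite /b posK.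
have tc : val t c = k.+1 :> nat by rewrite /c posK.
have no_between e : (k < val t e)%N -> (val t e < k.+1)%N -> False by lia.
have bc : b != c by apply/eqP => e; move: tc; rewrite -e tb => /eqP; rewrite ltn_eqF.
case: (ltngtP (box_row b) (box_row c)) => rbc; last 1 first.
- case: (ltngtP (box_col b) (box_col c)) => cbc; last by rewrite (box_inj rbc cbc) eqxx in bc.
    apply: AdjRow => //; apply/eqP; rewrite eqn_leq cbc andbT leqNgt; apply/negP => gap.
    have [e [re ce]] := ex_corner (leqnn _) (ltnW gap).
    apply: (no_between e); first by rewrite -tb syt_row // ?re -?rbc // ce.
    by rewrite -tc syt_row // ce.
  by have := syt_row t (esym rbc) cbc; rewrite tb tc ltnNge leqnSn.
- case: (ltngtP (box_col b) (box_col c)) => cbc; last 1 first.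
  + apply: AdjCol => //; apply/eqP; rewrite eqn_leq rbc andbT leqNgt; apply/negP => gap.
    have [e [re ce]] := ex_corner (ltnW gap) (leqnn _).
    apply: (no_between e); first by rewrite -tb syt_col // ?ce // re.
    by rewrite -tc syt_col // re.
  + have [e [re ce]] := ex_corner (ltnW rbc) (leqnn (box_col c)).
    case: (no_between e); first by rewrite -tb syt_row // ce.
    by rewrite -tc syt_col // re.
  by apply: AdjDown.
case: (leqP (box_col c) (box_col b)) => cbc; last by apply: AdjUp.
have := syt_lt t (ltnW rbc) cbc; rewrite eq_sym => /(_ bc).
by rewrite tb tc ltnNge leqnSn.
Qed.

Lemma diagonal_le b c : content b = content c ->
  ((box_row b <= box_row c) && (box_col b <= box_col c))%N ||
  ((box_row c <= box_row b) && (box_col c <= box_col b))%N.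
Proof. by rewrite /content; lia. Qed.

(** Boxes of equal content are comparable. Were i in different boxes, the smaller of them would hold
    in the other tableau some j < i; by induction both tableaux have j in the same box, so j = i. *)
Lemma same_content_below t t' n :
  (forall i, (i < n)%N -> content (pos t i) = content (pos t' i)) ->
  forall i, (i < n)%N -> pos t i = pos t' i.
Proof.
move=> cont i; move: {2}i.+1 (ltnSn i) => d; elim: d i => // d IH i.
rewrite ltnS => le_d lt_n; have [//|ne] := eqVneq (pos t i) (pos t' i); exfalso.
have lower j : (j < i)%N -> pos t j = pos t' j.
  by move=> ji; apply: IH; [exact: leq_trans le_d | exact: ltn_trans lt_n].
case/orP: (diagonal_le (cont i lt_n)) => /andP[rl cl].
  have := syt_lt t' rl cl ne; rewrite posK => ji.
  have := lower _ ji; rewrite pos_syt => e; move: ji; rewrite -{2}(posK t i) -{2}e posK.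
  by rewrite ltnn.
have := syt_lt t rl cl; rewrite eq_sym => /(_ ne); rewrite posK => ji.
have := lower _ ji; rewrite pos_syt => e; move: ji; rewrite -{2}(posK t' i) {2}e posK.
by rewrite ltnn.
Qed.

Lemma same_content_above t t' n :
  (forall i, (n < i)%N -> content (pos t i) = content (pos t' i)) ->
  forall i, (n < i)%N -> pos t i = pos t' i.
Proof.
move=> cont i; move: {2}(m - i)%N.+1 (ltnSn (m - i)) => d; elim: d i => // d IH i.
rewrite ltnS => le_d lt_n; have [//|ne] := eqVneq (pos t i) (pos t' i); exfalso.
have upper j : (i < j)%N -> pos t j = pos t' j.
  move=> ij; apply: IH; last exact: ltn_trans ij.
  by apply: leq_trans le_d; apply: ltn_sub2l => //; apply: ltn_ord.
case/orP: (diagonal_le (cont i lt_n)) => /andP[rl cl].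
  have := syt_lt t rl cl ne; rewrite posK => ij.
  have := upper _ ij; rewrite pos_syt => e; move: ij; rewrite -{1}(posK t' i) {1}e posK.
  by rewrite ltnn.
have := syt_lt t' rl cl; rewrite eq_sym => /(_ ne); rewrite posK => ij.
have := upper _ ij; rewrite pos_syt => e; move: ij; rewrite -{1}(posK t i) -{1}e posK.
by rewrite ltnn.
Qed.

Definition swap k t : {ffun box lam -> 'I_m} := [ffun b => adj_tperm k (val t b)].

(** The two previous lemmas place all entries other than k and k + 1, and two boxes remain for
    these. *)
Lemma same_content t t' k :
  (forall i, i != ord_left k -> i != ord_right k ->
     content (pos t i) = content (pos t' i)) ->
  val t' = val t \/ val t' = swap k t.
Proof.
move=> cont.
have same i : i != ord_left k -> i != ord_right k -> pos t i = pos t' i.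
  move=> il ir; case: (ltngtP i k) => ik; last by case/eqP: il; apply: val_inj.
    apply: (same_content_below (n := k)) => // j jk; apply: cont;
      rewrite -(inj_eq val_inj) neq_ltn ?jk //=.
    by rewrite ltnW // ltnS ltnW.
  have ik' : (k.+1 < i)%N.
    by rewrite ltn_neqAle ik andbT; apply: contraNneq ir => e; apply/eqP/val_inj.
  apply: (same_content_above (n := k.+1)) => // j jk; apply: cont;
      rewrite -(inj_eq val_inj) neq_ltn ?jk ?orbT //=.
  by rewrite (ltnW jk) orbT.
have far b : val t b != ord_left k -> val t b != ord_right k -> val t' b = val t b.
  by move=> l r; rewrite -{1}(pos_syt t b) same // posK.
have near b : (val t b == ord_left k) || (val t b == ord_right k) ->
    (val t' b == ord_left k) || (val t' b == ord_right k).
  apply: contraLR; rewrite !negb_or => /andP[l r].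
  by have := same _ l r; rewrite pos_syt => <-; rewrite posK l r.
have lr := left_neq_right k.
have rl : pos t (ord_left k) != pos t (ord_right k) by rewrite (inj_eq (@pos_inj t)).
have := near (pos t (ord_left k)); rewrite posK eqxx => /(_ isT) /orP[] /eqP tl.
  left; apply/ffunP=> b; case: (eqVneq (val t b) (ord_left k)) => [e|nl].
    by rewrite e -tl; congr (val t' _); rewrite -e pos_syt.
  case: (eqVneq (val t b) (ord_right k)) => [e|nr]; last exact: far.
  have := near b; rewrite e eqxx orbT => /(_ isT) /orP[] /eqP // tb.
  by case/eqP: nl; rewrite -(posK t (ord_left k)); congr (val t _); apply: (@syt_inj t'); rewrite tb tl.
right; apply/ffunP=> b; rewrite ffunE; case: (eqVneq (val t b) (ord_left k)) => [e|nl].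
  by rewrite e adj_left -tl; congr (val t' _); rewrite -e pos_syt.
case: (eqVneq (val t b) (ord_right k)) => [e|nr].
  rewrite e adj_right; have := near b; rewrite e eqxx orbT => /(_ isT) /orP[] /eqP // tb.
  by case/eqP: nl; rewrite -(posK t (ord_left k)); congr (val t _); apply: (@syt_inj t'); rewrite tb tl.
by rewrite far // /adj_tperm tpermD // eq_sym.
Qed.

End Boxes.

Section JucysMurphy.
Variables (K : fieldType) (q : K) (m : nat) (B : algType K) (g : 'I_m.-1 -> B).
Hypothesis fam : hecke_family q g.
Local Notation T := (basis_elt g).
Implicit Types (k : 'I_m.-1) (u : 'S_m) (i j l : 'I_m).

Definition jm l : B := 1 + (q - q^-1) *: \sum_(i < m | (i < l)%N) T (tperm i l).

Lemma conj_tperm_adj k i j :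
  (adj_tperm k * tperm i j * adj_tperm k)%g = tperm (adj_tperm k i) (adj_tperm k j).
Proof. by rewrite -tpermJ conjgE tpermV mulgA. Qed.

Lemma gen_basis_comm k u : u (ord_left k) = ord_left k -> u (ord_right k) = ord_right k ->
  g k * T u = T u * g k.
Proof.
move=> ul ur; have uV x : u x = x -> u^-1%g x = x by move=> e; rewrite -{1}e permK.
rewrite (gen_basis_up fam); last by rewrite /ascent ul ur /=.
rewrite (basis_gen_up fam); last by rewrite /ascent !uV.
by congr T; apply: (mulgI (u^-1)%g); rewrite mulKg -conjgE tpermJ ul ur.
Qed.

Lemma gen_basis_gen k u : ascent u k -> ascent (adj_tperm k * u)^-1%g k ->
  g k * T u * g k = T (adj_tperm k * u * adj_tperm k)%g.
Proof. by move=> a1 a2; rewrite (gen_basis_up fam) // (basis_gen_up fam). Qed.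

(** Lengths add up in T_(i,k+1) = g_k T_(i,k) g_k for i < k, and the quadratic relation for g_k 1
    g_k supplies the missing summand T_(k,k+1). *)
Lemma jm_step k : jm (ord_right k) = g k * jm (ord_left k) * g k.
Proof.
rewrite /jm mulrDr mulrDl mulr1 (hf_quad fam) -scalerAr -scalerAl -addrA -scalerDr.
congr (1 + _ *: _); rewrite (bigD1 (ord_left k)) //=; congr (_ + _).
  by rewrite (gen_basis fam).
rewrite mulr_sumr mulr_suml; apply: eq_big => [i|i /andP[ik ne]].
  by rewrite ltnS leq_eqVlt -(inj_eq val_inj) /=; case: ltngtP.
have lt : (i < k)%N by rewrite ltn_neqAle -ltnS ik andbT; apply: contra ne => /eqP e; apply/eqP/val_inj.
have ai : adj_tperm k i = i by apply: adj_tpermD; rewrite lt.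
have tr : tperm i (ord_left k) (ord_right k) = ord_right k.
  by rewrite tpermD // -(inj_eq val_inj) /= neq_ltn ?ltnSn ?orbT // ltnW.
rewrite gen_basis_gen ?conj_tperm_adj ?ai ?adj_left //.
  by rewrite /ascent tpermR tr /= ltnW.
by rewrite invMg !tpermV /ascent !permM tpermR tr ai adj_right.
Qed.

(** For l > k + 1 the summands i = k and i = k + 1 commute with g_k only together, by
    [gen_pair_comm]; all others commute one by one. *)
Lemma jm_comm k l : l != ord_left k -> l != ord_right k -> g k * jm l = jm l * g k.
Proof.
move=> nl nr; rewrite /jm mulrDr mulrDl mulr1 mul1r -scalerAr -scalerAl.
congr (_ + _ *: _).
have far i : i != ord_left k -> i != ord_right k ->
    g k * T (tperm i l) = T (tperm i l) * g k.
  by move=> il ir; apply: gen_basis_comm; rewrite tpermD.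
case: (ltngtP l k) => lk; last by case/eqP: nl; apply: val_inj.
  rewrite mulr_sumr mulr_suml; apply: eq_bigr => i il; apply: far;
    rewrite -(inj_eq val_inj) neq_ltn /=.
    by rewrite (ltn_trans il).
  by rewrite ltnS ltnW // (ltn_trans il).
have kl : (k.+1 < l)%N.
  by rewrite ltn_neqAle lk andbT; apply: contraNneq nr => e; apply/eqP/val_inj.
rewrite (bigD1 (ord_left k)) //= (bigD1 (ord_right k)) /=; last first.
  by rewrite kl -(inj_eq val_inj) /= neq_ltn ltnSn orbT.
set A := T (tperm (ord_right k) l).
have -> : T (tperm (ord_left k) l) = g k * A * g k.
  have al : adj_tperm k l = l by apply: adj_tpermD; rewrite kl orbT.
  have tl : tperm (ord_right k) l (ord_left k) = ord_left k.
    by rewrite tpermD // -(inj_eq val_inj) /= neq_ltn ?ltnSn ?lk ?orbT.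
  rewrite gen_basis_gen ?conj_tperm_adj ?al ?adj_right //.
    by rewrite /ascent tpermL tl.
  by rewrite invMg !tpermV /ascent !permM tpermL tl al adj_left.
rewrite addrA mulrDr [RHS]mulrDl [_ + A]addrC (gen_pair_comm fam); congr (_ + _).
rewrite mulr_sumr mulr_suml; apply: eq_bigr => i /andP[/andP[_ il] ir].
exact: far.
Qed.

End JucysMurphy.

Section Swap.
Variable lam : intpart.
Local Notation m := (psize lam).
Implicit Types (t : syt lam) (k : 'I_m.-1).

Definition swappable t k :=
  (box_row (pos t (ord_left k)) != box_row (pos t (ord_right k))) &&
  (box_col (pos t (ord_left k)) != box_col (pos t (ord_right k))).

Lemma swap_syt t k : swappable t k -> is_syt (swap k t).
Proof.
case/andP=> nr nc; apply/and3P; split.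
- by apply/injectiveP=> b c; rewrite !ffunE => /perm_inj/syt_inj.
- apply/forallP=> b; apply/forallP=> c; apply/implyP=> /andP[/eqP r cl].
  rewrite !ffunE; have lt := syt_row t r cl.
  have : ~~ ((val t b == ord_left k) && (val t c == ord_right k)).
    by rewrite -!pos_eq; apply/andP=> -[/eqP e1 /eqP e2]; rewrite e1 e2 r eqxx in nr.
  rewrite -!(inj_eq val_inj) /= !adj_tpermE; move: (val t b) (val t c) lt => x y.
  by repeat (case_nat_if; rewrite //=); lia.
apply/forallP=> b; apply/forallP=> c; apply/implyP=> /andP[/eqP r cl].
rewrite !ffunE; have lt := syt_col t r cl.
have : ~~ ((val t b == ord_left k) && (val t c == ord_right k)).
  by rewrite -!pos_eq; apply/andP=> -[/eqP e1 /eqP e2]; rewrite e1 e2 r eqxx in nc.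
rewrite -!(inj_eq val_inj) /= !adj_tpermE; move: (val t b) (val t c) lt => x y.
by repeat (case_nat_if; rewrite //=); lia.
Qed.

(** [insubd] returns [t] itself when the exchange does not give a standard tableau; only swappable
    pairs matter. *)
Definition sw k t : syt lam := insubd t (swap k t).

Lemma val_sw t k : swappable t k -> val (sw k t) = swap k t.
Proof. by move=> /swap_syt st; rewrite /sw insubdK. Qed.

Lemma pos_sw t k i : swappable t k -> pos (sw k t) i = pos t (adj_tperm k i).
Proof.
move=> st; apply: (@syt_inj _ (sw k t)); rewrite posK val_sw // ffunE posK.
by rewrite -permM adj_tpermK perm1.
Qed.

Lemma swappable_sw t k : swappable t k -> swappable (sw k t) k.
Proof.
move=> st; rewrite /swappable !pos_sw // adj_left adj_right.
by rewrite [box_row _ == _]eq_sym [box_col _ == _]eq_sym.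
Qed.

Lemma swK t k : swappable t k -> sw k (sw k t) = t.
Proof.
move=> st; apply: val_inj; rewrite val_sw ?swappable_sw //.
by apply/ffunP=> b; rewrite ffunE val_sw // ffunE -permM adj_tpermK perm1.
Qed.

Lemma sw_neq t k : swappable t k -> sw k t != t.
Proof.
move=> st; apply/eqP => e; have := val_sw st; rewrite e.
move=> /ffunP/(_ (pos t (ord_left k))); rewrite ffunE posK adj_left => /eqP.
exact/negP/left_neq_right.
Qed.

Variant swap_spec t k : bool -> Prop :=
| SwapRow of box_row (pos t (ord_left k)) = box_row (pos t (ord_right k))
   & content (pos t (ord_right k)) = content (pos t (ord_left k)) + 1
    : swap_spec t k false
| SwapCol of box_col (pos t (ord_left k)) = box_col (pos t (ord_right k))
   & box_row (pos t (ord_right k)) = (box_row (pos t (ord_left k))).+1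
   & content (pos t (ord_left k)) = content (pos t (ord_right k)) + 1
    : swap_spec t k false
| SwapFar of content (pos t (ord_left k)) != content (pos t (ord_right k))
   & content (pos t (ord_right k)) != content (pos t (ord_left k)) + 1
   & content (pos t (ord_left k)) != content (pos t (ord_right k)) + 1
    : swap_spec t k true.

Lemma swapP t k : swap_spec t k (swappable t k).
Proof.
rewrite /swappable; case: (adjacent_pos t k) => e1 e2.
- by rewrite e1 eqxx; apply: SwapRow; rewrite // /content e1 e2; lia.
- by rewrite e1 eqxx andbF; apply: SwapCol; rewrite // /content e1 e2; lia.
- rewrite (ltn_eqF e1) eq_sym (ltn_eqF e2).
  by apply: SwapFar; rewrite /content; apply/eqP; lia.
rewrite eq_sym (ltn_eqF e1) (ltn_eqF e2).
by apply: SwapFar; rewrite /content; apply/eqP; lia.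
Qed.

End Swap.

Section RootOfUnity.
Variables (K : fieldType) (q : K).
Hypotheses (q_neq0 : q != 0) (q_nroot : forall k : nat, (0 < k)%N -> q ^+ k != 1).

Lemma exprz_eq1 (z : int) : q ^ z = 1 -> z = 0.
Proof.
case: z => [[|n] //|n] => [/eqP|].
  by rewrite (negPf (q_nroot _)).
move=> /eqP; rewrite -[_ ^ _]/((q ^+ n.+1)^-1) invr_eq1 (negPf (q_nroot _)) //.
Qed.

Lemma exprz_inj (z z' : int) : q ^ z = q ^ z' -> z = z'.
Proof.
move=> e; apply/eqP; rewrite -subr_eq0; apply/eqP/exprz_eq1.
by rewrite expfzDr // e -expfzDr // subrr.
Qed.

Lemma exprz2_inj (z z' : int) : q ^ (2 * z) = q ^ (2 * z') -> z = z'.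
Proof. by move/exprz_inj => e; apply: (mulfI (_ : 2 != 0 :> int)). Qed.

End RootOfUnity.

(** Replaces the vector space interface by plain coordinate functions. In the proof [A] has the
    basis vectors as columns and [C] the coordinates as rows, so that A C = 1 and the trace can be
    rotated. *)
Lemma basis_coordinates (K : fieldType) (d : nat) (I : finType) (v : I -> 'cV[K]_d) :
  basis_of fullv (codom v) -> exists cf : I -> 'cV[K]_d -> K,
  [/\ forall i a x y, cf i (a *: x + y) = a * cf i x + cf i y,
      forall i j, cf i (v j) = (i == j)%:R,
      forall x, x = \sum_i cf i x *: v i &
      forall M : 'M[K]_d, \tr M = \sum_i cf i (M *m v i)].
Proof.
move=> bv; pose X := [tuple of codom v].
have bX : basis_of fullv X by rewrite /= in bv *.
have fX := basis_free bX.
pose cf i x := coord X (enum_rank i) x.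
have Xi i : X`_(enum_rank i) = v i.
  by rewrite (nth_map i) -?cardE ?ltn_ord // -[in RHS](enum_rankK i) (enum_val_nth i).
have cfv i j : cf i (v j) = (i == j)%:R.
  by rewrite /cf -Xi coord_free // (inj_eq enum_rank_inj) eq_sym.
have cfE x : x = \sum_i cf i x *: v i.
  rewrite [LHS](coord_basis bX (memvf x)) (reindex (@enum_rank I)) /=.
    by apply: eq_bigr => i _; rewrite Xi.
  by exists enum_val => i _; rewrite ?enum_rankK ?enum_valK.
exists cf; split=> // [i a x y|M]; first by rewrite /cf linearP.
pose A := \matrix_(a, i) v (enum_val i) a 0 : 'M[K]_(d, #|I|).
pose C := \matrix_(i, a) cf (enum_val i) (delta_mx a 0) : 'M[K]_(#|I|, d).
have AC : A *m C = 1%:M.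
  apply/matrixP=> a b; rewrite !mxE.
  transitivity ((delta_mx b 0 : 'cV[K]_d) a 0); last by rewrite mxE andbT.
  rewrite [in RHS](cfE (delta_mx b 0)) summxE (reindex (@enum_rank I)) /=.
    by apply: eq_bigr => i _; rewrite !mxE enum_rankK mulrC.
  by exists enum_val => i _; rewrite ?enum_rankK ?enum_valK.
rewrite -[M in LHS]mulmx1 -AC mulmxA mxtrace_mulC mulmxA /mxtrace.
rewrite (reindex (@enum_rank I)) /=; last first.
  by exists enum_val => i _; rewrite ?enum_rankK ?enum_valK.
apply: eq_bigr => i _; rewrite -mulmxA mxE.
have -> : M *m v i = \sum_a (M *m v i) a 0 *: delta_mx a 0.
  apply/matrixP=> a b; rewrite ord1 summxE (bigD1 a) //= [in RHS]mxE [delta_mx _ _ _ _]mxE.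
  rewrite !eqxx mulr1 big1 ?addr0 // => c /negPf ne.
  by rewrite mxE [delta_mx _ _ _ _]mxE eq_sym ne mulr0.
rewrite /cf linear_sum; apply: eq_bigr => a _; rewrite linearZ !mxE enum_rankK mulrC /=.
by congr (_ * _); apply: eq_bigr => b _; rewrite !mxE enum_rankK.
Qed.

(** * The generators in the Jucys-Murphy eigenbasis *)

Section Calibrated.
Variables (K : fieldType) (q : K) (lam : intpart).
Local Notation m := (psize lam).
Variables (B : algType K) (g : 'I_m.-1 -> B).
Hypotheses (q_neq0 : q != 0) (fam : hecke_family q g).
Hypothesis q_nroot : forall k : nat, (0 < k)%N -> q ^+ k != 1.
Variables (d : nat) (act : B -> 'M[K]_d).
Hypotheses (act1 : act 1 = 1%:M) (actM : forall x y, act (x * y) = act x *m act y)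
  (actP : forall a x y, act (a *: x + y) = a *: act x + act y).
Variables (v : syt lam -> 'cV[K]_d) (cf : syt lam -> 'cV[K]_d -> K).
Hypotheses (cfP : forall t a x y, cf t (a *: x + y) = a * cf t x + cf t y)
  (cfv : forall t t', cf t (v t') = (t == t')%:R)
  (cfE : forall x, x = \sum_t cf t x *: v t).
Hypothesis jm_v : forall t l,
  act (jm q g l) *m v t = q ^ (2 * content (pos t l)) *: v t.

Local Notation T := (basis_elt g).
Implicit Types (t : syt lam) (k : 'I_m.-1) (w : 'cV[K]_d) (l : 'I_m) (s u : 'S_m).

Let cfD t x y : cf t (x + y) = cf t x + cf t y.
Proof. by rewrite -{1}[x]scale1r cfP mul1r. Qed.

Let cf0 t : cf t 0 = 0.
Proof. by apply: (addIr (cf t 0)); rewrite -cfD !add0r. Qed.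

Let cfZ t a x : cf t (a *: x) = a * cf t x.
Proof. by rewrite -[a *: x]addr0 cfP cf0 addr0. Qed.

Let cf_sum t (I : Type) (r : seq I) (P : pred I) (F : I -> 'cV[K]_d) :
  cf t (\sum_(i <- r | P i) F i) = \sum_(i <- r | P i) cf t (F i).
Proof. exact: (big_morph _ (cfD t) (cf0 t)). Qed.

Let cf_ext x y : (forall t, cf t x = cf t y) -> x = y.
Proof. by move=> e; rewrite (cfE x) (cfE y); apply: eq_bigr => t _; rewrite e. Qed.

Let actD x y : act (x + y) = act x + act y.
Proof. by rewrite -[x]scale1r actP !scale1r. Qed.

Let act0 : act 0 = 0.
Proof. by apply: (addIr (act 0)); rewrite -actD !add0r. Qed.

Let actZ a x : act (a *: x) = a *: act x.
Proof. by rewrite -[a *: x]addr0 actP act0 addr0. Qed.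

Definition weight (b : box lam) : K := q ^ (2 * content b).

Lemma weight_inj b c : weight b = weight c -> content b = content c.
Proof. exact: exprz2_inj. Qed.

Lemma weight_neq0 b : weight b != 0.
Proof. exact: expfz_neq0. Qed.

Lemma weight_succ b c : (weight c == q ^+ 2 * weight b) = (content c == content b + 1).
Proof.
have -> : q ^+ 2 * weight b = q ^ (2 * (content b + 1)).
  by rewrite mulrDr mulr1 expfzDr // mulrC.
by rewrite /weight; apply/eqP/eqP => [/(exprz2_inj q_neq0 q_nroot)|->].
Qed.

Lemma cf_jm t l w : cf t (act (jm q g l) *m w) = weight (pos t l) * cf t w.
Proof.
rewrite {1}(cfE w) mulmx_sumr cf_sum (bigD1 t) //= -scalemxAr jm_v !cfZ cfv eqxx mulr1.
rewrite big1 ?addr0 => [|t' /negPf ne]; first by rewrite mulrC.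
by rewrite -scalemxAr jm_v !cfZ cfv eq_sym ne !mulr0.
Qed.

Local Notation G k w := (act (g k) *m w).

(** g_k commutes with all Jucys-Murphy elements other than those of k and k + 1, hence preserves
    their joint eigenspaces, and distinct contents have distinct eigenvalues. *)
Lemma gen_support k t t' : cf t' (G k (v t)) != 0 -> val t' = val t \/ val t' = swap k t.
Proof.
move=> nz; apply: same_content => i nl nr; apply: weight_inj; apply: (mulIf nz).
by rewrite -cf_jm mulmxA -actM -(jm_comm fam) // actM -mulmxA jm_v -scalemxAr cfZ.
Qed.

Lemma swap_not_syt k t t' : val t' = swap k t -> swappable t k.
Proof.
move=> e; case: (swapP t k) => // [r|c r] cont.
  have lt : (box_col (pos t (ord_left k)) < box_col (pos t (ord_right k)))%N.
    by move: cont; rewrite /content r; lia.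
  have := syt_row t' r lt; rewrite e !ffunE !posK adj_left adj_right /=.
  by rewrite ltnNge leqnSn.
have lt : (box_row (pos t (ord_left k)) < box_row (pos t (ord_right k)))%N by rewrite r.
by have := syt_col t' c lt; rewrite e !ffunE !posK adj_left adj_right /= ltnNge leqnSn.
Qed.

Definition diag k t := cf t (G k (v t)).
Definition offdiag k t := cf (sw k t) (G k (v t)).

Lemma cf_gen_same k t w : ~~ swappable t k -> cf t (G k w) = diag k t * cf t w.
Proof.
move=> ns; rewrite {1}(cfE w) mulmx_sumr cf_sum (bigD1 t) //= -scalemxAr cfZ mulrC.
rewrite big1 ?addr0 // => t' ne; rewrite -scalemxAr cfZ.
have [->|/gen_support[e|e]] := eqVneq (cf t (G k (v t'))) 0; first by rewrite mulr0.
  by rewrite (val_inj e) eqxx in ne.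
case/negP: ns; apply: (@swap_not_syt k t t').
by apply/ffunP=> b; rewrite ffunE e ffunE -permM adj_tpermK perm1.
Qed.

Lemma cf_gen_far k t w : swappable t k ->
  cf t (G k w) = diag k t * cf t w + offdiag k (sw k t) * cf (sw k t) w.
Proof.
move=> st; rewrite {1}(cfE w) mulmx_sumr cf_sum (bigD1 t) //= -scalemxAr cfZ mulrC.
rewrite (bigD1 (sw k t)) ?sw_neq //= -scalemxAr cfZ /offdiag swK // mulrC.
rewrite [cf (sw k t) w * _]mulrC big1 ?addr0 // => t' /andP[ne ne'].
rewrite -scalemxAr cfZ.
have [->|/gen_support[e|e]] := eqVneq (cf t (G k (v t'))) 0; first by rewrite mulr0.
  by rewrite (val_inj e) eqxx in ne.
case/eqP: ne'; apply: val_inj; rewrite val_sw //.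
by apply/ffunP=> b; rewrite ffunE e ffunE -permM adj_tpermK perm1.
Qed.

Local Notation wl k t := (weight (pos t (ord_left k))).
Local Notation wr k t := (weight (pos t (ord_right k))).

(** The coefficient of v_t in the relation g_k J_(k+1) = J_k g_k + (q - q^-1) J_(k+1) applied to
    v_t. *)
Lemma diagE k t : diag k t * (wr k t - wl k t) = (q - q^-1) * wr k t.
Proof.
have e : g k * jm q g (ord_right k) =
    jm q g (ord_left k) * g k + (q - q^-1) *: jm q g (ord_right k).
  rewrite (jm_step fam) !mulrA (hf_quad fam) mulrDl mul1r mulrDl.
  by rewrite -!scalerAl.
have := congr1 (fun x => cf t (act x *m v t)) e; rewrite /= actD actZ !actM mulmxDl cfD.
rewrite -!mulmxA -scalemxAl !cfZ !cf_jm jm_v -scalemxAr cfZ cfv eqxx mulr1.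
rewrite -/(weight _) -/(diag k t) => e'.
by rewrite mulrBr [diag k t * _]mulrC e' [diag k t * _]mulrC addrC addKr.
Qed.

Let wl_neq0 k t : wl k t != 0. Proof. exact: weight_neq0. Qed.

Let q2_neq1 : q ^+ 2 - 1 != 0.
Proof. by rewrite subr_eq0 q_nroot. Qed.

Lemma cf_gen_row k t w : box_row (pos t (ord_left k)) = box_row (pos t (ord_right k)) ->
  cf t (G k w) = q * cf t w.
Proof.
move=> r; have ns : ~~ swappable t k by rewrite /swappable r eqxx.
rewrite cf_gen_same //; congr (_ * _); have := diagE k t.
have -> : wr k t = q ^+ 2 * wl k t.
  apply/eqP; rewrite weight_succ; move: ns; case: swapP => // [_ -> //|c rr _ _].
  by move: rr; rewrite r; lia.
move=> e; apply: (mulIf (wl_neq0 k t)); apply: (mulIf q2_neq1).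
transitivity (diag k t * (q ^+ 2 * wl k t - wl k t)); first by ring.
by rewrite e; field.
Qed.

Lemma cf_gen_col k t w : box_col (pos t (ord_left k)) = box_col (pos t (ord_right k)) ->
  cf t (G k w) = - q^-1 * cf t w.
Proof.
move=> c; have ns : ~~ swappable t k by rewrite /swappable c eqxx andbF.
rewrite cf_gen_same //; congr (_ * _); have := diagE k t.
have -> : wl k t = q ^+ 2 * wr k t.
  apply/eqP; rewrite weight_succ; move: ns; case: swapP => // [r cc _|_ _ -> //].
  by move: cc; rewrite /content r c; lia.
move=> e; apply: (mulIf (weight_neq0 (pos t (ord_right k)))); apply: (mulIf q2_neq1).
transitivity (- (diag k t * (wr k t - q ^+ 2 * wr k t))); first by ring.
by rewrite e; field.
Qed.

(** The value of [diag k t] + q^-1 when [b] and [c] hold k and k + 1. Written in terms of boxes so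
    that it can be multiplied over inversions. *)
Definition theta b c : K := (q * weight c - q^-1 * weight b) / (weight c - weight b).

Lemma weight_neq k t : swappable t k -> wr k t - wl k t != 0.
Proof.
case: swapP => // ne _ _ _; rewrite subr_eq0; apply: contra ne => /eqP/weight_inj->.
exact: eqxx.
Qed.

Lemma diag_theta k t : swappable t k ->
  diag k t + q^-1 = theta (pos t (ord_left k)) (pos t (ord_right k)).
Proof.
move=> /weight_neq ne; apply: (mulIf ne); rewrite mulrDl diagE /theta mulfVK //.
by ring.
Qed.

Lemma diag_sw k t : swappable t k -> q - diag k t = diag k (sw k t) + q^-1.
Proof.
move=> st; have ne := weight_neq st; apply: (mulIf ne).
have := diagE k (sw k t); rewrite !pos_sw // adj_left adj_right => e.
transitivity (q * (wr k t - wl k t) - diag k t * (wr k t - wl k t)); first by ring.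
rewrite diagE.
transitivity (- (diag k (sw k t) * (wl k t - wr k t)) + q^-1 * (wr k t - wl k t)); last by ring.
by rewrite e; ring.
Qed.

(** The eigenvectors are fixed only up to scalars, so only this product of opposite entries is
    determined; it is the diagonal entry of the quadratic relation. *)
Lemma offdiag_sw k t : swappable t k ->
  offdiag k (sw k t) * offdiag k t = (q - diag k t) * (diag k t + q^-1).
Proof.
move=> st; have := cf_gen_far (G k (v t)) st.
rewrite mulmxA -actM (hf_quad fam) actD act1 actZ mulmxDl mul1mx -scalemxAl cfD cfZ.
rewrite cfv eqxx -/(diag k t) -/(offdiag k t) /= => e.
by rewrite -[LHS](addKr (diag k t * diag k t)) -e; field.
Qed.

Lemma theta_neq0 k t : swappable t k -> diag k t + q^-1 != 0.
Proof.
move=> st; apply/negP => /eqP z; have := diagE k t.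
have -> : diag k t = - q^-1 by apply/eqP; rewrite -addr_eq0 z.
move=> e; have : wl k t == q ^+ 2 * wr k t; first apply/eqP.
  have -> : wl k t = q * (- q^-1 * (wr k t - wl k t)) + wr k t by field.
  by rewrite e; field.
by rewrite weight_succ; case: swapP st => // _ _ /negPf->.
Qed.

Lemma offdiag_neq0 k t : swappable t k -> offdiag k t != 0.
Proof.
move=> st; have : offdiag k (sw k t) * offdiag k t != 0.
  by rewrite offdiag_sw // mulf_neq0 ?theta_neq0 // diag_sw // theta_neq0 ?swappable_sw.
by rewrite mulf_eq0 negb_or => /andP[].
Qed.

(** * Invariants of a parabolic subalgebra within one label class *)

Section Connected.
Variable t0 : syt lam.

Fact relabel_inj t : injective (fun i => val t0 (pos t i)).
Proof. by move=> i j /syt_inj/pos_inj. Qed.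

(** The permutation carrying the entries of [t] to those of [t0] box by box; its length measures the
    distance from [t0]. *)
Definition relabel t : 'S_m := perm (@relabel_inj t).

Lemma relabelE t i : relabel t i = val t0 (pos t i).
Proof. by rewrite permE. Qed.

Lemma relabel0 : relabel t0 = 1%g.
Proof. by apply/permP=> i; rewrite relabelE perm1 posK. Qed.

Lemma relabel_eq1 t : relabel t = 1%g -> t = t0.
Proof.
move=> e; apply: val_inj; apply/ffunP=> b.
by have := relabelE t (val t b); rewrite e perm1 pos_syt.
Qed.

Lemma relabel_sw k t : swappable t k -> relabel (sw k t) = (adj_tperm k * relabel t)%g.
Proof. by move=> st; apply/permP=> i; rewrite permM !relabelE pos_sw. Qed.

(** A generator changes a tableau by at most one exchange, so a product of l generators reaches only
    tableaux at distance at most l. *)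
Lemma act_basis_support s t : cf t (act (T s) *m v t0) != 0 -> (ninv (relabel t) <= ninv s)%N.
Proof.
elim/perm_ind_up: s t => [|k s asc IH] t.
  rewrite (basis1 fam) act1 mul1mx cfv; case: (t =P t0) => [->|_]; last by rewrite eqxx.
  by rewrite relabel0.
rewrite -(gen_basis_up fam asc) actM -mulmxA ninv_adj //.
have [st|ns] := boolP (swappable t k); last first.
  rewrite cf_gen_same // mulf_eq0 negb_or => /andP[_ /IH le].
  exact: leq_trans le (leqnSn _).
have [z|/IH le _] := eqVneq (cf t (act (T s) *m v t0)) 0; last exact: leq_trans le (leqnSn _).
rewrite cf_gen_far // z mulr0 add0r mulf_eq0 negb_or => /andP[_ /IH].
rewrite relabel_sw // => le; apply: leq_trans (ninv_adj_le _ k) _.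
by rewrite ltnS.
Qed.

(** An invariant vector must satisfy c(sw k t) = offdiag k t / (diag k t + q^-1) c(t), and its
    coefficients are to be defined without choosing a path from [t0] to [t]. The product of the
    numerators along a path is this coefficient, by [leading_sw]. *)
Definition leading t := cf t (act (T (relabel t)) *m v t0).

Lemma leading_sw k t : swappable t k -> ascent (relabel t) k ->
  leading (sw k t) = offdiag k t * leading t.
Proof.
move=> st asc; rewrite /leading relabel_sw // -(gen_basis_up fam asc) actM -mulmxA.
rewrite cf_gen_far ?swappable_sw // swK //.
have [->|/act_basis_support] := eqVneq (cf (sw k t) (act (T (relabel t)) *m v t0)) 0.
  by rewrite mulr0 add0r.
by rewrite relabel_sw // ninv_adj // ltnn.
Qed.

(** The denominators multiply up to a product over inversions, which depends on no path either. *)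
Definition correction t := \prod_(p | inversion (relabel t) p)
  (theta (pos t0 (relabel t p.2)) (pos t0 (relabel t p.1)))^-1.

Lemma correction_sw k t : swappable t k -> ascent (relabel t) k ->
  correction (sw k t) = (diag k t + q^-1)^-1 * correction t.
Proof.
move=> st asc; rewrite /correction relabel_sw //.
rewrite (big_inversion_adj _ (fun i j => (theta (pos t0 j) (pos t0 i))^-1)) //=.
by rewrite diag_theta // !relabelE !pos_syt.
Qed.

Variable F : 'I_m -> nat.
Hypothesis F_nd : forall i j : 'I_m, (i <= j)%N -> (F i <= F j)%N.

Definition same_label t := [forall b, F (val t b) == F (val t0 b)].

Lemma same_labelP t : reflect (forall b, F (val t b) = F (val t0 b)) (same_label t).
Proof. by apply: (iffP forallP) => h b; apply/eqP. Qed.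

Lemma same_label_sw k t : swappable t k -> F (ord_left k) = F (ord_right k) ->
  same_label (sw k t) = same_label t.
Proof.
move=> st Fk; apply: eq_forallb => b; rewrite val_sw // ffunE.
by case: tpermP => [->|->|//]; rewrite Fk.
Qed.

Definition symm_fixed w := forall k, F (ord_left k) = F (ord_right k) -> G k w = q *: w.

(** Induction on the distance from [t0]. At a descent k of [relabel t] the labels of k and k + 1
    agree and the two can be exchanged; the invariance equation at the exchanged tableau, where the
    coefficient is already 0, leaves a nonzero multiple of the coefficient at [t]. *)
Lemma invariant_cf0 w : symm_fixed w -> cf t0 w = 0 ->
  forall t, same_label t -> cf t w = 0.
Proof.
move=> wI w0 t; move: {2}(ninv (relabel t)) (leqnn (ninv (relabel t))) => n.
elim: n t => [|n IH] t le_n /same_labelP lab.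
all: have [/relabel_eq1->//|/ex_descent[k desc]] := eqVneq (relabel t) 1%g.
  by move: le_n; rewrite (ninv_adjN desc).
have Fpos i : F (relabel t i) = F i by rewrite relabelE -lab posK.
have Fk : F (ord_left k) = F (ord_right k).
  apply/eqP; rewrite eqn_leq F_nd /=; last exact: leqnSn.
  by rewrite -(Fpos (ord_left k)) -(Fpos (ord_right k)) F_nd // leqNgt.
case: (boolP (swappable t k)) => [st|ns].
  have st' := swappable_sw st.
  have z : cf (sw k t) w = 0.
    apply: IH; last by rewrite same_label_sw //; apply/same_labelP.
    by rewrite relabel_sw // -ltnS -(ninv_adjN desc).
  have /eqP := congr1 (cf (sw k t)) (wI _ Fk).
  rewrite cf_gen_far // swK // cfZ z !mulr0 add0r mulf_eq0.
  by rewrite (negPf (offdiag_neq0 st)) => /eqP.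
case/negP: desc; rewrite /ascent !relabelE; move: ns.
case: swapP => // [r cont|c r0 _] _.
  by apply: (@syt_row _ t0 _ _ r); move: cont; rewrite /content r; lia.
by apply: (@syt_col _ t0 _ _ c); rewrite r0.
Qed.

(** Within a column g_k acts by -q^-1 on the coordinate, while invariance demands q. *)
Lemma invariant_vertical w k : symm_fixed w -> F (ord_left k) = F (ord_right k) ->
  box_col (pos t0 (ord_left k)) = box_col (pos t0 (ord_right k)) -> cf t0 w = 0.
Proof.
move=> wI Fk c; have := congr1 (cf t0) (wI _ Fk).
rewrite cf_gen_col // cfZ => e.
(* Since q is not a root of unity, the factor q^2 + 1 of q^4 - 1 cannot vanish. *)
have q4 : q ^+ 4 - 1 != 0 by rewrite subr_eq0 q_nroot.
have q1 : q ^+ 2 + 1 != 0.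
  have e4 : q ^+ 4 - 1 = (q ^+ 2 + 1) * (q ^+ 2 - 1) by ring.
  by apply: contraNneq q4 => z; rewrite e4 z mul0r.
apply: (mulfI q1); rewrite mulr0.
transitivity (q * (q * cf t0 w) + cf t0 w); first by ring.
by rewrite -e; field.
Qed.

Definition canonical : 'cV[K]_d :=
  \sum_(t | same_label t) (leading t * correction t) *: v t.

Lemma cf_canonical t :
  cf t canonical = if same_label t then leading t * correction t else 0.
Proof.
rewrite /canonical cf_sum (big_mkcond same_label) (bigD1 t) //= big1 ?addr0.
  by case: ifP => // _; rewrite cfZ cfv eqxx mulr1.
by move=> t' /negPf ne; case: ifP => // _; rewrite cfZ cfv eq_sym ne mulr0.
Qed.

Lemma same_label0 : same_label t0.
Proof. exact/same_labelP. Qed.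

Lemma cf0_canonical : cf t0 canonical = 1.
Proof.
rewrite cf_canonical same_label0 /leading /correction relabel0 (basis1 fam) act1 mul1mx.
rewrite cfv eqxx mul1r big1 // => -[i j]; rewrite /inversion !perm1 /=.
by case: ltngtP.
Qed.

Hypothesis col_strict : forall b c, box_col b = box_col c -> (box_row b < box_row c)%N ->
  (F (val t0 b) < F (val t0 c))%N.

(** Checked coordinate by coordinate. Where k and k + 1 share a column, [col_strict] gives them
    different labels, contrary to [F] being equal on them; such tableaux are outside the class and
    have coefficient 0. *)
Lemma canonical_invariant : symm_fixed canonical.
Proof.
move=> k Fk; apply: cf_ext => t; rewrite cfZ.
have [st|ns] := boolP (swappable t k); last first.
  move: ns; case: swapP => // [r _ _|c r _ _]; first exact: cf_gen_row.
  rewrite cf_gen_col //.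
  suff -> : cf t canonical = 0 by rewrite !mulr0.
  rewrite cf_canonical; case: ifP => // /same_labelP lab.
  by have := col_strict c; rewrite r => /(_ (ltnSn _)); rewrite -!lab !posK Fk ltnn.
have st' := swappable_sw st.
rewrite cf_gen_far // !cf_canonical same_label_sw //.
case: ifP => _; last by rewrite !mulr0 addr0.
have [asc|desc] := boolP (ascent (relabel t) k).
  rewrite leading_sw // correction_sw //.
  have := theta_neq0 st; have := offdiag_sw st.
  move: (diag k t) (diag k t + q^-1) (offdiag k t) (offdiag k (sw k t)) => x th y z.
  move: (leading t) (correction t) => a b e nz.
  transitivity (x * (a * b) + (z * y) * (a * b) / th); first by field.
  by rewrite e; field.
have asc : ascent (relabel (sw k t)) k by rewrite relabel_sw // ascent_adj.
have := leading_sw st' asc; have := correction_sw st' asc; rewrite !swK // => -> ->.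
have := theta_neq0 st'; have := diag_sw st.
move: (diag k t) (diag k (sw k t) + q^-1) (offdiag k (sw k t)) (leading _) (correction _).
move=> y th z a b e nz; have -> : y = q - th by rewrite -e; ring.
by field.
Qed.

(** On the class every invariant vector is the multiple of [canonical] given by its coordinate at
    [t0]. So the partial trace of [P] is the coordinate at [t0] of [P] applied to [canonical]. *)
Lemma sum_cf_projection (P : 'M[K]_d) :
  (forall x, symm_fixed (P *m x)) -> (forall x, symm_fixed x -> P *m x = x) ->
  \sum_(t | same_label t) cf t (P *m v t) = 1.
Proof.
move=> PI Pid; have cI := canonical_invariant.
have prop x t : symm_fixed x -> same_label t -> cf t x = cf t0 x * cf t canonical.
  move=> xI lab; apply/eqP; rewrite -subr_eq0; apply/eqP.
  have := @invariant_cf0 (x + (- cf t0 x) *: canonical).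
  rewrite cfD cfZ cf0_canonical mulr1 subrr => /(_ _ erefl t lab).
  rewrite cfD cfZ mulNr; apply=> k Fk.
  by rewrite mulmxDr -scalemxAr xI // cI // scalerDr !scalerA mulrC.
transitivity (cf t0 (P *m canonical)); last by rewrite Pid // cf0_canonical.
rewrite /canonical mulmx_sumr cf_sum; apply: eq_bigr => t lab.
rewrite (prop _ t (PI _) lab) cf_canonical lab -scalemxAr cfZ.
exact: mulrC.
Qed.

End Connected.

End Calibrated.

Section NondecreasingRearrangement.
Variables (n m : nat).
Implicit Types (f : m.-tuple 'I_n).

Lemma nth_map_val f (i : 'I_m) : nth 0%N (map val f) i = tnth f i.
Proof. by rewrite (tnth_nth (tnth f i)) (nth_map (tnth f i)) // size_tuple. Qed.

Lemma nondecr_sorted f : nondecr f = sorted leq (map val f).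
Proof.
have sz : size (map val f) = m by rewrite size_map size_tuple.
apply/nondecrP/idP => [nd|srt i j ij].
  apply/(sortedP 0%N) => i; rewrite sz => lt.
  have := nd (Ordinal (ltnW lt)) (Ordinal lt) (leqnSn i).
  by rewrite -!nth_map_val.
rewrite -!nth_map_val; apply: (sorted_leq_nth leq_trans leqnn 0%N srt) => //;
  by rewrite inE sz.
Qed.

Lemma nondecr_tact f (u : 'S_m) : nondecr f -> nondecr (tact f u) -> tact f u = f.
Proof.
rewrite !nondecr_sorted => sf su; apply: val_inj; apply: (inj_map val_inj).
apply: (sorted_eq leq_trans anti_leq su sf); apply: perm_map.
by apply/tuple_permP; exists u.
Qed.

End NondecreasingRearrangement.

(** * Standardization of semistandard tableaux *)

Section Standardization.
Variables (lam : intpart) (n : nat).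
Local Notation m := (psize lam).
Implicit Types (b c e : box lam) (t : syt lam) (S : {ffun box lam -> 'I_n}).

Definition label (f : m.-tuple 'I_n) t : {ffun box lam -> 'I_n} := [ffun b => tnth f (val t b)].

Definition weak S := [forall b, forall c,
  ((box_row b == box_row c) && (box_col b < box_col c)%N
   || (box_col b == box_col c) && (box_row b < box_row c)%N) ==> (S b <= S c)%N].

Lemma weakP S : reflect ((forall b c, box_row b = box_row c -> (box_col b < box_col c)%N -> (S b <= S c)%N)
   /\ (forall b c, box_col b = box_col c -> (box_row b < box_row c)%N -> (S b <= S c)%N)) (weak S).
Proof.
apply: (iffP forallP) => [h|[h1 h2] b].
  by split=> b c e lt; have /forallP/(_ c)/implyP := h b; apply; rewrite e eqxx lt ?orbT.
by apply/forallP=> c; apply/implyP=> /orP[] /andP[/eqP e lt]; [apply: h1 | apply: h2].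
Qed.

Lemma ssytP S : reflect ((forall b c, box_row b = box_row c -> (box_col b < box_col c)%N -> (S b <= S c)%N)
   /\ (forall b c, box_col b = box_col c -> (box_row b < box_row c)%N -> (S b < S c)%N)) (is_ssyt S).
Proof.
apply: (iffP andP) => [[/forallP h1 /forallP h2]|[h1 h2]].
  split=> b c e lt; first by have /forallP/(_ c)/implyP := h1 b; apply; rewrite e eqxx.
  by have /forallP/(_ c)/implyP := h2 b; apply; rewrite e eqxx.
by split; apply/forallP=> b; apply/forallP=> c; apply/implyP=> /andP[/eqP e lt];
  [apply: h1 | apply: h2].
Qed.

Lemma ssyt_weak S : is_ssyt S -> weak S.
Proof. by case/ssytP=> h1 h2; apply/weakP; split=> // b c e lt; apply/ltnW/h2. Qed.

Lemma label_weak f t : nondecr f -> weak (label f t).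
Proof.
move=> /nondecrP nd; apply/weakP; split=> b c e lt; rewrite !ffunE; apply/nd/ltnW.
  exact: syt_row e lt.
exact: syt_col e lt.
Qed.

(* Boxes are standardized in the order of their labels, equal labels from left
   to right and within a column from top to bottom. *)
Definition before S b c := (S b < S c)%N || (S b == S c) &&
  ((box_col b < box_col c)%N || (box_col b == box_col c) && (box_row b < box_row c)%N).

Lemma before_irr S b : before S b b = false.
Proof. by rewrite /before !ltnn andbF andbF. Qed.

Lemma before_trans S : transitive (before S).
Proof. by move=> c b e; rewrite /before -!(inj_eq val_inj) /=; lia. Qed.

Lemma before_total S b c : b != c -> before S b c || before S c b.
Proof.
move=> ne; rewrite /before -!(inj_eq val_inj) /=.
have : ~~ ((box_row b == box_row c) && (box_col b == box_col c)).
  by apply: contra ne => /andP[/eqP r /eqP cl]; apply/eqP/box_inj.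
lia.
Qed.

Definition rank S b := #|[set c | before S c b]|.

Lemma rank_lt S b : (rank S b < m)%N.
Proof.
rewrite -[X in (_ < X)%N](card_box lam) -cardsT; apply: proper_card.
by apply/properP; split; [exact: subsetT | exists b; rewrite !inE ?before_irr].
Qed.

Definition ranking S : {ffun box lam -> 'I_m} := [ffun b => Ordinal (rank_lt S b)].

Lemma rank_before S b c : before S b c -> (rank S b < rank S c)%N.
Proof.
move=> bc; apply: proper_card; apply/properP; split.
  by apply/subsetP=> e; rewrite !inE => eb; apply: before_trans bc.
by exists b; rewrite !inE ?bc ?before_irr.
Qed.

Lemma rank_leq S b c : (rank S b <= rank S c)%N -> (S b <= S c)%N.
Proof.
by apply: contraLR; rewrite -!ltnNge => lt; apply: rank_before; rewrite /before lt.
Qed.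

Lemma ranking_syt S : weak S -> is_syt (ranking S).
Proof.
move=> /weakP[w1 w2]; apply/and3P; split.
- apply/injectiveP=> b c; rewrite !ffunE => -[e]; apply/eqP.
  by apply: contraT => /(before_total S)/orP[] /rank_before; rewrite e ltnn.
- apply/forallP=> b; apply/forallP=> c; apply/implyP=> /andP[/eqP r cl].
  rewrite !ffunE /=; apply: rank_before; have := w1 _ _ r cl.
  by rewrite /before cl /= andbT -(inj_eq val_inj) /= leq_eqVlt orbC.
apply/forallP=> b; apply/forallP=> c; apply/implyP=> /andP[/eqP r cl].
rewrite !ffunE /=; apply: rank_before; have := w2 _ _ r cl.
by rewrite /before r cl eqxx ltnn /= andbT -(inj_eq val_inj) /= leq_eqVlt orbC.
Qed.

Definition standardization S (wS : weak S) : syt lam := Sub (ranking S) (ranking_syt wS).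

Lemma label_standardization S (wS : weak S) : exists2 f, nondecr f &
  label f (standardization wS) = S.
Proof.
set t := standardization wS; exists [tuple S (pos t i) | i < m].
  apply/nondecrP=> i j ij; rewrite !tnth_mktuple; apply: rank_leq.
  by have := ij; rewrite -{1}(posK t i) -{1}(posK t j) /t /= !ffunE.
by apply/ffunP=> b; rewrite ffunE tnth_mktuple pos_syt.
Qed.

(** The labelling determines the multiset of letters, and a sorted word is determined by that. *)
Lemma label_inj f f' t t' : nondecr f -> nondecr f' -> label f t = label f' t' -> f = f'.
Proof.
move=> nd nd' e; have inj : injective (fun i => val t (pos t' i)).
  by move=> i j /syt_inj/pos_inj.
have f'E : f' = tact f (perm inj).
  apply: eq_from_tnth => i; rewrite tnth_tact permE.
  by move/ffunP/(_ (pos t' i)): e; rewrite !ffunE posK.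
by rewrite f'E nondecr_tact // -f'E.
Qed.

(** A failure of strictness produces two vertical neighbours with equal labels. The tableau sought
    is the standardization, whose order makes them consecutive. *)
Lemma label_vertical f t : nondecr f -> ~~ is_ssyt (label f t) ->
  exists t0 k, [/\ label f t0 = label f t,
    tnth f (ord_left k) = tnth f (ord_right k) &
    box_col (pos t0 (ord_left k)) = box_col (pos t0 (ord_right k))].
Proof.
move=> nd ns; set S := label f t in ns *.
have wS : weak S by apply: label_weak.
have [f' nd' lab] := label_standardization wS.
have ff' : f' = f by apply: (label_inj nd' nd lab).
move: lab; rewrite ff' => lab {f' nd' ff'}.
set t0 := standardization wS in lab *.
have [b [c [cl r Sbc]]] : exists b c,
    [/\ box_col c = box_col b, box_row c = (box_row b).+1 & S b = S c].
  have [w1 w2] := weakP _ wS.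
  have /existsP[b /existsP[c /and3P[/eqP cl r Scb]]] : [exists b, [exists c,
      [&& box_col b == box_col c, (box_row b < box_row c)%N & (S c <= S b)%N]]].
    move: ns; rewrite /is_ssyt negb_and => /orP[].
      case/forallPn=> b /forallPn[c]; rewrite negb_imply => /andP[/andP[/eqP e lt]].
      by rewrite w1.
    case/forallPn=> b /forallPn[c]; rewrite negb_imply -leqNgt -andbA => h.
    by apply/existsP; exists b; apply/existsP; exists c.
  have [e [re ce]] := ex_corner r (leqnn (box_col c)).
  exists b, e; split=> //; first by rewrite ce.
  apply: val_inj; apply/eqP; rewrite eqn_leq w2 ?ce ?re //= (leq_trans _ Scb) //.
  move: r; rewrite -re leq_eqVlt => /orP[/eqP e1|lt]; first by rewrite (box_inj e1 ce).
  exact: w2 ce lt.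
(* No box comes between b and c: it would have the same label and column, and a row strictly between
   consecutive rows. *)
have rk : rank S c = (rank S b).+1.
  rewrite /rank -[RHS]/(true + _)%N.
  have -> : true = (b \notin [set e | before S e b]) by rewrite inE before_irr.
  rewrite -cardsU1; apply: eq_card => e; rewrite !inE.
  have [->|ne] := eqVneq e b; first by rewrite /before Sbc cl r eqxx eqxx ltnSn /= !orbT.
  have below : (box_col e == box_col b) && (box_row e < (box_row b).+1)%N =
      (box_col e == box_col b) && (box_row e < box_row b)%N.
    case: eqP => //= ce; rewrite ltnS leq_eqVlt; case: eqP => // re.
    by case/eqP: ne; apply: box_inj.
  by rewrite /before -Sbc cl r below.
have km : (rank S b < m.-1)%N by have := rank_lt S c; rewrite rk; case: m.
have tb : val t0 b = ord_left (Ordinal km) by apply: val_inj; rewrite /= ffunE.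
have tc : val t0 c = ord_right (Ordinal km) by apply: val_inj; rewrite /= ffunE /= rk.
have lb e : S e = tnth f (val t0 e) by rewrite -lab ffunE.
by exists t0, (Ordinal km); split=> //; rewrite -tb -tc -?lb // !pos_syt cl.
Qed.

End Standardization.

(** * The central element of a trace function *)

Section CharacterElement.
Variables (K : fieldType) (q : K) (m : nat) (B : algType K) (g : 'I_m.-1 -> B).
Variable act0 : B -> 'M[K]_(tens_dim m m).
Hypotheses (q_neq0 : q != 0) (fam : hecke_family q g) (rep0 : tensor_rep q g act0).
Variable tr : B -> K.
Hypothesis trP : forall a x y, tr (a *: x + y) = a * tr x + tr y.
Hypothesis trC : forall x y, tr (x * y) = tr (y * x).
Local Notation T := (basis_elt g).

Definition trace_elt : B := \sum_(s : 'S_m) tr (T s^-1%g) *: T s.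

Let trD x y : tr (x + y) = tr x + tr y.
Proof. by rewrite -{1}[x]scale1r trP mul1r. Qed.

Let tr0 : tr 0 = 0.
Proof. by apply: (addIr (tr 0)); rewrite -trD !add0r. Qed.

Let trZ a x : tr (a *: x) = a * tr x.
Proof. by rewrite -[a *: x]addr0 trP tr0 addr0. Qed.

Lemma bcoord_trace_elt s : bcoord act0 trace_elt s = tr (T s^-1%g).
Proof.
rewrite /trace_elt (bcoord_sum rep0) (bigD1 s) //= (bcoordZ rep0) (bcoord_basis fam rep0).
rewrite eqxx mulr1 big1 ?addr0 // => u /negPf ne.
by rewrite (bcoordZ rep0) (bcoord_basis fam rep0) eq_sym ne mulr0.
Qed.

(** [trace_elt] is the element dual to [tr] under the symmetrizing form; cyclicity of [tr] then
    makes it central. *)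
Lemma tform_trace_elt y : tform act0 (trace_elt * y) = tr y.
Proof.
rewrite (tformM fam rep0) [in RHS](bcoordE fam rep0 y) (big_morph _ trD tr0).
rewrite (reindex_inj invg_inj); apply: eq_bigr => s _.
by rewrite bcoord_trace_elt invgK trZ mulrC.
Qed.

Lemma trace_elt_central x : x * trace_elt = trace_elt * x.
Proof.
apply/eqP; rewrite -subr_eq0; apply/eqP.
apply: (tform_nondeg fam rep0) => y; rewrite mulrBl.
rewrite -[X in _ - X]scale1r -scaleNr addrC /tform (bcoordP rep0) mulN1r -/(tform _ _).
rewrite -mulrA tform_trace_elt -/(tform _ _) -mulrA (tformC fam rep0) -mulrA.
by rewrite tform_trace_elt trC addNr.
Qed.

End CharacterElement.

Section TraceOfSymmetrizer.
Variables (K : fieldType) (q : K) (lam : intpart).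
Local Notation m := (psize lam).
Variables (B : algType K) (g : 'I_m.-1 -> B).
Hypotheses (q_neq0 : q != 0) (fam : hecke_family q g).
Hypothesis q_nroot : forall k : nat, (0 < k)%N -> q ^+ k != 1.
Variables (d : nat) (act : B -> 'M[K]_d).
Hypotheses (act1 : act 1 = 1%:M) (actM : forall x y, act (x * y) = act x *m act y)
  (actP : forall a x y, act (a *: x + y) = a *: act x + act y).
Variables (v : syt lam -> 'cV[K]_d).
Hypothesis v_basis : basis_of fullv (codom v).
Hypothesis jm_v : forall t l,
  act (jm q g l) *m v t = q ^ (2 * content (pos t l)) *: v t.
Variables (n : nat) (f : m.-tuple 'I_n).
Hypothesis f_nd : nondecr f.
Local Notation F := (fun i : 'I_m => nat_of_ord (tnth f i)).

(** The semistandard tableaux of weight f: a labelling [label f t] distributes exactly the letters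
    of [f] over the boxes. *)
Definition ssyt_of : {set {ffun box lam -> 'I_n}} :=
  [set S | is_ssyt S & [exists t : syt lam, label f t == S]].

Let actD x y : act (x + y) = act x + act y.
Proof. by rewrite -[x]scale1r actP !scale1r. Qed.

Let act0 : act 0 = 0.
Proof. by apply: (addIr (act 0)); rewrite -actD !add0r. Qed.

Let actZ a x : act (a *: x) = a *: act x.
Proof. by rewrite -[a *: x]addr0 actP act0 addr0. Qed.

Let F_nd (i j : 'I_m) : (i <= j)%N -> (F i <= F j)%N.
Proof. exact: (nondecrP _ f_nd). Qed.

Lemma act_symm_invariant (x : 'cV[K]_d) : symm_fixed q g act F x ->
  act (symm q g F) *m x = poincare q F *: x.
Proof.
move=> xI; rewrite /symm (big_morph _ actD act0) mulmx_suml /poincare scaler_suml.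
apply: eq_bigr => u st; rewrite actZ -scalemxAl.
suff -> : act (basis_elt g u) *m x = q ^+ ninv u *: x.
  by rewrite scalerA -exprD addnn mul2n.
elim/(stab_ind F_nd): {u}st => [|k u Fk asc _ IH].
  by rewrite (basis1 fam) act1 mul1mx ninv1 scale1r.
rewrite -(gen_basis_up fam asc) actM -mulmxA IH -scalemxAr xI //.
by rewrite scalerA -exprSr ninv_adj.
Qed.

(** Divided by the Poincaré polynomial, [symm] acts as the projection onto invariants. Its trace is
    summed over classes of standard tableaux with equal labelling: a semistandard class contributes
    1 and any other class 0. *)
Lemma trace_symm : \tr (act (symm q g F)) = poincare q F * #|ssyt_of|%:R.
Proof.
have pnz : poincare q F != 0 := poincare_neq0 q_nroot F_nd.
have [cf [cfP cfv cfE trE]] := basis_coordinates v_basis.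
pose P := (poincare q F)^-1 *: act (symm q g F).
have PI x : symm_fixed q g act F (P *m x).
  move=> k Fk; rewrite /P -scalemxAl -scalemxAr mulmxA -actM (gen_symm q_neq0 fam Fk).
  by rewrite actZ -scalemxAl !scalerA mulrC.
have Pid x : symm_fixed q g act F x -> P *m x = x.
  by move=> xI; rewrite /P -scalemxAl act_symm_invariant // scalerA mulVf // scale1r.
suff trPE : \tr P = #|ssyt_of|%:R.
  have -> : act (symm q g F) = poincare q F *: P by rewrite scalerA mulfV // scale1r.
  by rewrite mxtraceZ trPE.
rewrite trE (partition_big (label f) predT) //= -sum1_card natr_sum [RHS]big_mkcond /=.
apply: eq_bigr => S _; rewrite inE.
case: (boolP [exists t, label f t == S]) => [/existsP[t0 /eqP lab0]|no]; last first.
  rewrite andbF big_pred0 // => t; apply: contraNF no => lab.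
  by apply/existsP; exists t.
have same t1 t : label f t1 = S -> (label f t == S) = same_label t1 F t.
  move=> lab1; rewrite -lab1; apply/eqP/same_labelP => [/ffunP e b|e].
    by have := e b; rewrite !ffunE => ->.
  by apply/ffunP=> b; rewrite !ffunE; apply: val_inj; apply: e.
rewrite andbT; case: (boolP (is_ssyt S)) => [/ssytP[_ strict]|ns].
  rewrite (eq_bigl _ _ (fun t => same t0 t lab0)).
  apply: (sum_cf_projection q_neq0 fam q_nroot act1 actM actP cfP cfv cfE jm_v F_nd) => //.
  by move=> b c e lt; have := strict b c e lt; rewrite -lab0 !ffunE.
(* The base point is moved to a tableau with a vertical pair of equal labels; there every invariant
   vanishes, and hence on the whole class. *)
rewrite -lab0 in ns; have [t1 [k [lab1 Fk cl]]] := label_vertical f_nd ns.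
rewrite lab0 in lab1; rewrite big1 // => t; rewrite (same t1) // => lab.
apply: (invariant_cf0 q_neq0 fam q_nroot act1 actM actP cfP cfv cfE jm_v F_nd (PI _)) lab.
apply: (invariant_vertical q_neq0 fam q_nroot actM actP cfP cfv cfE jm_v (PI _) _ cl).
by rewrite /= Fk.
Qed.

End TraceOfSymmetrizer.

(** * Products of quantum matrices *)

Section FactorProduct.
Variables (A : nzRingType) (n m : nat) (M : 'M[A]_n).
Implicit Types (I J L : m.-tuple 'I_n).

Lemma in_factor_bra I J k : bra_ket I J (in_factor k M) =
  if I == tset J k (tnth I k) then M (tnth I k) (tnth J k) else 0.
Proof.
rewrite /bra_ket mxE !enum_rankK; congr (if _ then _ else _).
apply/forallP/eqP => [h|e l]; last first.
  by apply/implyP=> /negPf ne; rewrite {1}e tnth_mktuple ne.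
apply: eq_from_tnth => l; rewrite tnth_mktuple; case: eqP => [->//|/eqP ne].
by have /implyP/(_ ne)/eqP := h l.
Qed.

(** Generalized from the full range to a list so that induction can remove one factor; positions
    outside the list are not acted upon and have to agree. *)
Lemma bra_ket_factors_seq (r : seq 'I_m) I J : uniq r ->
  bra_ket I J (\prod_(l <- r) in_factor l M) =
  if [forall l, (l \in r) || (tnth I l == tnth J l)]
  then \prod_(l <- r) M (tnth I l) (tnth J l) else 0.
Proof.
elim: r I => [|k r IH] I.
  move=> _; rewrite !big_nil /bra_ket mxE (inj_eq enum_rank_inj); case: ifP => [/forallP h|/negP h].
    by case: eqP => // -[]; apply: eq_from_tnth => l; have /eqP := h l.
  by case: eqP => // e; case: h; apply/forallP=> l; rewrite e eqxx orbT.
rewrite cons_uniq => /andP[kr ur]; rewrite !big_cons -[_ * _]/(_ *m _) bra_ketM.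
pose L0 := tset I k (tnth J k).
rewrite (bigD1 L0) //= [X in _ + X]big1 ?addr0 => [|L ne]; last first.
  rewrite in_factor_bra; case: eqP => [e|_]; last by rewrite mul0r.
  rewrite IH //; case: ifP => [/forallP/(_ k)|]; last by rewrite mulr0.
  rewrite (negPf kr) /= => /eqP Lk; case/eqP: ne; apply: eq_from_tnth => l.
  rewrite tnth_mktuple; case: eqP => [->//|/eqP ne].
  by have := congr1 (fun t => tnth t l) e; rewrite tnth_mktuple (negPf ne).
rewrite in_factor_bra IH // tnth_mktuple eqxx.
have -> : I == tset L0 k (tnth I k).
  apply/eqP/eq_from_tnth => l; rewrite !tnth_mktuple; case: eqP => [->|] //.
have -> : [forall l, (l \in r) || (tnth L0 l == tnth J l)] =
    [forall l, (l \in k :: r) || (tnth I l == tnth J l)].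
  apply: eq_forallb => l; rewrite inE tnth_mktuple; case: (l =P k) => [->|_] //=.
  by rewrite eqxx orbT.
case: ifP => _; last by rewrite mulr0.
congr (_ * _); rewrite !big_seq; apply: eq_bigr => l lr; rewrite tnth_mktuple.
by case: eqP lr kr => // -> ->.
Qed.

Lemma bra_ket_factors I J : bra_ket I J (\prod_(l < m) in_factor l M) =
  \prod_(l < m) M (tnth I l) (tnth J l).
Proof.
rewrite bra_ket_factors_seq ?index_enum_uniq // ifT //.
by apply/forallP=> l; rewrite mem_index_enum.
Qed.

End FactorProduct.

(** The entries of X do not commute, so the ordered product must be cut exactly around the two
    neighbouring factors. *)
Lemma split_adjacent m (k : 'I_m.-1) : exists s1 s2,
  [/\ index_enum 'I_m = s1 ++ [:: ord_left k, ord_right k & s2],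
      {in s1, forall l, adj_tperm k l = l} & {in s2, forall l, adj_tperm k l = l}].
Proof.
have eE : index_enum 'I_m = enum 'I_m by rewrite [index_enum _]unlock enumT.
have szE : size (index_enum 'I_m) = m by rewrite eE size_enum_ord.
have nthE (i : 'I_m) : nth i (index_enum 'I_m) i = i.
  by rewrite eE; apply: val_inj; rewrite /= nth_enum_ord.
move: szE nthE (index_enum_uniq 'I_m); set e := index_enum _ => szE nthE ue.
have e1 : drop k e = ord_left k :: drop k.+1 e.
  by rewrite (drop_nth (ord_left k)) ?szE ?(nthE (ord_left k)) // ltnW // (ltn_ord (ord_right k)).
have e2 : drop k.+1 e = ord_right k :: drop k.+2 e.
  by rewrite (drop_nth (ord_right k)) ?szE ?(nthE (ord_right k)) // (ltn_ord (ord_right k)).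
have {}eE : e = take k e ++ [:: ord_left k, ord_right k & drop k.+2 e].
  by rewrite -{1}(cat_take_drop k e) e1 e2.
have /and3P[_ nh /= /and3P[nl nr _]] :
    [&& uniq (take k e), ~~ has (mem (take k e)) [:: ord_left k, ord_right k & drop k.+2 e]
      & uniq [:: ord_left k, ord_right k & drop k.+2 e]] by rewrite -cat_uniq -eE.
exists (take k e), (drop k.+2 e); split=> // l ls; apply: tpermD.
- by apply: contraNneq nh => el; rewrite /= el ls.
- by apply: contraNneq nh => el; rewrite /= el ls orbT.
- by apply: contraNneq nl => el; rewrite inE el ls orbT.
by apply: contraNneq nr => el; rewrite el.
Qed.

Section Commutation.
Variables (K : fieldType) (q : K) (n m : nat) (A : algType K) (X : 'M[A]_n).
Hypothesis q_neq0 : q != 0.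
Implicit Types (I J : m.-tuple 'I_n).

Local Notation XX p := (\prod_(l < p) in_factor l X).
Local Notation R k := (Rcheck q n (ord_left k) (ord_right k)).

Lemma bra_ket_map (p : nat) (I J : p.-tuple 'I_n) (M : 'M[K]_(tens_dim n p)) :
  bra_ket I J (map_mx (in_alg A) M) = (bra_ket I J M)%:A.
Proof. by rewrite /bra_ket mxE. Qed.

Lemma Rcheck_bra_ket p (k : 'I_p.-1) (I J : p.-tuple 'I_n) : bra_ket I J (R k) =
  rdiag q (tnth J (ord_left k)) (tnth J (ord_right k)) * (I == J)%:R +
  rswap K (tnth J (ord_left k)) (tnth J (ord_right k)) * (I == tact J (adj_tperm k))%:R.
Proof. by rewrite bra_ketE Rcheck_adj_ket mxE [X in X + _]mxE [X in _ + X]mxE !ketE. Qed.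

Lemma Rcheck_factors_l p (k : 'I_p.-1) (I J : p.-tuple 'I_n) :
  bra_ket I J (map_mx (in_alg A) (R k) *m XX p) =
  rdiag q (tnth I (ord_left k)) (tnth I (ord_right k)) *: \prod_(l < p) X (tnth I l) (tnth J l)
  + rswap K (tnth I (ord_left k)) (tnth I (ord_right k)) *:
      \prod_(l < p) X (tnth I (adj_tperm k l)) (tnth J l).
Proof.
rewrite bra_ketM.
under eq_bigr => L _ do rewrite bra_ket_map bra_ket_factors mulr_algl
  -bra_ket_tr Rcheck_tr Rcheck_bra_ket scalerDl -!scalerA.
rewrite big_split /= -!scaler_sumr; congr (_ *: _ + _ *: _).
  rewrite (bigD1 I) //= eqxx scale1r [X in _ + X]big1 ?addr0 // => L /negPf ne.
  by rewrite ne scale0r.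
rewrite (bigD1 (tact I (adj_tperm k))) //= eqxx scale1r [X in _ + X]big1 ?addr0 => [|L /negPf ne].
  by apply: eq_bigr => l _; rewrite tnth_tact.
by rewrite ne scale0r.
Qed.

Lemma Rcheck_factors_r p (k : 'I_p.-1) (I J : p.-tuple 'I_n) :
  bra_ket I J (XX p *m map_mx (in_alg A) (R k)) =
  rdiag q (tnth J (ord_left k)) (tnth J (ord_right k)) *: \prod_(l < p) X (tnth I l) (tnth J l)
  + rswap K (tnth J (ord_left k)) (tnth J (ord_right k)) *:
      \prod_(l < p) X (tnth I l) (tnth J (adj_tperm k l)).
Proof.
rewrite bra_ketM.
under eq_bigr => L _ do rewrite bra_ket_map bra_ket_factors mulr_algr
  Rcheck_bra_ket scalerDl -!scalerA.
rewrite big_split /= -!scaler_sumr; congr (_ *: _ + _ *: _).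
  rewrite (bigD1 J) //= eqxx scale1r [X in _ + X]big1 ?addr0 // => L /negPf ne.
  by rewrite ne scale0r.
rewrite (bigD1 (tact J (adj_tperm k))) //= eqxx scale1r [X in _ + X]big1 ?addr0 => [|L /negPf ne].
  by apply: eq_bigr => l _; rewrite tnth_tact.
by rewrite ne scale0r.
Qed.

Hypothesis RXX : forall a b : 2.-tuple 'I_n,
  bra_ket a b (map_mx (in_alg A) (Rcheck q n (@ord0 1) (@ord_max 1)) *m XX 2) =
  bra_ket a b (XX 2 *m map_mx (in_alg A) (Rcheck q n (@ord0 1) (@ord_max 1))).

Lemma quantum_relation (i1 i2 j1 j2 : 'I_n) :
  rdiag q i1 i2 *: (X i1 j1 * X i2 j2) + rswap K i1 i2 *: (X i2 j1 * X i1 j2) =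
  rdiag q j1 j2 *: (X i1 j1 * X i2 j2) + rswap K j1 j2 *: (X i1 j2 * X i2 j1).
Proof.
have e0 : ord_left (@ord0 0 : 'I_2.-1) = @ord0 1 by apply: val_inj.
have e1 : ord_right (@ord0 0 : 'I_2.-1) = @ord_max 1 by apply: val_inj.
have := RXX [tuple i1; i2] [tuple j1; j2].
rewrite -{1 2}e0 -{1 2}e1 Rcheck_factors_l Rcheck_factors_r !big_ord_recl !big_ord0 !mulr1.
have -> : lift ord0 ord0 = @ord_max 1 by apply: val_inj.
have a0 : adj_tperm (@ord0 0 : 'I_2.-1) ord0 = @ord_max 1 by rewrite -e0 adj_left.
have a1 : adj_tperm (@ord0 0 : 'I_2.-1) (@ord_max 1) = ord0 by rewrite -e1 adj_right.
by rewrite a0 a1 e0 e1 !(tnth_nth i1).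
Qed.

(** The outer factors are untouched on both sides, and the two middle ones satisfy the defining
    relation of the quantum matrix. *)
Lemma Rcheck_factors_comm (k : 'I_m.-1) :
  map_mx (in_alg A) (R k) *m XX m = XX m *m map_mx (in_alg A) (R k).
Proof.
apply/matrixP=> a b; rewrite -[a]enum_valK -[b]enum_valK.
set I := enum_val a; set J := enum_val b.
rewrite -!/(bra_ket I J _) Rcheck_factors_l Rcheck_factors_r.
have [s1 [s2 [e s1f s2f]]] := split_adjacent k.
rewrite !e !big_cat !big_cons /= !adj_left !adj_right.
have fixI s : {in s, forall l, adj_tperm k l = l} ->
    \prod_(l <- s) X (tnth I (adj_tperm k l)) (tnth J l) = \prod_(l <- s) X (tnth I l) (tnth J l).
  by move=> sf; rewrite !big_seq; apply: eq_bigr => l /sf->.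
have fixJ s : {in s, forall l, adj_tperm k l = l} ->
    \prod_(l <- s) X (tnth I l) (tnth J (adj_tperm k l)) = \prod_(l <- s) X (tnth I l) (tnth J l).
  by move=> sf; rewrite !big_seq; apply: eq_bigr => l /sf->.
rewrite !fixI // !fixJ // !mulrA.
have pull c (x y z t : A) : c *: (x * y * z * t) = x * (c *: (y * z)) * t.
  by rewrite -scalerAr -scalerAl !mulrA.
by rewrite !pull -!mulrDl -!mulrDr quantum_relation.
Qed.

End Commutation.

(** * Shuffle products *)

Section ParabolicEmbedding.
Variables (K : fieldType) (q : K) (p n : nat) (B C : algType K).
Variables (g : 'I_p.-1 -> B) (h : 'I_n.-1 -> C).
Variable act0 : B -> 'M[K]_(tens_dim p p).
Hypotheses (famB : hecke_family q g) (famC : hecke_family q h) (rep0 : tensor_rep q g act0).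
Variables (gap : 'I_p.-1 -> 'I_n.-1) (lift_perm : 'S_p -> 'S_n).
Hypotheses (lift1 : lift_perm 1%g = 1%g)
  (lift_adj : forall k s, lift_perm (adj_tperm k * s)%g = (adj_tperm (gap k) * lift_perm s)%g)
  (lift_asc : forall k s, ascent (lift_perm s) (gap k) = ascent s k).

(** Defined on the standard basis, since an abstract family offers no presentation to map out of;
    that it is multiplicative is proved in [embM]. *)
Definition emb (x : B) : C := \sum_s bcoord act0 x s *: basis_elt h (lift_perm s).

Lemma embP a x y : emb (a *: x + y) = a *: emb x + emb y.
Proof.
rewrite /emb scaler_sumr -big_split; apply: eq_bigr => s _ /=.
by rewrite (bcoordP rep0) scalerDl scalerA.
Qed.

Lemma embD x y : emb (x + y) = emb x + emb y.
Proof. by rewrite -{1}[x]scale1r embP scale1r. Qed.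

Lemma emb0 : emb 0 = 0.
Proof. by apply: (addIr (emb 0)); rewrite -embD !add0r. Qed.

Lemma embZ a x : emb (a *: x) = a *: emb x.
Proof. by rewrite -[a *: x]addr0 embP emb0 addr0. Qed.

Lemma emb_basis s : emb (basis_elt g s) = basis_elt h (lift_perm s).
Proof.
rewrite /emb (bigD1 s) //= (bcoord_basis famB rep0) eqxx scale1r big1 ?addr0 // => u /negPf ne.
by rewrite (bcoord_basis famB rep0) ne scale0r.
Qed.

Lemma emb1 : emb 1 = 1.
Proof. by rewrite -(basis1 famB) emb_basis lift1 (basis1 famC). Qed.

Lemma emb_genM k x : emb (g k * x) = h (gap k) * emb x.
Proof.
elim/(basis_span famB): x => [s|x y ex ey|a x ex]; last 2 first.
- by rewrite mulrDr !embD mulrDr ex ey.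
- by rewrite -scalerAr !embZ ex scalerAr.
have [asc|desc] := boolP (ascent s k).
  by rewrite (gen_basis_up famB) // !emb_basis (gen_basis_up famC) ?lift_asc // lift_adj.
rewrite (gen_basis_down famB) // embD embZ !emb_basis (gen_basis_down famC) ?lift_asc //.
by rewrite lift_adj.
Qed.

Lemma emb_gen k : emb (g k) = h (gap k).
Proof. by rewrite -[g k]mulr1 emb_genM emb1 mulr1. Qed.

Lemma embM x y : emb (x * y) = emb x * emb y.
Proof.
elim/(hf_ind famB): x => [|k x ex|x z ex ez|a x ex].
- by rewrite emb1 !mul1r.
- by rewrite -mulrA !emb_genM ex mulrA.
- by rewrite mulrDl !embD ex ez mulrDl.
by rewrite -scalerAl !embZ ex scalerAl.
Qed.

End ParabolicEmbedding.

Section BlockPermutations.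
Variables a b : nat.
Implicit Types (i : 'I_a) (j : 'I_b) (s : 'S_a) (t : 'S_b) (u : 'S_(a + b)).

Fact lgap_subproof (k : 'I_a.-1) : (k < (a + b).-1)%N.
Proof. by have := ltn_ord k; lia. Qed.

Fact rgap_subproof (k : 'I_b.-1) : (a + k < (a + b).-1)%N.
Proof. by have := ltn_ord k; lia. Qed.

Definition lgap k := Ordinal (lgap_subproof k).
Definition rgap k := Ordinal (rgap_subproof k).

Lemma left_lgap k : ord_left (lgap k) = lshift b (ord_left k).
Proof. exact: val_inj. Qed.
Lemma right_lgap k : ord_right (lgap k) = lshift b (ord_right k).
Proof. exact: val_inj. Qed.
Lemma left_rgap k : ord_left (rgap k) = rshift a (ord_left k).
Proof. exact: val_inj. Qed.
Lemma right_rgap k : ord_right (rgap k) = rshift a (ord_right k).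
Proof. by apply: val_inj; rewrite /= addnS. Qed.

Definition block_fun s t (x : 'I_(a + b)) : 'I_(a + b) :=
  match split x with inl i => lshift b (s i) | inr j => rshift a (t j) end.

Fact block_fun_inj s t : injective (block_fun s t).
Proof.
move=> x y; rewrite /block_fun; case: (split_ordP x) => i ->; case: (split_ordP y) => j ->.
- by move/lshift_inj/perm_inj->.
- by move/eqP; rewrite eq_lrshift.
- by move/eqP; rewrite eq_rlshift.
by move/rshift_inj/perm_inj->.
Qed.

Definition block_perm s t : 'S_(a + b) := perm (@block_fun_inj s t).

Lemma block_perml s t i : block_perm s t (lshift b i) = lshift b (s i).
Proof.
by rewrite permE /block_fun; case: (split_ordP (lshift b i)) => [i' /lshift_inj->|j' /eqP];
  rewrite // eq_lrshift.
Qed.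

Lemma block_permr s t j : block_perm s t (rshift a j) = rshift a (t j).
Proof.
by rewrite permE /block_fun; case: (split_ordP (rshift a j)) => [i' /eqP|j' /rshift_inj->];
  rewrite // eq_rlshift.
Qed.

Lemma block_perm_ext u (v : 'S_(a + b)) : (forall i, u (lshift b i) = v (lshift b i)) ->
  (forall j, u (rshift a j) = v (rshift a j)) -> u = v.
Proof. by move=> l r; apply/permP=> x; case: (split_ordP x) => ? ->. Qed.

Lemma block_perm1 : block_perm 1 1 = 1%g.
Proof. by apply: block_perm_ext => i; rewrite ?block_perml ?block_permr !perm1. Qed.

Lemma block_permM s t s' t' : block_perm (s * s') (t * t') = (block_perm s t * block_perm s' t')%g.
Proof. by apply: block_perm_ext => i; rewrite !permM ?block_perml ?block_permr !permM. Qed.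

Lemma block_perm_lgap k : block_perm (adj_tperm k) 1 = adj_tperm (lgap k).
Proof.
apply: block_perm_ext => i; rewrite ?block_perml ?block_permr ?perm1 /adj_tperm
  left_lgap right_lgap; last by rewrite tpermD // eq_lrshift.
by case: tpermP => [->|->|/eqP l /eqP r]; rewrite ?tpermL ?tpermR ?tpermD // eq_lshift eq_sym.
Qed.

Lemma block_perm_rgap k : block_perm 1 (adj_tperm k) = adj_tperm (rgap k).
Proof.
apply: block_perm_ext => i; rewrite ?block_perml ?block_permr ?perm1 /adj_tperm
  left_rgap right_rgap; first by rewrite tpermD // eq_rlshift.
by case: tpermP => [->|->|/eqP l /eqP r]; rewrite ?tpermL ?tpermR ?tpermD // eq_rshift eq_sym.
Qed.

Lemma ascent_block_l k s t : ascent (block_perm s t) (lgap k) = ascent s k.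
Proof. by rewrite /ascent left_lgap right_lgap !block_perml. Qed.

Lemma ascent_block_r k s t : ascent (block_perm s t) (rgap k) = ascent t k.
Proof. by rewrite /ascent left_rgap right_rgap !block_permr /= ltn_add2l. Qed.

Lemma block_perm_adj_l k s t :
  block_perm (adj_tperm k * s) t = (adj_tperm (lgap k) * block_perm s t)%g.
Proof. by rewrite -block_perm_lgap -block_permM mul1g. Qed.

Lemma block_perm_adj_r k s t :
  block_perm s (adj_tperm k * t) = (adj_tperm (rgap k) * block_perm s t)%g.
Proof. by rewrite -block_perm_rgap -block_permM mul1g. Qed.

(** Increasing on both blocks, that is, a representative of minimal length of its coset under left
    multiplication by S_a x S_b. *)
Definition shuffle u := [forall k, ascent u (lgap k)] && [forall k, ascent u (rgap k)].

Lemma shuffleP u : reflect ((forall k, ascent u (lgap k)) /\ (forall k, ascent u (rgap k))) (shuffle u).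
Proof. by apply: (iffP andP) => -[/forallP h1 /forallP h2]. Qed.

(** Deodhar's lemma. If right multiplication by s_k destroys the ascent at a gap k' of a block, then
    u carries the pair k', k' + 1 to k, k + 1, and s_k moves through u as s_(k'). *)
Lemma shuffle_adj u k : shuffle u ->
  shuffle (u * adj_tperm k) \/
  exists2 k', (u * adj_tperm k = adj_tperm k' * u)%g &
    [/\ ascent u k', ascent u^-1%g k & (exists l, k' = lgap l) \/ (exists l, k' = rgap l)].
Proof.
move=> /shuffleP[ul ur].
have key k' : ascent u k' -> ~~ ascent (u * adj_tperm k)%g k' ->
    (u * adj_tperm k = adj_tperm k' * u)%g /\ ascent u^-1%g k.
  move=> asc; rewrite /ascent !permM !adj_tpermE => desc.
  have [el er] : u (ord_left k') = ord_left k /\ u (ord_right k') = ord_right k.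
    move: asc desc; rewrite /ascent.
    move: (u (ord_left k')) (u (ord_right k')) => x y xy.
    by move=> h; split; apply: val_inj; move: h; rewrite /=; repeat (case_nat_if; rewrite //=); lia.
  split; last by rewrite -el -er !permK /=.
  by rewrite -[adj_tperm k]/(tperm _ _) -el -er -tpermJ conjgE mulKVg.
case: (boolP (shuffle (u * adj_tperm k)%g)) => [|ns]; [by left | right].
move: ns; rewrite negb_and => /orP[] /forallPn[l].
  by case/(key _ (ul l)) => e asc; exists (lgap l) => //; split=> //; left; exists l.
by case/(key _ (ur l)) => e asc; exists (rgap l) => //; split=> //; right; exists l.
Qed.

End BlockPermutations.

Section ShuffleProduct.
Variables (K : fieldType) (q : K) (a b : nat) (A B C : algType K).
Variables (ga : 'I_a.-1 -> A) (gb : 'I_b.-1 -> B) (gc : 'I_(a + b).-1 -> C).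
Hypotheses (famA : hecke_family q ga) (famB : hecke_family q gb) (famC : hecke_family q gc).
Variables (actA0 : A -> 'M[K]_(tens_dim a a)) (actB0 : B -> 'M[K]_(tens_dim b b)).
Hypotheses (repA0 : tensor_rep q ga actA0) (repB0 : tensor_rep q gb actB0).
Local Notation T := (basis_elt gc).
Implicit Types (x : A) (y : B) (u : 'S_(a + b)).

Definition emb_l : A -> C := emb gc actA0 (fun s => block_perm s (1%g : 'S_b)).
Definition emb_r : B -> C := emb gc actB0 (fun t => block_perm (1%g : 'S_a) t).

Lemma emb_lM k x : emb_l (ga k * x) = gc (lgap b k) * emb_l x.
Proof.
by apply: (emb_genM famA famC repA0) => *; rewrite ?block_perm_adj_l ?ascent_block_l.
Qed.

Lemma emb_rM k y : emb_r (gb k * y) = gc (rgap a k) * emb_r y.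
Proof.
by apply: (emb_genM famB famC repB0) => *; rewrite ?block_perm_adj_r ?ascent_block_r.
Qed.

Lemma emb_l_mul x x' : emb_l (x * x') = emb_l x * emb_l x'.
Proof.
by apply: (embM famA famC repA0 (gap := @lgap a b)) => *;
  rewrite ?block_perm1 ?block_perm_adj_l ?ascent_block_l.
Qed.

Lemma emb_r_mul y y' : emb_r (y * y') = emb_r y * emb_r y'.
Proof.
by apply: (embM famB famC repB0 (gap := @rgap a b)) => *;
  rewrite ?block_perm1 ?block_perm_adj_r ?ascent_block_r.
Qed.

Lemma emb_l_gen k : emb_l (ga k) = gc (lgap b k).
Proof.
by apply: (emb_gen famA famC repA0) => *;
  rewrite ?block_perm1 ?block_perm_adj_l ?ascent_block_l.
Qed.

Lemma emb_r_gen k : emb_r (gb k) = gc (rgap a k).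
Proof.
by apply: (emb_gen famB famC repB0) => *;
  rewrite ?block_perm1 ?block_perm_adj_r ?ascent_block_r.
Qed.

Lemma emb_l1 : emb_l 1 = 1.
Proof. by apply: (emb1 famA famC repA0); rewrite block_perm1. Qed.

Lemma emb_r1 : emb_r 1 = 1.
Proof. by apply: (emb1 famB famC repB0); rewrite block_perm1. Qed.

Let emb_l_rgap k x : gc (rgap a k) * emb_l x = emb_l x * gc (rgap a k).
Proof.
elim/(hf_ind famA): x => [|l x ex|x z ex ez|c x ex].
- by rewrite emb_l1 mulr1 mul1r.
- rewrite emb_lM mulrA (hf_comm famC) -?mulrA ?ex //=.
  by rewrite [X in _ || X]ltn_addr ?orbT // -ltn_predRL.
- by rewrite /emb_l (embD _ repA0) mulrDr mulrDl ex ez.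
by rewrite /emb_l (embZ _ repA0) -scalerAr -scalerAl ex.
Qed.

Let emb_r_lgap k y : gc (lgap b k) * emb_r y = emb_r y * gc (lgap b k).
Proof.
elim/(hf_ind famB): y => [|l x ex|x z ex ez|c x ex].
- by rewrite emb_r1 mulr1 mul1r.
- rewrite emb_rM mulrA (hf_comm famC) -?mulrA ?ex //=.
  by rewrite ltn_addr // -ltn_predRL.
- by rewrite /emb_r (embD _ repB0) mulrDr mulrDl ex ez.
by rewrite /emb_r (embZ _ repB0) -scalerAr -scalerAl ex.
Qed.

Definition shuffle_product x y : C :=
  \sum_(u | shuffle u) T u^-1%g * (emb_l x * emb_r y) * T u.

Variables (x : A) (y : B).
Hypotheses (x_central : forall k, ga k * x = x * ga k) (y_central : forall k, gb k * y = y * gb k).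

Let c := emb_l x * emb_r y.

Let c_lgap k : gc (lgap b k) * c = c * gc (lgap b k).
Proof.
rewrite /c mulrA -emb_lM x_central emb_l_mul emb_l_gen -!mulrA.
by rewrite emb_r_lgap.
Qed.

Let c_rgap k : gc (rgap a k) * c = c * gc (rgap a k).
Proof.
rewrite /c mulrA emb_l_rgap -!mulrA; congr (_ * _).
by rewrite -emb_rM y_central emb_r_mul emb_r_gen.
Qed.

(** By [shuffle_adj] the sum splits in two. If u s_k is no shuffle, g_k passes through T_u as a
    generator of one block, which commutes with the central elements. The remaining u form pairs u,
    u s_k, to which [gen_pair_comm] applies. *)
Lemma shuffle_product_central k :
  gc k * shuffle_product x y = shuffle_product x y * gc k.
Proof.
rewrite /shuffle_product -/c; pose S u := T u^-1%g * c * T u.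
rewrite (bigID (fun u => shuffle (u * adj_tperm k)%g)) /= mulrDr mulrDl; congr (_ + _); last first.
  rewrite mulr_sumr mulr_suml; apply: eq_bigr => u /andP[su ns].
  have [/idPn//|[k' e [asc ascV kk']]] := shuffle_adj k su.
  have ck : gc k' * c = c * gc k' by case: kk' => [[l ->]|[l ->]]; [apply: c_lgap | apply: c_rgap].
  rewrite -(mulrA _ (T u)) (basis_gen_up famC ascV) e -(gen_basis_up famC asc).
  rewrite !mulrA (gen_basis_up famC ascV).
  have -> : (adj_tperm k * u^-1 = u^-1 * adj_tperm k')%g.
    by apply: (mulgI u); rewrite mulKVg mulgA e mulgK.
  rewrite -(basis_gen_up famC) ?invgK // -!(mulrA (T u^-1%g)).
  congr (_ * (_ * _)); move: ck; rewrite /c !mulrA; exact.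
have inv_adj u : (u * adj_tperm k)^-1%g = (adj_tperm k * u^-1)%g by rewrite invMg tpermV.
pose P u := shuffle u && shuffle (u * adj_tperm k)%g.
have PA u : P (u * adj_tperm k)%g = P u by rewrite /P adj_tpermKr andbC.
have pairs : \sum_(u | P u) S u =
    \sum_(u | P u && ascent u^-1%g k) (S u + gc k * S u * gc k).
  rewrite (bigID (fun u => ascent u^-1%g k)) big_split /=; congr (_ + _).
  rewrite (reindex_inj (mulIg (adj_tperm k))) /=.
  apply: eq_big => [u|u]; rewrite PA inv_adj ascent_adj negbK // => /andP[_ asc].
  rewrite /S inv_adj -(gen_basis_up famC asc) -(basis_gen_up famC asc).
  by rewrite !mulrA.
rewrite -/(P _) (eq_bigr S) // pairs mulr_sumr mulr_suml; apply: eq_bigr => u _.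
exact: (gen_pair_comm famC).
Qed.

End ShuffleProduct.

Section Concatenation.
Variables (X : Type) (a b : nat).
Implicit Types (I : a.-tuple X) (J : b.-tuple X) (w : (a + b).-tuple X).

Definition lpart w : a.-tuple X := [tuple tnth w (lshift b i) | i < a].
Definition rpart w : b.-tuple X := [tuple tnth w (rshift a j) | j < b].

Lemma tuple_block_ext w w' : lpart w = lpart w' -> rpart w = rpart w' -> w = w'.
Proof.
move=> el er; apply: eq_from_tnth => x; case: (split_ordP x) => i ->.
  by have := congr1 (fun t => tnth t i) el; rewrite !tnth_mktuple.
by have := congr1 (fun t => tnth t i) er; rewrite !tnth_mktuple.
Qed.

Lemma lpart_cat I J : lpart [tuple of I ++ J] = I.
Proof. by apply: eq_from_tnth => i; rewrite tnth_mktuple tnth_lshift. Qed.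

Lemma rpart_cat I J : rpart [tuple of I ++ J] = J.
Proof. by apply: eq_from_tnth => i; rewrite tnth_mktuple tnth_rshift. Qed.

Lemma cat_parts w : [tuple of lpart w ++ rpart w] = w.
Proof. by apply: tuple_block_ext; rewrite ?lpart_cat ?rpart_cat. Qed.

Lemma tact_cat_block I J (s : 'S_a) (t : 'S_b) :
  tact [tuple of I ++ J] (block_perm s t) = [tuple of tact I s ++ tact J t].
Proof.
by apply: tuple_block_ext; rewrite ?lpart_cat ?rpart_cat; apply: eq_from_tnth => i;
  rewrite tnth_mktuple !tnth_tact ?block_perml ?block_permr ?tnth_lshift ?tnth_rshift.
Qed.

End Concatenation.

Lemma ket_lin_ext (K : fieldType) (n m : nat) (V : lmodType K)
    (phi psi : 'cV[K]_(tens_dim n m) -> V) : linear phi -> linear psi ->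
  (forall J, phi (ket K J) = psi (ket K J)) -> phi =1 psi.
Proof.
move=> lphi lpsi e v.
have lin0 (f : 'cV[K]_(tens_dim n m) -> V) : linear f -> f 0 = 0.
  by move=> lf; apply: (addIr (f 0)); have := lf 1 0 0; rewrite !scale1r !add0r => <-.
rewrite (cV_ket v); elim: (index_enum _) => [|J r IH]; first by rewrite big_nil !lin0.
by rewrite big_cons lphi lpsi e IH.
Qed.

Section BlockAction.
Variables (K : fieldType) (q : K) (a b : nat) (A B C : algType K).
Variables (ga : 'I_a.-1 -> A) (gb : 'I_b.-1 -> B) (gc : 'I_(a + b).-1 -> C).
Hypotheses (famA : hecke_family q ga) (famB : hecke_family q gb) (famC : hecke_family q gc).
Variables (actA0 : A -> 'M[K]_(tens_dim a a)) (actB0 : B -> 'M[K]_(tens_dim b b)).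
Hypotheses (repA0 : tensor_rep q ga actA0) (repB0 : tensor_rep q gb actB0).
Variables (n : nat) (actA : A -> 'M[K]_(tens_dim n a)) (actB : B -> 'M[K]_(tens_dim n b))
  (actC : C -> 'M[K]_(tens_dim n (a + b))).
Hypotheses (repA : tensor_rep q ga actA) (repB : tensor_rep q gb actB)
  (repC : tensor_rep q gc actC).
Local Notation R k := (Rcheck q n (ord_left k) (ord_right k)).
Local Notation emb_l := (emb_l gc actA0).
Local Notation emb_r := (emb_r gc actB0).
Implicit Types (I : a.-tuple 'I_n) (J : b.-tuple 'I_n).

(** The tensor product of v with the basis vector of [J]; [append_l] has the basis vector on the
    left. *)
Definition append_r J (v : 'cV[K]_(tens_dim n a)) : 'cV[K]_(tens_dim n (a + b)) :=
  \sum_I v (enum_rank I) 0 *: ket K [tuple of I ++ J].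

Definition append_l I (v : 'cV[K]_(tens_dim n b)) : 'cV[K]_(tens_dim n (a + b)) :=
  \sum_J v (enum_rank J) 0 *: ket K [tuple of I ++ J].

Lemma append_rP J c v w : append_r J (c *: v + w) = c *: append_r J v + append_r J w.
Proof.
rewrite /append_r scaler_sumr -big_split; apply: eq_bigr => I _ /=.
by rewrite !mxE scalerDl scalerA.
Qed.

Lemma append_lP I c v w : append_l I (c *: v + w) = c *: append_l I v + append_l I w.
Proof.
rewrite /append_l scaler_sumr -big_split; apply: eq_bigr => J _ /=.
by rewrite !mxE scalerDl scalerA.
Qed.

Lemma append_r_ket I J : append_r J (ket K I) = ket K [tuple of I ++ J].
Proof.
rewrite /append_r (bigD1 I) //= ketE eqxx scale1r big1 ?addr0 // => L /negPf ne.
by rewrite ketE ne scale0r.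
Qed.

Lemma append_l_ket I J : append_l I (ket K J) = ket K [tuple of I ++ J].
Proof.
rewrite /append_l (bigD1 J) //= ketE eqxx scale1r big1 ?addr0 // => L /negPf ne.
by rewrite ketE ne scale0r.
Qed.

Lemma append_rZ J c v : append_r J (c *: v) = c *: append_r J v.
Proof. by rewrite /append_r scaler_sumr; apply: eq_bigr => I _; rewrite mxE scalerA. Qed.

Lemma append_lZ I c v : append_l I (c *: v) = c *: append_l I v.
Proof. by rewrite /append_l scaler_sumr; apply: eq_bigr => J _; rewrite mxE scalerA. Qed.

Lemma append_r_gen k J v : R (lgap b k) *m append_r J v = append_r J (R k *m v).
Proof.
apply: (ket_lin_ext (phi := fun v => R (lgap b k) *m append_r J v)
  (psi := fun v => append_r J (R k *m v))) v => [c v w|c v w|I].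
- by rewrite append_rP mulmxDr -scalemxAr.
- by rewrite mulmxDr -scalemxAr append_rP.
rewrite append_r_ket !Rcheck_adj_ket append_rP append_rZ !append_r_ket.
rewrite left_lgap right_lgap !tnth_lshift -block_perm_lgap tact_cat_block.
by rewrite tact1.
Qed.

Lemma append_l_gen k I v : R (rgap a k) *m append_l I v = append_l I (R k *m v).
Proof.
apply: (ket_lin_ext (phi := fun v => R (rgap a k) *m append_l I v)
  (psi := fun v => append_l I (R k *m v))) v => [c v w|c v w|J].
- by rewrite append_lP mulmxDr -scalemxAr.
- by rewrite mulmxDr -scalemxAr append_lP.
rewrite append_l_ket !Rcheck_adj_ket append_lP append_lZ !append_l_ket.
rewrite left_rgap right_rgap !tnth_rshift -block_perm_rgap tact_cat_block.
by rewrite tact1.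
Qed.

Lemma act_emb_l x J v : actC (emb_l x) *m append_r J v = append_r J (actA x *m v).
Proof.
elim/(hf_ind famA): x v => [|k x ex|x z ex ez|c x ex] v.
- by rewrite (emb_l1 famA famC repA0) (tr_1 repA) (tr_1 repC) !mul1mx.
- rewrite (emb_lM famA famC repA0) (tr_M repC) (tr_M repA) -!mulmxA ex.
  by rewrite (tr_gen repA) (tr_gen repC) append_r_gen.
- rewrite /emb_l (embD _ repA0) (actD repC) (actD repA) !mulmxDl ex ez.
  by rewrite -[X in append_r _ (X + _)]scale1r append_rP scale1r.
rewrite /emb_l (embZ _ repA0) (actZ repC) (actZ repA) -!scalemxAl ex.
by rewrite append_rZ.
Qed.

Lemma act_emb_r y I v : actC (emb_r y) *m append_l I v = append_l I (actB y *m v).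
Proof.
elim/(hf_ind famB): y v => [|k x ex|x z ex ez|c x ex] v.
- by rewrite (emb_r1 famB famC repB0) (tr_1 repB) (tr_1 repC) !mul1mx.
- rewrite (emb_rM famB famC repB0) (tr_M repC) (tr_M repB) -!mulmxA ex.
  by rewrite (tr_gen repB) (tr_gen repC) append_l_gen.
- rewrite /emb_r (embD _ repB0) (actD repC) (actD repB) !mulmxDl ex ez.
  by rewrite -[X in append_l _ (X + _)]scale1r append_lP scale1r.
rewrite /emb_r (embZ _ repB0) (actZ repC) (actZ repB) -!scalemxAl ex.
by rewrite append_lZ.
Qed.

Lemma act_emb_ket x y I J : actC (emb_l x * emb_r y) *m ket K [tuple of I ++ J] =
  \sum_I' \sum_J' (bra_ket I' I (actA x) * bra_ket J' J (actB y)) *: ket K [tuple of I' ++ J'].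
Proof.
rewrite (tr_M repC) -mulmxA -append_l_ket act_emb_r /append_l mulmx_sumr exchange_big /=.
apply: eq_bigr => J' _; rewrite -bra_ketE -scalemxAr -append_r_ket act_emb_l /append_r scaler_sumr.
by apply: eq_bigr => I' _; rewrite -bra_ketE scalerA mulrC.
Qed.

Lemma bra_ket_emb x y I J I' J' :
  bra_ket [tuple of I' ++ J'] [tuple of I ++ J] (actC (emb_l x * emb_r y)) =
  bra_ket I' I (actA x) * bra_ket J' J (actB y).
Proof.
rewrite bra_ketE act_emb_ket summxE (bigD1 I') //= summxE (bigD1 J') //= mxE ketE eqxx mulr1.
rewrite big1 ?addr0 => [|L /negPf ne]; last first.
  rewrite mxE ketE; case: eqP => [e|_]; last by rewrite mulr0.
  by have := congr1 (@rpart _ a b) e; rewrite !rpart_cat => e'; rewrite e' eqxx in ne.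
rewrite big1 ?addr0 // => L /negPf ne; rewrite summxE big1 // => L' _.
rewrite mxE ketE; case: eqP => [e|_]; last by rewrite mulr0.
by have := congr1 (@lpart _ a b) e; rewrite !lpart_cat => e'; rewrite e' eqxx in ne.
Qed.

End BlockAction.

Section ShuffleDecomposition.
Variables a b : nat.
Implicit Types (s : 'S_a) (t : 'S_b) (u v : 'S_(a + b)).

Lemma shuffle_l u (i j : 'I_a) : shuffle u -> (i < j)%N -> (u (lshift b i) < u (lshift b j))%N.
Proof.
move=> /shuffleP[ul _]; apply: (adjacent_incr (h := fun i => u (lshift b i))) => k.
by have := ul k; rewrite /ascent left_lgap right_lgap.
Qed.

Lemma shuffle_r u (i j : 'I_b) : shuffle u -> (i < j)%N -> (u (rshift a i) < u (rshift a j))%N.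
Proof.
move=> /shuffleP[_ ur]; apply: (adjacent_incr (h := fun i => u (rshift a i))) => k.
by have := ur k; rewrite /ascent left_rgap right_rgap.
Qed.

Lemma ascent_shuffle_l u s t k : shuffle u -> ascent (block_perm s t * u)%g (lgap b k) = ascent s k.
Proof.
move=> su; rewrite /ascent !permM left_lgap right_lgap !block_perml.
case: (ltngtP (s (ord_left k)) (s (ord_right k))) => [lt|lt|/val_inj/perm_inj/eqP].
- by rewrite shuffle_l.
- by apply: negbTE; rewrite -leqNgt ltnW // shuffle_l.
by rewrite -(inj_eq val_inj) /= ltn_eqF.
Qed.

Lemma ascent_shuffle_r u s t k : shuffle u -> ascent (block_perm s t * u)%g (rgap a k) = ascent t k.
Proof.
move=> su; rewrite /ascent !permM left_rgap right_rgap !block_permr.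
case: (ltngtP (t (ord_left k)) (t (ord_right k))) => [lt|lt|/val_inj/perm_inj/eqP].
- by rewrite shuffle_r.
- by apply: negbTE; rewrite -leqNgt ltnW // shuffle_r.
by rewrite -(inj_eq val_inj) /= ltn_eqF.
Qed.

Lemma ex_shuffle u : exists s t v, shuffle v /\ u = (block_perm s t * v)%g.
Proof.
move: {2}(ninv u) (leqnn (ninv u)) => d; elim: d u => [|d IH] u le;
  case: (boolP (shuffle u)) => [su|]; try by exists 1%g, 1%g, u; rewrite block_perm1 mul1g.
  rewrite /shuffle negb_and => /orP[] /forallPn[k desc]; exfalso;
  by move: le; rewrite (ninv_adjN desc).
rewrite /shuffle negb_and => /orP[] /forallPn[k desc]; have := ninv_adjN desc => e.
  have [|s [t [v [sv ev]]]] := IH (adj_tperm (lgap b k) * u)%g; first by rewrite -ltnS -e.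
  by exists (adj_tperm k * s)%g, t, v; rewrite block_perm_adj_l -mulgA -ev adj_tpermKl.
have [|s [t [v [sv ev]]]] := IH (adj_tperm (rgap a k) * u)%g; first by rewrite -ltnS -e.
by exists s, (adj_tperm k * t)%g, v; rewrite block_perm_adj_r -mulgA -ev adj_tpermKl.
Qed.

Lemma block_permV s t : (block_perm s t)^-1%g = block_perm s^-1 t^-1.
Proof. by apply: (mulgI (block_perm s t)); rewrite mulgV -block_permM !mulgV block_perm1. Qed.

(** Two shuffles in one coset differ by a block permutation; as it has only ascents by
    [ascent_shuffle_l] and [ascent_shuffle_r], it is the identity. *)
Lemma shuffle_uniq s t u s' t' u' : shuffle u -> shuffle u' ->
  (block_perm s t * u = block_perm s' t' * u')%g -> [/\ s = s', t = t' & u = u'].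
Proof.
move=> su su' e.
have {}e : (u' = block_perm (s'^-1 * s) (t'^-1 * t) * u)%g.
  by rewrite block_permM -mulgA e -block_permV mulKg.
have /shuffleP[l r] := su'.
have s1 : (s'^-1 * s = 1)%g.
  by apply: all_ascent => k; have := l k; rewrite e ascent_shuffle_l.
have t1 : (t'^-1 * t = 1)%g.
  by apply: all_ascent => k; have := r k; rewrite e ascent_shuffle_r.
split; [| |by rewrite e s1 t1 block_perm1 mul1g].
  by rewrite -[s](mulKVg s') s1 mulg1.
by rewrite -[t](mulKVg t') t1 mulg1.
Qed.

Lemma sum_shuffle (V : nmodType) (F : 'S_(a + b) -> V) :
  \sum_u F u = \sum_(u | shuffle u) \sum_s \sum_t F (block_perm s t * u)%g.
Proof.
pose h (p : 'S_(a + b) * ('S_a * 'S_b)) := (block_perm p.2.1 p.2.2 * p.1)%g.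
transitivity (\sum_(u in [set h p | p in [pred p | shuffle p.1]]) F u).
  apply: eq_bigl => u; apply/esym/imsetP.
  by have [s [t [v [sv ->]]]] := ex_shuffle u; exists (v, (s, t)).
rewrite big_imset => [|[u [s t]] [u' [s' t']]]; last first.
  by rewrite !inE /h /= => su su' e; have [-> -> ->] := shuffle_uniq su su' e.
transitivity (\sum_(u | shuffle u) \sum_p F (h (u, p))).
  by rewrite pair_big_dep /=; apply: eq_big => [[u p]|[u p] _]; rewrite ?andbT.
by apply: eq_bigr => u _; rewrite pair_big /=; apply: eq_bigr => -[].
Qed.

Variable n : nat.
Implicit Types (f w : (a + b).-tuple 'I_n).

Lemma nondecr_lpart f u : nondecr f -> shuffle u -> nondecr (lpart (tact f u)).
Proof.
move=> /nondecrP nd su; apply/nondecrP=> i j; rewrite !tnth_mktuple leq_eqVlt.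
by case/orP=> [/eqP/val_inj->//|ij]; apply/nd/ltnW/shuffle_l.
Qed.

Lemma nondecr_rpart f u : nondecr f -> shuffle u -> nondecr (rpart (tact f u)).
Proof.
move=> /nondecrP nd su; apply/nondecrP=> i j; rewrite !tnth_mktuple leq_eqVlt.
by case/orP=> [/eqP/val_inj->//|ij]; apply/nd/ltnW/shuffle_r.
Qed.

(** Ascents inside the blocks survive multiplication by a shuffle, so inversions can be added one at
    a time, first those of t and then those of s. *)
Lemma ninvf_shuffle f u s t : shuffle u ->
  ninvf f (block_perm s t * u)%g =
  (ninvf (lpart (tact f u)) s + ninvf (rpart (tact f u)) t + ninvf f u)%N.
Proof.
move=> su; elim/perm_ind_up: s => [|k s asc IH].
  rewrite ninvf1; elim/perm_ind_up: t => [|k t asc IH].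
    by rewrite block_perm1 mul1g ninvf1.
  rewrite block_perm_adj_r -mulgA [LHS]ninvf_up ?ascent_shuffle_r // IH.
  rewrite ninvf_up // !permM left_rgap right_rgap !block_permr !tnth_mktuple.
  by rewrite !add0n addnA.
rewrite block_perm_adj_l -mulgA [LHS]ninvf_up ?ascent_shuffle_l // IH.
rewrite ninvf_up // !permM left_lgap right_lgap !block_perml !tnth_mktuple.
by rewrite !addnA.
Qed.

End ShuffleDecomposition.

Lemma tact_injl (T : Type) m (s : 'S_m) : injective (fun I : m.-tuple T => tact I s).
Proof.
by move=> I J e; rewrite -[I]tact1 -[J]tact1 -(mulVg s) !tactM e.
Qed.

(** * Weighted counting of rearrangements of a word *)

Section WeightedOrbit.
Variables (K : fieldType) (q : K) (n m : nat) (f : m.-tuple 'I_n).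
Implicit Types (w : m.-tuple 'I_n) (u s : 'S_m).

Definition orbit_weight w : K := \sum_(u | tact f u == w) q ^+ (2 * ninvf f u).

Lemma ninvf_adj u k : tnth f (u (ord_left k)) != tnth f (u (ord_right k)) ->
  ninvf f (adj_tperm k * u)%g = ninvf f u.
Proof.
move=> ne; have [asc|desc] := boolP (ascent u k).
  by rewrite /ninvf invQ_adj // eq_sym (negPf ne).
rewrite -{2}[u](adj_tpermKl k) [RHS]invQ_adj ?ascent_adj // !permM adj_left adj_right.
by rewrite (negPf ne).
Qed.

(** Exchanging two different letters neither creates nor destroys an inversion between equal
    letters. Hence all rearrangements of [f] carry the same weight, the Poincaré polynomial found at
    [f] itself. *)
Lemma orbit_weight_adj w k : orbit_weight (tact w (adj_tperm k)) = orbit_weight w.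
Proof.
have [e|ne] := eqVneq (tnth w (ord_left k)) (tnth w (ord_right k)).
  congr orbit_weight; apply: eq_from_tnth => i; rewrite tnth_tact.
  by case: tpermP => [->|->|].
rewrite /orbit_weight (reindex_inj (mulgI (adj_tperm k))) /=.
apply: eq_big => [u|u /eqP e].
  apply/eqP/eqP => [|<-]; last by rewrite tactM.
  by rewrite tactM => /tact_injl.
have {}e : tact f u = w by move: e; rewrite tactM => /tact_injl.
by rewrite ninvf_adj // -!tnth_tact e.
Qed.

Lemma orbit_weight_tact w s : orbit_weight (tact w s) = orbit_weight w.
Proof.
elim/perm_ind_up: s => [|k s _ IH]; first by rewrite tact1.
by rewrite tactM orbit_weight_adj.
Qed.

Lemma orbit_weight_id : nondecr f ->
  orbit_weight f = poincare q (fun i => tnth f i : nat).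
Proof.
move=> nd; apply: eq_big => u; first by rewrite stab_tact.
by rewrite -stab_tact => /(ninvf_stab nd)->.
Qed.

End WeightedOrbit.

Section OrbitFactorization.
Variables (K : fieldType) (q : K) (n a b : nat) (f : (a + b).-tuple 'I_n).
Hypothesis f_nd : nondecr f.
Variables (w1 : a.-tuple 'I_n) (w2 : b.-tuple 'I_n).
Hypotheses (nd1 : nondecr w1) (nd2 : nondecr w2).
Local Notation P w := (poincare q (fun i => nat_of_ord (tnth w i))).

(** Every way to reach w1 w2 from [f] is a shuffle followed by stabilizers of w1 and w2, with
    inversions adding up. This identity dictates the denominators in [weight_char]. *)
Lemma orbit_weight_shuffle :
  (\sum_(u | shuffle u && (tact f u == [tuple of w1 ++ w2])) q ^+ (2 * ninvf f u)) * (P w1 * P w2) =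
  orbit_weight q f [tuple of w1 ++ w2].
Proof.
rewrite /orbit_weight [RHS]big_mkcond sum_shuffle mulr_suml [LHS]big_mkcondr /=.
apply: eq_bigr => u su.
have tE s t : tact f (block_perm s t * u)%g =
    [tuple of tact (lpart (tact f u)) s ++ tact (rpart (tact f u)) t].
  by rewrite tactM -[in LHS](cat_parts (tact f u)) tact_cat_block.
have ndl := nondecr_lpart f_nd su; have ndr := nondecr_rpart f_nd su.
under eq_bigr => s _ do under eq_bigr => t _ do rewrite tE.
case: eqP => [e|ne]; last first.
  rewrite big1 // => s _; rewrite big1 // => t _; case: eqP => // e.
  have e1 := congr1 (@lpart _ _ _) e; have e2 := congr1 (@rpart _ _ _) e.
  rewrite !lpart_cat in e1; rewrite !rpart_cat in e2; case: ne.
  apply: tuple_block_ext; rewrite ?lpart_cat ?rpart_cat.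
    by rewrite -e1 (nondecr_tact (u := s)) // e1.
  by rewrite -e2 (nondecr_tact (u := t)) // e2.
have e1 : lpart (tact f u) = w1 by rewrite e lpart_cat.
have e2 : rpart (tact f u) = w2 by rewrite e rpart_cat.
rewrite e1 e2 -(orbit_weight_id q nd1) -(orbit_weight_id q nd2) /orbit_weight.
rewrite mulr_suml mulr_sumr [LHS]big_mkcond /=; apply: eq_bigr => s _.
have cat_eq t : ([tuple of tact w1 s ++ tact w2 t] == [tuple of w1 ++ w2]) =
    (tact w1 s == w1) && (tact w2 t == w2).
  apply/eqP/andP => [e'|[/eqP-> /eqP->]//].
  have := congr1 (@lpart _ _ _) e'; have := congr1 (@rpart _ _ _) e'.
  by rewrite !lpart_cat !rpart_cat => -> ->.
under [RHS]eq_bigr => t _ do rewrite cat_eq.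
case: (tact w1 s == w1) => /=; last by rewrite big1.
rewrite -big_mkcond /= mulr_sumr mulr_sumr; apply: eq_bigr => t _.
by rewrite ninvf_shuffle // e1 e2 -!exprD -!mulnDr; congr (q ^+ (2 * _)); lia.
Qed.

End OrbitFactorization.

Lemma ex_nondecr n m (w : m.-tuple 'I_n) : exists f s, nondecr f /\ tact f s = w.
Proof.
pose r := relpre (@nat_of_ord n) leq.
have : perm_eq w [tuple of sort r w] by rewrite perm_sym perm_sort.
case/tuple_permP=> s e; exists [tuple of sort r w], s; split; last by apply: val_inj.
rewrite nondecr_sorted sorted_map; apply: sort_sorted => i j; exact: leq_total.
Qed.

(** * Multiplicativity of the weight character *)

Section WeightCharacter.
Variables (K : fieldType) (q : K) (n : nat) (R : comAlgType K) (X : 'I_n -> R).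

Definition orbit_poly m (f : m.-tuple 'I_n) : K := poincare q (fun i => nat_of_ord (tnth f i)).

Definition monom m (f : m.-tuple 'I_n) : R := \prod_i X (tnth f i).

Definition weight_char m (B : Type) (act : B -> 'M[K]_(tens_dim n m)) (z : B) : R :=
  \sum_(f : m.-tuple 'I_n | nondecr f) (bra_ket f f (act z) / orbit_poly f) *: monom f.

Lemma monom_tact m (f : m.-tuple 'I_n) s : monom (tact f s) = monom f.
Proof.
rewrite /monom [RHS](reindex_inj (@perm_inj _ s)) /=.
by apply: eq_bigr => i _; rewrite tnth_tact.
Qed.

Lemma monom_cat a b (w1 : a.-tuple 'I_n) (w2 : b.-tuple 'I_n) :
  monom [tuple of w1 ++ w2] = monom w1 * monom w2.
Proof.
by rewrite /monom big_split_ord /=; congr (_ * _); apply: eq_bigr => i _;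
  rewrite ?tnth_lshift ?tnth_rshift.
Qed.

Variables (a b : nat) (A B C : algType K).
Variables (ga : 'I_a.-1 -> A) (gb : 'I_b.-1 -> B) (gc : 'I_(a + b).-1 -> C).
Hypotheses (famA : hecke_family q ga) (famB : hecke_family q gb) (famC : hecke_family q gc).
Variables (actA0 : A -> 'M[K]_(tens_dim a a)) (actB0 : B -> 'M[K]_(tens_dim b b)).
Hypotheses (repA0 : tensor_rep q ga actA0) (repB0 : tensor_rep q gb actB0).
Variables (actA : A -> 'M[K]_(tens_dim n a)) (actB : B -> 'M[K]_(tens_dim n b))
  (actC : C -> 'M[K]_(tens_dim n (a + b))).
Hypotheses (repA : tensor_rep q ga actA) (repB : tensor_rep q gb actB)
  (repC : tensor_rep q gc actC).
Hypotheses (q_nroot : forall k : nat, (0 < k)%N -> q ^+ k != 1).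
Variables (x : A) (y : B).
Local Notation Z := (shuffle_product gc actA0 actB0 x y).
Local Notation alpha w := (bra_ket w w (actA x)).
Local Notation beta w := (bra_ket w w (actB y)).

(** T_u takes the sorted word to a single ket, and by transposition T_(u^-1) does the same to the
    bra; each gives the same power of q. *)
Lemma bra_ket_conj (f : (a + b).-tuple 'I_n) u c : nondecr f ->
  bra_ket f f (actC (basis_elt gc u^-1%g * c * basis_elt gc u)) =
  q ^+ (2 * ninvf f u) * bra_ket (tact f u) (tact f u) (actC c).
Proof.
move=> nd; have ket_u L : bra_ket L f (actC (basis_elt gc u)) =
    q ^+ ninvf f u * (L == tact f u)%:R.
  by rewrite bra_ketE (act_basis_ket famC repC) // mxE ketE.
have pick (F : (a + b).-tuple 'I_n -> K) :
    \sum_L F L * (q ^+ ninvf f u * (L == tact f u)%:R) = F (tact f u) * q ^+ ninvf f u.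
  rewrite (bigD1 (tact f u)) //= eqxx mulr1 big1 ?addr0 // => L /negPf->.
  by rewrite !mulr0.
rewrite !(tr_M repC) -(act_tr famC repC) bra_ketM.
under eq_bigr => L _ do rewrite ket_u.
rewrite pick bra_ketM.
under eq_bigr => L _ do rewrite bra_ket_tr ket_u mulrC.
by rewrite pick [RHS]mulrC mul2n -addnn exprD mulrA.
Qed.

Lemma bra_ket_shuffle f : nondecr f ->
  bra_ket f f (actC Z) = \sum_(u | shuffle u) q ^+ (2 * ninvf f u) *
    (alpha (lpart (tact f u)) * beta (rpart (tact f u))).
Proof.
move=> nd; rewrite /shuffle_product (act_sum repC) bra_ket_sum; apply: eq_bigr => u _.
rewrite bra_ket_conj // -{1 2}(cat_parts (tact f u)).
by rewrite (bra_ket_emb famA famB famC repA0 repB0 repA repB repC).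
Qed.

Lemma weight_char_shuffle :
  weight_char actC Z = weight_char actA x * weight_char actB y.
Proof.
have P_neq0 m (f : m.-tuple 'I_n) : nondecr f -> orbit_poly f != 0.
  by move=> /nondecrP nd; apply: poincare_neq0.
pose Cf f (w1 : a.-tuple 'I_n) (w2 : b.-tuple 'I_n) : K :=
  \sum_(u | shuffle u && (tact f u == [tuple of w1 ++ w2])) q ^+ (2 * ninvf f u).
(* The shuffles are grouped by the two subwords they cut out of f; both are sorted because f is. *)
transitivity (\sum_(w1 : a.-tuple 'I_n | nondecr w1) \sum_(w2 : b.-tuple 'I_n | nondecr w2)
    \sum_(f | nondecr f) (Cf f w1 w2 * (alpha w1 * beta w2) / orbit_poly f) *: monom f).
  under [RHS]eq_bigr do rewrite exchange_big /=; rewrite [RHS]exchange_big /=.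
  apply: eq_bigr => f nd; rewrite bra_ket_shuffle //.
  under [RHS]eq_bigr do rewrite -scaler_suml; rewrite -scaler_suml.
  congr (_ *: _); under [RHS]eq_bigr do rewrite -mulr_suml; rewrite -mulr_suml; congr (_ / _).
  rewrite (partition_big (fun u => lpart (tact f u)) (fun w => nondecr w)) /=; last first.
    by move=> u; apply: nondecr_lpart.
  apply: eq_bigr => w1 _.
  rewrite (partition_big (fun u => rpart (tact f u)) (fun w => nondecr w)) /=; last first.
    by move=> u /andP[su _]; apply: nondecr_rpart.
  apply: eq_bigr => w2 _; rewrite mulr_suml; apply: eq_big => [u|u].
    rewrite -andbA; congr (_ && _); apply/andP/eqP => [[/eqP<- /eqP<-]|->].
      by rewrite cat_parts.
    by rewrite lpart_cat rpart_cat.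
  by case/andP=> /andP[_ /eqP->] /eqP->.
rewrite /weight_char mulr_suml; apply: eq_bigr => w1 nd1.
rewrite mulr_sumr; apply: eq_bigr => w2 nd2.
(* For given subwords only the sorted rearrangement of their concatenation contributes to the sum
   over f. *)
have [f0 [s0 [nd0 e0]]] := ex_nondecr [tuple of w1 ++ w2].
rewrite (bigD1 f0) //= [X in _ + X]big1 ?addr0 => [|f /andP[nd ne]]; last first.
  rewrite [Cf _ _ _]big1 ?mul0r ?scale0r // => u /andP[_ /eqP e].
  case/eqP: ne; rewrite -[f](tact1) -(mulVg u) tactM e -e0 -tactM.
  by apply: nondecr_tact => //; rewrite tactM e0 -e -tactM mulVg tact1.
have := orbit_weight_shuffle q nd0 nd1 nd2; rewrite -/(Cf _ _ _) -e0 orbit_weight_tact.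
rewrite orbit_weight_id // -!/(orbit_poly _) => CP.
rewrite -scalerAl -scalerAr -monom_cat -e0 monom_tact scalerA; congr (_ *: _).
have := P_neq0 _ _ nd0; rewrite -CP !mulf_eq0 !negb_or => /andP[c0 /andP[p1 p2]].
by field; rewrite c0 p1 p2.
Qed.

End WeightCharacter.

(** * Immanants of shuffle products *)

Section Increasing.
Variables (n m : nat).
Implicit Types (w : m.-tuple 'I_n).

Definition incr w := sorted ltn (map val w).

Lemma incrP w : reflect (forall i j : 'I_m, (i < j)%N -> (tnth w i < tnth w j)%N) (incr w).
Proof.
have sz : size (map val w) = m by rewrite size_map size_tuple.
apply: (iffP idP) => [srt i j ij|h].
  rewrite -!nth_map_val; apply: (sorted_ltn_nth ltn_trans 0%N srt) => //; by rewrite inE sz.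
apply/(sortedP 0%N) => i; rewrite sz => lt.
by have := h (Ordinal (ltnW lt)) (Ordinal lt) (ltnSn i); rewrite -!nth_map_val.
Qed.

Lemma incr_nondecr w : incr w -> nondecr w.
Proof. by rewrite nondecr_sorted; apply: sub_sorted => i j /ltnW. Qed.

Lemma incr_uniq w : incr w -> uniq w.
Proof. by move/(sorted_uniq ltn_trans ltnn)/map_uniq. Qed.

Lemma incr_inj w i j : incr w -> tnth w i = tnth w j -> i = j.
Proof.
move/incrP=> h e; apply: val_inj; case: (ltngtP i j) => // /h; by rewrite e ltnn.
Qed.

Lemma incr_lt w i j : incr w -> (tnth w i < tnth w j)%N = (i < j)%N.
Proof.
move=> /incrP h; case: (ltngtP i j) => [/h->//|/h/ltnW|/val_inj->]; last exact: ltnn.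
by rewrite leqNgt => /negbTE.
Qed.

Lemma incr_tact_inj w : incr w -> injective (tact w).
Proof.
move=> iw s u e; apply/permP=> i; have := congr1 (fun t => tnth t i) e.
by rewrite /= !tnth_tact; apply: incr_inj.
Qed.

Lemma ninvf_incr w u : incr w -> ninvf w u = 0%N.
Proof.
move=> iw; apply: big1 => -[i j] /andP[_ /=]; case: eqP => // /(incr_inj iw)->.
by rewrite ltnn.
Qed.

Lemma incr_perm_eq w w' : incr w -> incr w' -> perm_eq w w' -> w = w'.
Proof.
move=> iw iw' p; apply: val_inj; apply: (inj_map val_inj).
by apply: (irr_sorted_eq ltn_trans ltnn iw iw') => x; rewrite (perm_mem (perm_map val p)).
Qed.

End Increasing.

Section ShuffleSubsets.
Variables (n a b : nat) (J : (a + b).-tuple 'I_n).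
Hypothesis incrJ : incr J.
Implicit Types (u : 'S_(a + b)) (w : (a + b).-tuple 'I_n).

Lemma incr_shuffle u :
  shuffle u = incr (lpart (tact J u)) && incr (rpart (tact J u)).
Proof.
apply/idP/andP => [su|[/incrP l /incrP r]].
  by split; apply/incrP=> i j ij; rewrite !tnth_mktuple incr_lt //;
    [apply: shuffle_l | apply: shuffle_r].
apply/shuffleP; split=> k; rewrite /ascent ?left_lgap ?right_lgap ?left_rgap ?right_rgap.
  by have := l _ _ (ltnSn k : ord_left k < ord_right k)%N; rewrite !tnth_mktuple incr_lt.
by have := r _ _ (ltnSn k : ord_left k < ord_right k)%N; rewrite !tnth_mktuple incr_lt.
Qed.

Lemma ex_complement (w1 : a.-tuple 'I_n) : incr w1 -> {subset w1 <= J} ->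
  exists w2 : b.-tuple 'I_n, [/\ incr w2, perm_eq (w1 ++ w2) J &
    forall z, z \in w2 = (z \in J) && (z \notin w1)].
Proof.
move=> i1 sub1; pose s := [seq z <- J | z \notin w1].
have mem_s z : z \in s = (z \in J) && (z \notin w1) by rewrite mem_filter andbC.
have ps : perm_eq (w1 ++ s) J.
  apply: uniq_perm; rewrite ?(incr_uniq incrJ) //.
    rewrite cat_uniq incr_uniq //= filter_uniq ?(incr_uniq incrJ) // andbT.
    by apply/hasPn=> z; rewrite mem_s => /andP[].
  move=> z; rewrite mem_cat mem_s; case: (boolP (z \in w1)) => [/sub1->//|].
  by rewrite andbT.
have szs : size s == b.
  by have := perm_size ps; rewrite size_cat !size_tuple => /addnI->.
exists (Tuple szs); split=> //.
rewrite /incr sorted_map; apply: sorted_filter; first by move=> x y z; apply: ltn_trans.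
by have := incrJ; rewrite /incr sorted_map.
Qed.

(** The letters of [J] are distinct, so a shuffle is the same as a splitting of [J] into two
    increasing subwords. *)
Lemma sum_shuffle_subsets (V : nmodType) (F : a.-tuple 'I_n -> b.-tuple 'I_n -> V) :
  \sum_(u | shuffle u) F (lpart (tact J u)) (rpart (tact J u)) =
  \sum_(w1 | incr w1 && all (fun z => z \in J) w1)
    \sum_(w2 | incr w2 && perm_eq (w1 ++ w2) J) F w1 w2.
Proof.
rewrite pair_big_dep /=.
pose h u := (lpart (tact J u), rpart (tact J u)).
rewrite -(@big_imset _ _ _ _ _ h [pred u | shuffle u] (fun p => F p.1 p.2)) /=; last first.
  move=> u u' _ _ e; apply: (incr_tact_inj incrJ).
  exact: (tuple_block_ext (congr1 fst e) (congr1 snd e)).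
apply: eq_bigl => -[w1 w2] /=; apply/imsetP/idP => [[u su [-> ->]]|].
  have := su; rewrite inE incr_shuffle => /andP[-> ->] /=.
  have p : perm_eq (lpart (tact J u) ++ rpart (tact J u)) J.
    by rewrite -[_ ++ _]/(tval [tuple of _ ++ _]) cat_parts; apply/tuple_permP; exists u.
  rewrite p andbT; apply/allP=> z zl.
  by rewrite -[_ \in J]/(z \in tval J) -(perm_mem p) mem_cat zl.
case/andP=> /andP[i1 _] /andP[i2 /tuple_permP[u e]].
have {}e : [tuple of w1 ++ w2] = tact J u by apply: val_inj.
have e1 : w1 = lpart (tact J u) by rewrite -e lpart_cat.
have e2 : w2 = rpart (tact J u) by rewrite -e rpart_cat.
by exists u; rewrite /h -?e1 -?e2 // inE incr_shuffle -e1 -e2 i1 i2.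
Qed.

End ShuffleSubsets.

Section ShuffleImmanant.
Variables (K : fieldType) (q : K) (n : nat) (Q : algType K) (X : 'M[Q]_n).
Local Notation XX p := (\prod_(l < p) in_factor l X).
Local Notation M c := (map_mx (in_alg Q) c).
Hypothesis RXX : forall a b : 2.-tuple 'I_n,
  bra_ket a b (M (Rcheck q n (@ord0 1) (@ord_max 1)) *m XX 2) =
  bra_ket a b (XX 2 *m M (Rcheck q n (@ord0 1) (@ord_max 1))).

Definition imm m (B : Type) (act : B -> 'M[K]_(tens_dim n m)) (z : B) (I : m.-tuple 'I_n) : Q :=
  bra_ket I I (M (act z) *m XX m).

Lemma immE m (B : Type) (act : B -> 'M[K]_(tens_dim n m)) z I :
  imm act z I = \sum_L bra_ket I L (act z) *: \prod_l X (tnth L l) (tnth I l).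
Proof.
rewrite /imm bra_ketM; apply: eq_bigr => L _.
by rewrite bra_ket_map bra_ket_factors mulr_algl.
Qed.

Lemma act_factors_comm m (B : algType K) (g : 'I_m.-1 -> B) (act : B -> 'M[K]_(tens_dim n m)) :
  hecke_family q g -> tensor_rep q g act -> forall z, M (act z) *m XX m = XX m *m M (act z).
Proof.
move=> fam rep; elim/(hf_ind fam) => [|k x ex|x y ex ey|c x ex].
- by rewrite (tr_1 rep) map_mx1 mulmx1 mul1mx.
- by rewrite (tr_M rep) map_mxM -mulmxA ex !mulmxA (tr_gen rep) (Rcheck_factors_comm RXX).
- by rewrite (actD rep) map_mxD mulmxDl mulmxDr ex ey.
rewrite (actZ rep) map_mxZ -scalemxAl ex; apply/matrixP=> i j; rewrite !mxE mulr_sumr.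
by apply: eq_bigr => k _; rewrite !mxE /= !mulr_algl -[RHS]scalerAr.
Qed.

Variables (a b : nat) (A B C : algType K).
Variables (ga : 'I_a.-1 -> A) (gb : 'I_b.-1 -> B) (gc : 'I_(a + b).-1 -> C).
Hypotheses (famA : hecke_family q ga) (famB : hecke_family q gb) (famC : hecke_family q gc).
Variables (actA0 : A -> 'M[K]_(tens_dim a a)) (actB0 : B -> 'M[K]_(tens_dim b b)).
Hypotheses (repA0 : tensor_rep q ga actA0) (repB0 : tensor_rep q gb actB0).
Variables (actA : A -> 'M[K]_(tens_dim n a)) (actB : B -> 'M[K]_(tens_dim n b))
  (actC : C -> 'M[K]_(tens_dim n (a + b))).
Hypotheses (repA : tensor_rep q ga actA) (repB : tensor_rep q gb actB)
  (repC : tensor_rep q gc actC).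
Variables (x : A) (y : B).
Local Notation Z := (shuffle_product gc actA0 actB0 x y).

(** T_u is moved to the right through X_1 ... X_m, where it acts on the ket while T_(u^-1) acts on
    the bra. On an increasing word neither yields a power of q. *)
Lemma imm_conj (J : (a + b).-tuple 'I_n) u c : incr J ->
  imm actC (basis_elt gc u^-1%g * c * basis_elt gc u) J = imm actC c (tact J u).
Proof.
move=> iJ; have ket_u L : bra_ket L J (actC (basis_elt gc u)) = (L == tact J u)%:R.
  rewrite bra_ketE (act_basis_ket famC repC) ?incr_nondecr // mxE ketE.
  by rewrite ninvf_incr // mul1r.
rewrite /imm !(tr_M repC) !map_mxM -!mulmxA (act_factors_comm famC repC (basis_elt gc u)).
rewrite -(act_tr famC repC) bra_ketM.
under eq_bigr => L _ do rewrite bra_ket_map bra_ket_tr ket_u.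
rewrite (bigD1 (tact J u)) //= eqxx scale1r mul1r [X in _ + X]big1 ?addr0 => [|L /negPf->]; last first.
  by rewrite scale0r mul0r.
rewrite mulmxA bra_ketM.
under [LHS]eq_bigr => L _ do rewrite bra_ket_map ket_u.
rewrite (bigD1 (tact J u)) //= eqxx scale1r mulr1 [X in _ + X]big1 ?addr0 // => L /negPf->.
by rewrite scale0r mulr0.
Qed.

Lemma imm_emb (w : (a + b).-tuple 'I_n) :
  imm actC (emb_l gc actA0 x * emb_r gc actB0 y) w = imm actA x (lpart w) * imm actB y (rpart w).
Proof.
rewrite !immE [RHS]mulr_suml.
pose G (w1 : a.-tuple 'I_n) (w2 : b.-tuple 'I_n) :=
  bra_ket w [tuple of w1 ++ w2] (actC (emb_l gc actA0 x * emb_r gc actB0 y)) *: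
    \prod_l X (tnth [tuple of w1 ++ w2] l) (tnth w l).
transitivity (\sum_w1 \sum_w2 G w1 w2).
  rewrite pair_bigA /= (reindex (fun p : a.-tuple 'I_n * b.-tuple 'I_n => [tuple of p.1 ++ p.2])) //=.
  exists (fun w => (lpart w, rpart w)) => [[w1 w2] _|w' _]; last exact: cat_parts.
  by rewrite /= lpart_cat rpart_cat.
apply: eq_bigr => w1 _; rewrite mulr_sumr; apply: eq_bigr => w2 _.
rewrite /G -{1}(cat_parts w) (bra_ket_emb famA famB famC repA0 repB0 repA repB repC).
rewrite -scalerAl -scalerAr scalerA; congr (_ *: _); rewrite big_split_ord /=.
by congr (_ * _); apply: eq_bigr => i _; rewrite ?tnth_lshift ?tnth_rshift tnth_mktuple.
Qed.

Lemma imm_shuffle (J : (a + b).-tuple 'I_n) : incr J ->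
  imm actC Z J = \sum_(w1 | incr w1 && all (fun z => z \in J) w1)
    \sum_(w2 | incr w2 && perm_eq (w1 ++ w2) J) imm actA x w1 * imm actB y w2.
Proof.
move=> iJ; rewrite -sum_shuffle_subsets //.
transitivity (\sum_(u | shuffle u) imm actC (basis_elt gc u^-1%g *
    (emb_l gc actA0 x * emb_r gc actB0 y) * basis_elt gc u) J).
  rewrite /shuffle_product /imm (act_sum repC) raddf_sum mulmx_suml.
  exact: summxE.
by apply: eq_bigr => u _; rewrite imm_conj // imm_emb.
Qed.

End ShuffleImmanant.

(** * Iterated shuffle products and families of disjoint subsets *)

Section DependentCons.
Variables (l : nat) (T : 'I_l.+1 -> finType).

(** The type of an entry depends on its index, so the entry is transported along the equation that
    identifies the index; [eq_axiomK] later erases these casts. *)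
Definition cons_fun (x : T ord0) (g : {dffun forall i : 'I_l, T (lift ord0 i)}) i : T i :=
  match unliftP ord0 i in unlift_spec _ _ o return T i with
  | UnliftSome j e => ecast i (T i) (esym e) (g j)
  | UnliftNone e => ecast i (T i) (esym e) x
  end.

Definition dffun_cons x g : {dffun forall i, T i} := finfun (cons_fun x g).

Lemma dffun_cons0 x g : dffun_cons x g ord0 = x.
Proof.
rewrite ffunE /cons_fun; case: unliftP => [j e|e]; first by exfalso; move: (congr1 val e).
by rewrite (eq_axiomK e).
Qed.

Lemma dffun_consS x g i : dffun_cons x g (lift ord0 i) = g i.
Proof.
rewrite ffunE /cons_fun; case: unliftP => [j e|e].
  by have ej : j = i := esym (lift_inj e); subst j; rewrite (eq_axiomK e).
by exfalso; move: (congr1 val e).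
Qed.

Lemma sum_dffun_cons (V : nmodType) (P : pred {dffun forall i, T i}) (F : {dffun forall i, T i} -> V) :
  \sum_(f | P f) F f =
  \sum_(x : T ord0) \sum_(g : {dffun forall i : 'I_l, T (lift ord0 i)} | P (dffun_cons x g))
    F (dffun_cons x g).
Proof.
rewrite pair_big_dep /=.
rewrite (reindex (fun p : T ord0 * {dffun forall i : 'I_l, T (lift ord0 i)} => dffun_cons p.1 p.2)) //.
exists (fun f : {dffun forall i, T i} =>
  (f ord0, finfun (fun i : 'I_l => f (lift ord0 i)) : {dffun forall i : 'I_l, T (lift ord0 i)})).
  move=> [x g] _ /=; rewrite dffun_cons0; congr (_, _).
  by apply/ffunP=> i; rewrite ffunE dffun_consS.
move=> f _ /=; apply/ffunP=> i; case: (unliftP ord0 i) => [j ->|->].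
  by rewrite dffun_consS ffunE.
by rewrite dffun_cons0.
Qed.

End DependentCons.

Lemma forall_ord_recl l (P : pred 'I_l.+1) :
  [forall i, P i] = P ord0 && [forall i, P (lift ord0 i)].
Proof.
apply/forallP/andP => [h|[h0 /forallP h] i]; first by split=> //; apply/forallP=> i.
by case: (unliftP ord0 i) => [j ->|->].
Qed.

Lemma disjoint_increasing_cons n l (d : 'I_l.+1 -> nat) (x : (d ord0).-tuple 'I_n)
    (g : {dffun forall i : 'I_l, (d (lift ord0 i)).-tuple 'I_n}) :
  disjoint_increasing (dffun_cons (T := fun i => (d i).-tuple 'I_n) x g) =
  [&& incr x, [forall i, [disjoint x & g i]] & disjoint_increasing g].
Proof.
set f := dffun_cons _ _; have f0 : f ord0 = x := dffun_cons0 _ _.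
have fS i : f (lift ord0 i) = g i := dffun_consS _ _ _.
apply/andP/and3P => [[/forallP inc /forallP dis]|[ix /forallP dx /andP[/forallP ig /forallP dg]]].
  split; first by have := inc ord0; rewrite f0.
    by apply/forallP=> i; have /forallP/(_ (lift ord0 i)) := dis ord0; rewrite f0 fS.
  apply/andP; split; apply/forallP=> i; first by have := inc (lift ord0 i); rewrite fS.
  apply/forallP=> j; have /forallP/(_ (lift ord0 j)) := dis (lift ord0 i); rewrite !fS.
  by rewrite (inj_eq lift_inj).
split; apply/forallP=> i; first by case: (unliftP ord0 i) => [j ->|->]; rewrite ?fS ?f0.
apply/forallP=> j; apply/implyP.
case: (unliftP ord0 i) => [i' ->|->]; case: (unliftP ord0 j) => [j' ->|->]; rewrite ?fS ?f0.
- by rewrite (inj_eq lift_inj) => ne; have /forallP/(_ j')/implyP := dg i'; apply.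
- by rewrite disjoint_sym dx.
- by rewrite dx.
by rewrite eqxx.
Qed.

Section ProductElement.
Variables (K : fieldType) (q : K).
Hypotheses (q_neq0 : q != 0) (q_nroot : forall k : nat, (0 < k)%N -> q ^+ k != 1).
Variables (H : nat -> algType K) (g : forall m, 'I_m.-1 -> H m).
Variable act : forall n m, H m -> 'M[K]_(tens_dim n m).
Hypotheses (fam : forall m, hecke_family q (@g m))
  (rep : forall n m, tensor_rep q (@g m) (@act n m)).
Variables (r : nat) (R : comAlgType K) (Y : 'I_r -> R).
Variables (n : nat) (Q : algType K) (X : 'M[Q]_n).
Hypothesis RXX : forall a b : 2.-tuple 'I_n,
  bra_ket a b (map_mx (in_alg Q) (Rcheck q n (@ord0 1) (@ord_max 1)) *m \prod_(l < 2) in_factor l X) =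
  bra_ket a b ((\prod_(l < 2) in_factor l X) *m map_mx (in_alg Q) (Rcheck q n (@ord0 1) (@ord_max 1))).

Lemma weight_char1 (z : H 0) : z = 1 -> weight_char q Y (@act r 0) z = 1.
Proof.
move=> ->; rewrite /weight_char (big_pred1 [tuple]) => [|f]; last first.
  by rewrite (tuple0 f) [RHS]eqxx; apply/nondecrP=> -[].
rewrite (tr_1 (rep r 0)) /monom big_ord0 /bra_ket mxE eqxx /orbit_poly /poincare.
rewrite (big_pred1 1%g) => [|u]; first by rewrite ninv1 divr1 scale1r.
have -> : u = 1%g by apply/permP; case.
by rewrite stab1 /= eqxx.
Qed.

(** Stated for an arbitrary increasing [J], as the induction passes to the complement of the first
    subset, and for any [p] equal to the total degree, so that products with different degree
    sequences land in one and the same algebra. *)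
Lemma ex_product l (d : 'I_l -> nat) (chi : forall i, H (d i)) :
  (forall i k, g k * chi i = chi i * g k) ->
  forall p, p = (\sum_(i < l) d i)%N -> exists Z : H p,
  [/\ forall k, g k * Z = Z * g k,
    weight_char q Y (@act r p) Z = \prod_(i < l) weight_char q Y (@act r (d i)) (chi i) &
    forall J : p.-tuple 'I_n, incr J -> imm X (@act n p) Z J =
      \sum_(I : {dffun forall i : 'I_l, (d i).-tuple 'I_n}
           | disjoint_increasing I && [forall i, all (fun z => z \in J) (I i)])
        \prod_(i < l) imm X (@act n (d i)) (chi i) (I i)].
Proof.
elim: l d chi => [|l IH] d chi chiC p ->.
  rewrite big_ord0; exists 1; split=> [k| |J _]; first by rewrite mulr1 mul1r.
    by rewrite weight_char1 // big_ord0.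
  rewrite /imm (tr_1 (rep n 0)) map_mx1 mul1mx big_ord0 /bra_ket mxE eqxx.
  pose I0 : {dffun forall i : 'I_0, (d i).-tuple 'I_n} :=
    finfun (fun i : 'I_0 => match i with Ordinal m h => False_rect _ (notF h) end).
  rewrite (big_pred1 I0) => [|I]; first by rewrite big_ord0.
  have -> : I = I0 by apply/ffunP; case.
  rewrite [RHS]eqxx; apply/andP; split; last by apply/forallP; case.
  by apply/andP; split; apply/forallP; case.
rewrite big_ord_recl.
have [Z [ZC Zch Zimm]] := IH (fun i => d (lift ord0 i)) (fun i => chi (lift ord0 i))
  (fun i => chiC (lift ord0 i)) _ erefl.
set a := d ord0 in Z ZC Zch Zimm *; set b := (\sum_(i < l) _)%N in Z ZC Zch Zimm *.
exists (shuffle_product (@g (a + b)) (@act a a) (@act b b) (chi ord0) Z); split=> [k||J iJ].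
- exact: (shuffle_product_central (fam _) (fam _) (fam _) (rep _ _) (rep _ _) (chiC _) ZC).
- by rewrite (weight_char_shuffle Y (fam _) (fam _) (fam _) (rep _ _) (rep _ _)
    (rep _ _) (rep _ _) (rep _ _)) // Zch big_ord_recl.
rewrite (imm_shuffle RXX (fam _) (fam _) (fam _) (rep _ _) (rep _ _)
  (rep _ _) (rep _ _) (rep _ _)) //.
rewrite (sum_dffun_cons (T := fun i => (d i).-tuple 'I_n)).
rewrite big_mkcond; apply: eq_bigr => w1 _; case: ifPn => [/andP[i1 /allP sub1]|n1]; last first.
  rewrite big1 // => I /andP[]; rewrite disjoint_increasing_cons forall_ord_recl.
  rewrite dffun_cons0 => /andP[i1 _] /andP[s1 _]; by rewrite i1 s1 in n1.
(* The inner sum of [imm_shuffle] has one term: an increasing complement of the first subset is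
   unique. *)
have [w2 [i2 p2 mem2]] := ex_complement iJ i1 sub1.
rewrite (big_pred1 w2) => [|w]; last first.
  apply/andP/eqP => [[iw pw]|->//]; apply: incr_perm_eq => //.
  by rewrite -(perm_cat2l w1) (perm_trans pw) // perm_sym.
rewrite Zimm // mulr_sumr; apply: eq_big => [I|I _].
  rewrite disjoint_increasing_cons forall_ord_recl dffun_cons0 i1 /=.
  have -> /= : all (fun z => z \in J) w1 by apply/allP.
  rewrite -andbA andbCA; congr (_ && _).
  apply/forallP/andP => [h|[/forallP h1 /forallP h2] i].
    split; apply/forallP=> i.
      rewrite disjoint_sym disjoint_has; apply/hasPn=> z /(allP (h i)) /=.
      by rewrite mem2 => /andP[].
    rewrite dffun_consS; apply/allP=> z /(allP (h i)) /=.
    by rewrite mem2 => /andP[].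
  apply/allP=> z zi /=; rewrite mem2; have := allP (h2 i) z; rewrite dffun_consS => /(_ zi) -> /=.
  by apply: contraL (h1 i) => z1; rewrite disjoint_has; apply/negPn/hasP; exists z.
rewrite big_ord_recl dffun_cons0; congr (_ * _); apply: eq_bigr => i _.
by rewrite dffun_consS.
Qed.

End ProductElement.

(** * The Hecke algebra and the quantum coordinate algebra *)

Section QuantumRelation.
Variables (K : fieldType) (q : K) (n : nat) (F Q : algType K) (pi : F -> Q).
Hypotheses (piP : forall a x y, pi (a *: x + y) = a *: pi x + pi y)
  (piM : forall x y, pi (x * y) = pi x * pi y) (pi1 : pi 1 = 1).
Variable x : 'I_n * 'I_n -> F.
Let X : 'M[F]_n := \matrix_(i, j) x (i, j).
Let Y : 'M[Q]_n := \matrix_(i, j) pi (x (i, j)).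
Local Notation R A := (map_mx (in_alg A) (Rcheck q n (@ord0 1) (@ord_max 1))).

Lemma map_quantum_relation :
  (forall a b, pi ((R F *m in_factor (@ord0 1) X *m in_factor (@ord_max 1) X -
    in_factor (@ord0 1) X *m in_factor (@ord_max 1) X *m R F) a b) = 0) ->
  R Q *m \prod_(l < 2) in_factor l Y = (\prod_(l < 2) in_factor l Y) *m R Q.
Proof.
move=> rel.
have piD u v : pi (u + v) = pi u + pi v by rewrite -[u]scale1r piP !scale1r.
have pi0 : pi 0 = 0 by apply: (addIr (pi 0)); rewrite -piD !add0r.
have piZ a u : pi (a *: u) = a *: pi u by rewrite -[a *: u]addr0 piP pi0 addr0.
have piN u : pi (- u) = - pi u by rewrite -scaleN1r piZ scaleN1r.
have mapM (M N : 'M[F]_(tens_dim n 2)) : map_mx pi (M *m N) = map_mx pi M *m map_mx pi N.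
  apply/matrixP=> i j; rewrite !mxE (big_morph pi piD pi0).
  by apply: eq_bigr => k _; rewrite piM !mxE.
have eR : map_mx pi (R F) = R Q by apply/matrixP=> i j; rewrite !mxE /= piZ pi1.
have eX k : map_mx pi (in_factor k X) = in_factor k Y :> 'M_(tens_dim n 2).
  by apply/matrixP=> i j; rewrite !mxE; cbv zeta; case: [forall l, _]; rewrite ?mxE ?pi0.
have -> : \prod_(l < 2) in_factor l Y = in_factor (@ord0 1) Y *m in_factor (@ord_max 1) Y.
  rewrite !big_ord_recl big_ord0 mulr1; congr (in_factor _ _ *m in_factor _ _).
  exact: val_inj.
rewrite -!eX -eR -!mapM mulmxA; apply/matrixP=> a b.
have := rel a b; rewrite mxE piD [X in _ + pi X]mxE piN => /eqP; rewrite subr_eq0 => /eqP e.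
by rewrite [LHS]mxE e [RHS]mxE.
Qed.

End QuantumRelation.

Lemma qmat_quantum_relation (K : fieldType) (q : K) (n : nat) (a b : 2.-tuple 'I_n) :
  bra_ket a b (map_mx (in_alg (qmat q n)) (Rcheck q n (@ord0 1) (@ord_max 1)) *m
    \prod_(l < 2) in_factor l (qmat_X q n)) =
  bra_ket a b ((\prod_(l < 2) in_factor l (qmat_X q n)) *m
    map_mx (in_alg (qmat q n)) (Rcheck q n (@ord0 1) (@ord_max 1))).
Proof.
apply: (congr1 (bra_ket a b)).
apply: (@map_quantum_relation K q n (free_alg K ('I_n * 'I_n)%type) (qmat q n)
  (pres_pi (@qmat_rel K q n)) _ _ _ (@free_gen K _)).
- exact: pres_pi_is_linear.
- exact: (pres_pi_is_monoid_morphism _).2.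
- exact: (pres_pi_is_monoid_morphism _).1.
move=> i j; apply/eqP; rewrite -(linear0 (pres_pi (@qmat_rel K q n))); apply/pres_piP.
rewrite subr0; apply: Ideal_gen; exact: Qmat_RXX.
Qed.

(** Standardization shows that each semistandard tableau has exactly one nondecreasing word as its
    weight. *)
Lemma sum_ssyt (K : fieldType) (lam : intpart) (r : nat) (R : comAlgType K) (Y : 'I_r -> R) :
  \sum_(f : (psize lam).-tuple 'I_r | nondecr f) (#|ssyt_of f|%:R : K) *: monom Y f =
  \sum_(S : {ffun box lam -> 'I_r} | is_ssyt S) \prod_b Y (S b).
Proof.
have monomE f (t : syt lam) : monom Y f = \prod_b Y (label f t b).
  rewrite /monom (reindex (val t)) /=; last first.
    by exists (pos t) => i _; rewrite ?posK ?pos_syt.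
  by apply: eq_bigr => b _; rewrite ffunE.
transitivity (\sum_(f : (psize lam).-tuple 'I_r | nondecr f)
    \sum_(S in ssyt_of f) \prod_b Y (S b)).
  apply: eq_bigr => f _; rewrite (eq_bigr (fun=> monom Y f)) => [|S]; last first.
    by rewrite inE => /andP[_ /existsP[t /eqP <-]]; rewrite (monomE f t).
  by rewrite sumr_const scaler_nat.
rewrite (exchange_big_dep (fun S => is_ssyt S)) /= => [|f S _]; last by rewrite inE => /andP[].
apply: eq_bigr => S sS; have [f nd lab] := label_standardization (ssyt_weak sS).
rewrite (big_pred1 f) // => f'; rewrite !inE sS; apply/andP/eqP => [[nd' /existsP[t /eqP e]]|->].
  exact: (label_inj nd' nd (etrans e (esym lab))).
by split=> //; apply/existsP; eexists; apply/eqP; exact: lab.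
Qed.

Section CharacterOfElement.
Variables (K : fieldType) (q : K) (lam : intpart).
Local Notation m := (psize lam).
Variables (B : algType K) (g : 'I_m.-1 -> B).
Hypotheses (q_neq0 : q != 0) (fam : hecke_family q g).
Hypothesis q_nroot : forall k : nat, (0 < k)%N -> q ^+ k != 1.
Variables (d : nat) (act : B -> 'M[K]_d).
Hypotheses (act1 : act 1 = 1%:M) (actM : forall x y, act (x * y) = act x *m act y)
  (actP : forall a x y, act (a *: x + y) = a *: act x + act y).
Variables (v : syt lam -> 'cV[K]_d).
Hypothesis v_basis : basis_of fullv (codom v).
Hypothesis jm_v : forall t l,
  act (jm q g l) *m v t = q ^ (2 * content (pos t l)) *: v t.
Variables (act0 : B -> 'M[K]_(tens_dim m m)) (r : nat) (actr : B -> 'M[K]_(tens_dim r m)).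
Hypotheses (rep0 : tensor_rep q g act0) (rep : tensor_rep q g actr).
Local Notation chi := (trace_elt g (fun x => \tr (act x))).

Lemma mxtrace_actP a x y : \tr (act (a *: x + y)) = a * \tr (act x) + \tr (act y).
Proof. by rewrite actP linearP. Qed.

Lemma mxtrace_actC x y : \tr (act (x * y)) = \tr (act (y * x)).
Proof. by rewrite !actM mxtrace_mulC. Qed.

Lemma weight_char_trace_elt (R : comAlgType K) (Y : 'I_r -> R) :
  weight_char q Y actr chi = \sum_(S : {ffun box lam -> 'I_r} | is_ssyt S) \prod_b Y (S b).
Proof.
rewrite -sum_ssyt /weight_char; apply: eq_bigr => f nd; congr (_ *: _).
rewrite (bra_ket_symm fam rep0 rep nd) (tform_trace_elt fam rep0 mxtrace_actP).
rewrite (trace_symm q_neq0 fam q_nroot act1 actM actP v_basis jm_v nd) /orbit_poly.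
rewrite mulrAC divff ?mul1r //; apply: poincare_neq0 => //; exact: (nondecrP _ nd).
Qed.

End CharacterOfElement.

Lemma symm_ext (K : fieldType) (q : K) m (B : algType K) (g : 'I_m.-1 -> B) (F G : 'I_m -> nat) :
  F =1 G -> symm q g F = symm q g G.
Proof.
by move=> FG; apply: eq_bigl => u; apply: eq_forallb => i; rewrite !FG.
Qed.

(** * Central elements are detected by their weight character *)

Section CentralElement.
Variables (K : fieldType) (q : K) (n : nat) (B : algType K) (g : 'I_n.-1 -> B).
Variable act : B -> 'M[K]_(tens_dim n n).
Hypotheses (q_neq0 : q != 0) (fam : hecke_family q g) (rep : tensor_rep q g act).
Hypothesis q_nroot : forall k : nat, (0 < k)%N -> q ^+ k != 1.
Variable z : B.
Hypothesis zC : forall k, g k * z = z * g k.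

(** Centrality makes tau(z y) a trace function of y. By [bra_ket_symm] its value on a parabolic
    symmetrizer is a diagonal coefficient of z, so it vanishes, and tau is nondegenerate. *)
Lemma central_eq0 : (forall f, nondecr f -> bra_ket f f (act z) = 0) -> z = 0.
Proof.
move=> z0; apply: (tform_nondeg fam rep).
have zxC x : x * z = z * x.
  elim/(hf_ind fam): x => [|k x ex|x y ex ey|c x ex].
  - by rewrite mulr1 mul1r.
  - by rewrite -mulrA ex mulrA zC mulrA.
  - by rewrite mulrDl mulrDr ex ey.
  by rewrite -scalerAl -scalerAr ex.
apply: (tr_symm_eq0 q_neq0 fam q_nroot (tr := fun y => tform act (z * y))) => [c x y|x y|J].
- by rewrite mulrDr -scalerAr /tform (bcoordP rep).
- by rewrite (tformC fam rep) -mulrA zxC (tformC fam rep) -!mulrA (tformC fam rep) -mulrA zxC.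
(* Block indices never exceed positions, so they can serve as the letters of a word in n letters. *)
have lt i : (block J i < n)%N by apply: leq_ltn_trans (block_le J i) (ltn_ord i).
pose f := [tuple Ordinal (lt i) | i < n].
have nd : nondecr f by apply/nondecrP=> i j ij; rewrite !tnth_mktuple /=; apply: block_nd.
rewrite (@symm_ext _ q _ _ g _ (fun i => nat_of_ord (tnth f i))) => [|i]; last by rewrite tnth_mktuple.
by rewrite -(bra_ket_symm fam rep rep nd) z0.
Qed.

Lemma monomX r m (f : m.-tuple 'I_r) :
  monom (fun i => 'X_i : mpoly.mpoly r K) f = 'X_[[multinom count_mem j f | j < r]].
Proof.
have e : [multinom count_mem j f | j < r] = (\sum_(i < m) U_(tnth f i))%MM.
  apply/mnmP=> j; rewrite mnmE mnm_sumE -sum1_count [LHS]big_mkcond /=.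
  by rewrite big_tuple; apply: eq_bigr => i _; rewrite mnm1E; case: eqP.
by rewrite /monom e (big_morph _ (@mpolyXD _ _) (@mpolyX0 _ _)).
Qed.

(** Different sorted words give different monomials, so each coefficient of the polynomial vanishes
    separately. *)
Lemma weight_char_eq0 : weight_char q (fun i => 'X_i : mpoly.mpoly n K) act z = 0 ->
  forall f, nondecr f -> bra_ket f f (act z) = 0.
Proof.
move=> z0 f nd; have /(congr1 (mcoeff [multinom count_mem j f | j < n])) := z0.
rewrite /weight_char raddf_sum mcoeff0 (bigD1 f) //= big1 ?addr0 => [|f' /andP[nd' ne]].
  rewrite mcoeffZ monomX mcoeffX eqxx mulr1 => /eqP.
  rewrite mulf_eq0 invr_eq0 => /orP[/eqP //|/eqP P0].
  by have := poincare_neq0 q_nroot (nondecrP _ nd); rewrite -/(orbit_poly q f) P0 eqxx.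
rewrite mcoeffZ monomX mcoeffX; case: eqP => [/mnmP e|_]; last by rewrite mulr0.
case/eqP: ne; apply: val_inj; apply: (inj_map val_inj).
apply: (sorted_eq leq_trans anti_leq); rewrite -?nondecr_sorted //.
by apply: perm_map; apply/allP=> j _ /=; have := e j; rewrite !mnmE => ->.
Qed.

End CentralElement.

Section HeckeCharacter.
Variables (K : fieldType) (q : K) (lam : intpart) (V : specht_module q lam).
Hypothesis q_neq0 : q != 0.
Hypothesis q_nroot : forall k : nat, (0 < k)%N -> q ^+ k != 1.
Let fam : hecke_family q (@hecke_gen K q (psize lam)) := hecke_gens _ q_neq0.
Let rep n : tensor_rep q (@hecke_gen K q (psize lam)) (@tens_act K q (psize lam) n) :=
  tens_act_rep n _ q_neq0.

Let sm_spec : [/\ sm_act V 1 = 1%:M,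
  forall x y, sm_act V (x * y) = sm_act V x *m sm_act V y &
  forall a x y, sm_act V (a *: x + y) = a *: sm_act V x + sm_act V y].
Proof.
split; [exact: (rmorph1 (sm_act V)) | exact: (rmorphM (sm_act V)) | exact: (linearP (sm_act V))].
Qed.

Lemma char_elt_central k : hecke_gen q k * char_elt V = char_elt V * hecke_gen q k.
Proof.
have [s1 sM sP] := sm_spec.
exact: (trace_elt_central fam (rep _) (mxtrace_actP sP) (mxtrace_actC sM)).
Qed.

Lemma weight_char_char_elt n :
  weight_char q (fun i => 'X_i : mpoly.mpoly n K) (@tens_act K q (psize lam) n) (char_elt V) =
  schur K n lam.
Proof.
have [s1 sM sP] := sm_spec.
apply: (weight_char_trace_elt q_neq0 fam q_nroot s1 sM sP (sm_basis V) _ (rep _) (rep n)) => t l.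
by rewrite -(@sm_jucys_murphy K q lam V t (pos t l)) posK.
Qed.

End HeckeCharacter.

Section Linearity.
Variables (K : fieldType) (q : K) (m : nat) (B : algType K) (g : 'I_m.-1 -> B).
Variables (n : nat) (act : B -> 'M[K]_(tens_dim n m)).
Hypothesis rep : tensor_rep q g act.
Variables (N : nat) (a : 'I_N -> K) (Z : 'I_N -> B).

Lemma weight_char_sum (R : comAlgType K) (Y : 'I_n -> R) :
  weight_char q Y act (\sum_j a j *: Z j) = \sum_j a j *: weight_char q Y act (Z j).
Proof.
rewrite /weight_char; under [RHS]eq_bigr do rewrite scaler_sumr.
rewrite exchange_big /=; apply: eq_bigr => f _.
rewrite (act_sum rep) bra_ket_sum mulr_suml scaler_suml; apply: eq_bigr => j _.
by rewrite (actZ rep) bra_ketZ scalerA mulrA.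
Qed.

Lemma imm_sum (Q : algType K) (X : 'M[Q]_n) I :
  imm X act (\sum_j a j *: Z j) I = \sum_j a j *: imm X act (Z j) I.
Proof.
rewrite immE; under [RHS]eq_bigr do rewrite immE scaler_sumr.
rewrite exchange_big /=; apply: eq_bigr => L _.
rewrite (act_sum rep) bra_ket_sum scaler_suml; apply: eq_bigr => j _.
by rewrite (actZ rep) bra_ketZ scalerA.
Qed.

Lemma central_sum : (forall j k, g k * Z j = Z j * g k) ->
  forall k, g k * (\sum_j a j *: Z j) = (\sum_j a j *: Z j) * g k.
Proof.
move=> ZC k; rewrite mulr_sumr mulr_suml; apply: eq_bigr => j _.
by rewrite -scalerAr -scalerAl ZC.
Qed.

End Linearity.

Theorem theorem4p1 (R : realType) (q : R[i]) (q_neq0 : q != 0)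
    (q_not_root_of_unity : forall k : nat, (0 < k)%N -> q ^+ k != 1)
    (V : forall lam : intpart, specht_module q lam)
    (n : nat) (n_gt0 : (0 < n)%N)
    (N : nat) (a : 'I_N -> R[i]) (l : 'I_N -> nat)
    (lam : forall j : 'I_N, 'I_(l j) -> intpart)
    (lam_nonempty : forall (j : 'I_N) (i : 'I_(l j)), (0 < psize (lam j i))%N)
    (lam_degree : forall j : 'I_N, (\sum_(i < l j) psize (lam j i))%N = n)
    (schur_relation : forall k : nat,
       \sum_(j < N) a j *: \prod_(i < l j) schur R[i] k (lam j i) = 0) :
  \sum_(j < N) a j *:
    \sum_(I : {dffun forall i : 'I_(l j), (psize (lam j i)).-tuple 'I_n}
          | disjoint_increasing I)
      \prod_(i < l j) immanant (char_elt (V (lam j i))) (I i) = 0.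
Proof.
pose Y i : mpoly.mpoly n R[i] := 'X_i.
have fam m : hecke_family q (@hecke_gen _ q m) by apply: hecke_gens.
have rep r m : tensor_rep q (@hecke_gen _ q m) (@tens_act _ q m r) by apply: tens_act_rep.
have /fin_all_exists[Z Zspec] j := ex_product q_not_root_of_unity fam rep Y
  (qmat_quantum_relation q (n := n))
  (chi := fun i => char_elt (V (lam j i))) (fun i => char_elt_central (V (lam j i)) q_neq0)
  (esym (lam_degree j)).
have Z0 : \sum_j a j *: Z j = 0.
  apply: (central_eq0 q_neq0 (fam n) (rep n n) q_not_root_of_unity).
    by apply: central_sum => j; have [] := Zspec j.
  apply: (weight_char_eq0 q_not_root_of_unity).
  (* The relation is taken in n variables, matching the words of length n in n letters on which
     [central_eq0] tests the element. *)
  rewrite (weight_char_sum (rep n n)) -[RHS](schur_relation n); apply: eq_bigr => j _.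
  have [_ -> _] := Zspec j; congr (_ *: _); apply: eq_bigr => i _.
  exact: weight_char_char_elt.
have incr_id : incr (ord_tuple n) by apply/incrP=> i j; rewrite !tnth_ord_tuple.
transitivity (imm (qmat_X q n) (@tens_act _ q n n) (\sum_j a j *: Z j) (ord_tuple n)).
  rewrite (imm_sum (rep n n)); apply: eq_bigr => j _; congr (_ *: _).
  have [_ _ ->] := Zspec j; last exact: incr_id.
  (* The word (1, ..., n) contains every letter, so the containment condition of [ex_product] always
     holds. *)
  apply: eq_bigl => I; rewrite [X in _ && X](_ : _ = true) ?andbT //.
  by apply/forallP=> i; apply/allP=> x _; apply/tnthP; exists x; rewrite tnth_ord_tuple.
rewrite Z0 immE big1 // => L _.
by rewrite (act0 (rep n n)) /bra_ket mxE scale0r.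
Qed.
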